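(* Let $\Omega\subset\mathbb{R}^2$ be a bounded strictly convex domain with $C^2$ boundary $\partial\Omega$, let $\Lambda\subset\partial\Omega$ be an arc of its boundary, and let $\Omega^+\subset\Omega$ be the subset enclosed by $\Lambda$ and by the chord $L$ joining the endpoints of $\Lambda$. Let $1/2<\mu<1$ and let $a\in C^{1,\mu}(\overline\Omega)$ be a known real valued function, extended by zero outside $\overline\Omega$. Then, for every real valued $f\in C_0^{1,\mu}(\Omega)$, the restriction $f|_{\Omega^+}$ can be reconstructed from the partial attenuated $X$-ray data $X_a f|_{\Lambda_+}$. That is, there is a map $\mathcal{R}$, depending only on $\Omega$, $\Lambda$ and $a$ (and not on $f$), such that $$\mathcal{R}\big(X_a f|_{\Lambda_+}\big)=f|_{\Omega^+}\quad\text{for every real valued } f\in C_0^{1,\mu}(\Omega);$$ equivalently, if $f_1,f_2\in C_0^{1,\mu}(\Omega)$ are real valued and $X_af_1=X_af_2$ on $\Lambda_+$, then $f_1=f_2$ on $\Omega^+$.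
   Context: $\mathbf{S}^1$ is the unit circle of directions in $\mathbb{R}^2$, and $\nu(\zeta)$ is the outer unit normal to $\partial\Omega$ at $\zeta\in\partial\Omega$. An arc $\Lambda$ of $\partial\Omega$ is a connected proper piece of the boundary curve with two distinct endpoints. The chord $L$ joining these endpoints splits $\Omega$ into two subdomains; $\Omega^+$ is the one whose boundary is $\Lambda\cup L$ (together with the endpoints). $C^{1,\mu}(\overline\Omega)$ is the usual Hölder space, and $C_0^{1,\mu}(\Omega)$ is the space of $C^{1,\mu}$ functions with compact support in $\Omega$; such functions are extended by zero to $\mathbb{R}^2$. The divergence beam transform of $a$ is $Da(z,\theta)=\int_0^\infty a(z+t\theta)\,dt$. The attenuated $X$-ray transform of $f$ is $$X_af(z,\theta)=\int_{-\infty}^{\infty} f(z+s\theta)\,e^{-Da(z+s\theta,\theta)}\,ds,\qquad \theta\in\mathbf{S}^1.$$ The data set is $\Lambda_+=\{(\zeta,\theta)\in\Lambda\times\mathbf{S}^1:\ \nu(\zeta)\cdot\theta>0\}$, i.e. the data are the values of $X_af(\zeta,\theta)$ for $(\zeta,\theta)\in\Lambda_+$. *)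

(* Defs.v *)
From HB Require Import structures.
From mathcomp Require Import all_boot all_order all_algebra.
From mathcomp Require Import all_classical all_reals all_analysis.

Set Implicit Arguments.
Unset Strict Implicit.
Unset Printing Implicit Defensive.
Import Order.TTheory GRing.Theory Num.Theory.
Import numFieldNormedType.Exports.
Local Open Scope classical_set_scope.
Local Open Scope ring_scope.

Section Plane.
Context {R : realType}.
Local Notation plane := 'rV[R]_2.
Implicit Types (x y z p q n e theta zeta : plane) (g : R -> R) (f a : plane -> R)
  (Omega Lambda A : set plane).

(* The norm `|_| that the library puts on 'rV[R]_2 is the sup norm: it has the
   same topology, but directions and distances below are Euclidean. *)
Definition dotv x y : R := \sum_i x 0 i * y 0 i.
Definition enorm x : R := Num.sqrt (dotv x x).
Definition unit_circle : set plane := [set theta | enorm theta = 1].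

Definition boundary A : set plane := closure A `\` interior A.

Definition chord p q : set plane :=
  [set (1 - t) *: p + t *: q | t in `[0, 1]%classic].

Definition domain Omega := [/\ open Omega, connected Omega & Omega !=set0].

(* Stated on the closure, since an open set with a condition on its own points
   only would merely be convex; no curvature bound is required. *)
Definition strictly_convex Omega :=
  forall x y (t : R), closure Omega x -> closure Omega y -> x != y ->
    0 < t < 1 -> Omega ((1 - t) *: x + t *: y).

Definition C2_function g :=
  [/\ forall s, derivable g s 1, forall s, derivable g^`()%classic s 1
    & continuous g^`(2)%classic].

(* In the orthonormal frame (e, n) centred at zeta, the set Omega is, near zeta,
   the strict subgraph of g. *)
Definition local_subgraph Omega zeta e n g :=
  [/\ enorm e = 1, enorm n = 1, dotv e n = 0
    & \forall z \near zeta,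
        Omega z <-> dotv (z - zeta) n < g (dotv (z - zeta) e)].

Definition C2_boundary Omega :=
  forall zeta, boundary Omega zeta ->
    exists e n g, C2_function g /\ local_subgraph Omega zeta e n g.

Definition is_outer_normal Omega zeta (v : plane) :=
  exists e n g,
    [/\ C2_function g, local_subgraph Omega zeta e n g
      & v = (Num.sqrt (1 + (g^`()%classic 0) ^+ 2))^-1 *: (n - g^`()%classic 0 *: e)].

(* is_outer_normal Omega zeta determines v, whatever the frame used; the value
   0 is only taken where Omega has no C^2 boundary. *)
Definition outer_normal Omega zeta : plane :=
  xget 0 (is_outer_normal Omega zeta).

(* The endpoints are the boundary points of Lambda relative to the curve;
   each of them may or may not belong to Lambda. *)
Definition arc_with_endpoints Omega Lambda p q :=
  [/\ connected Lambda, Lambda `<` boundary Omega, p != q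
    & closure Lambda `&` closure (boundary Omega `\` Lambda) = [set p; q]].

(* The connected component of Omega minus the chord whose boundary consists of
   Lambda and of the (closed) chord. *)
Definition cap_domain Omega Lambda p q : set plane :=
  [set z | (Omega `\` chord p q) z /\
     boundary (connected_component (Omega `\` chord p q) z)
       = Lambda `|` chord p q].

(* C^{1,mu}(closure Omega) for a bounded convex Omega: there, the uniform Holder
   condition on Omega already provides boundedness of the partial derivatives
   and their continuous extension to the closure. *)
Definition C1holder (mu : R) Omega f :=
  [/\ {within closure Omega, continuous f},
      forall x, Omega x -> differentiable f x
    & exists C : R, forall (i : 'I_2) x y, Omega x -> Omega y ->
        `|'D_(delta_mx 0 i) f x - 'D_(delta_mx 0 i) f y|
          <= C * enorm (x - y) `^ mu].

(* Functions on Omega with compact support are identified with their extension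
   by zero to the whole plane. *)
Definition C1holder0 (mu : R) Omega f :=
  [/\ C1holder mu Omega f,
      compact (closure [set x | f x != 0])
    & closure [set x | f x != 0] `<=` Omega].

Definition divergence_beam a z theta : R :=
  \int[@lebesgue_measure R]_(t in `[0, +oo[) a (z + t *: theta).

Definition attenuated_xray a f (l : plane * plane) : R :=
  \int[@lebesgue_measure R]_s
    (f (l.1 + s *: l.2) * expR (- divergence_beam a (l.1 + s *: l.2) l.2)).

Definition Lambda_plus Omega Lambda : set (plane * plane) :=
  [set l | [/\ Lambda l.1, unit_circle l.2
             & 0 < dotv (outer_normal Omega l.1) l.2]].

End Plane.

(* Main.v *)
(* By choice, it suffices to show that X_a f = 0 on Lambda_+ forces f = 0 on the
   cap. Put the chord, or a parallel chord at height c inside the cap, on the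
   x-axis. A line through (x0, 0) with x0 outside the box containing Omega meets
   the upper half of Omega only inside the cap, so there the upper half-line
   integral U(x0, phi) of f e^{-b} vanishes, where b is half the difference of
   the forward and backward beam transforms of a; on each line b differs from Da
   by a constant. Let C = conj b be the conjugate function of b in phi. Since b
   is odd under phi -> phi + pi, exp(-b - iC) times a positive power of cis phi
   has zero mean, and C is constant along lines. Testing this against
   f(x,y) (x sin phi - y cos phi)^k and integrating over the upper half plane
   shows that the moments in x0 of U(x0, .) e^{-iC}, hence this function itself,
   have no Fourier coefficient of negative order. Multiplying by exp(b + iC) gives
   the same for the real function U e^b, which is then constant, and it is 0 at
   phi = 0. At phi = pi/2 this says that the integral of f e^{-b} over the part of
   a vertical line above height c vanishes for every c, whence f = 0. *)
Require Import Defs.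
From HB Require Import structures.
From mathcomp Require Import all_boot all_order all_algebra.
From mathcomp Require Import all_classical all_reals all_analysis.
From mathcomp Require Import measurable_realfun complex ring lra.
Set Implicit Arguments.
Unset Strict Implicit.
Unset Printing Implicit Defensive.
Import Order.TTheory GRing.Theory Num.Theory.
Import numFieldNormedType.Exports.
Local Open Scope classical_set_scope.
Local Open Scope ring_scope.

(** * Signed integrals over segments *)

(** Extended by zero, [a] may jump across the boundary of [Omega], while the conjugate function is
    built from a Lipschitz coefficient. Where [f] lives, only the derivative of the attenuation
    along a line counts, so [a] can be replaced by a Lipschitz function of bounded support that
    equals it on [closure Omega]; on each line this changes the weight by a positive factor
    independent of [f]. [C] is constant along lines by polar coordinates: its kernel, 1 over the
    sine of the angle to the line, is the polar Jacobian divided by the distance to the line. Up to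
    a factor, [C] is thus the integral of [a] over the plane against the reciprocal of the signed
    distance to the line, whichever point of the line was the centre. Hardy spaces appear as
    vanishing Fourier coefficients. They are stable under products with polynomials P in cis phi,
    hence under exp P, the limit of (1 + P / n) ^ n. The powers of cis phi turn the weights (x sin
    phi - y cos phi)^k into such polynomials. Lines parallel to the axis carry no data; a factor sin
    phi removes them, and the sines are divided out at the end with the Riemann-Lebesgue lemma. *)

Lemma continuous_pair (S T U : topologicalType) (f : S -> T) (g : S -> U) :
  continuous f -> continuous g -> continuous (fun s => (f s, g s)).
Proof.
move=> cf cg s.
have := cvg_pair (cf s) (cg s); exact.
Qed.

Lemma continuous_comp2 (S T U V : topologicalType) (f : S -> T) (g : S -> U)
    (h : T -> U -> V) :
  continuous (fun p : T * U => h p.1 p.2) -> continuous f -> continuous g ->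
  continuous (fun s => h (f s) (g s)).
Proof.
move=> ch cf cg s.
apply: (@continuous_comp _ _ _ (fun s => (f s, g s)) (fun p => h p.1 p.2)).
  exact: continuous_pair.
exact: ch.
Qed.

Section SignedIntegral.
Context {R : realType}.
Local Notation mu := (@lebesgue_measure R).
Implicit Types (F G : R -> R) (a b c x y : R).

(** Continuity is too narrow here: the integrand [cdiff] of the conjugate function is a quotient
    that may jump where the sine vanishes. Local boundedness with measurability survives sums and
    products and gives integrability on every segment. *)
Definition tame F := measurable_fun setT F /\
  forall r, exists M, forall x, `|x| <= r -> `|F x| <= M.

(** Oriented, so that additivity over endpoints and affine substitutions hold whatever the order of
    the endpoints. *)
Definition sint a b F : R :=
  if a <= b then \int[mu]_(x in `[a, b]) F x
  else - \int[mu]_(x in `[b, a]) F x.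

Lemma tame_integrable F a b : tame F -> mu.-integrable `[a, b] (EFin \o F).
Proof.
move=> [mF bF]; apply: measurable_bounded_integrable => //.
- rewrite [ltLHS](lebesgue_measure_itv `[a, b]) /=; case: ifP => _ //.
  by rewrite -EFinD ltry.
- exact: measurable_funTS.
- have [M HM] := bF (Num.max `|a| `|b|).
  exists M; split; first exact: num_real.
  move=> N MN x /=; rewrite in_itv/= => /andP[ax xb].
  apply: le_trans (ltW MN); apply: HM.
  rewrite ler_norml; apply/andP; split.
    apply: le_trans ax; rewrite lerNl; apply: le_trans (ler_norm _) _.
    by rewrite normrN le_max lexx.
  by apply: le_trans xb _; apply: le_trans (ler_norm _) _; rewrite le_max lexx orbT.
Qed.

Lemma tame_integrableS F a b (A : set R) : tame F -> measurable A ->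
  A `<=` `[a, b] -> mu.-integrable A (EFin \o F).
Proof.
move=> tF mA Aab; apply: (@integrableS _ _ _ mu `[a, b]%classic A) => //; exact: tame_integrable.
Qed.

Lemma continuous_tame F : continuous F -> tame F.
Proof.
move=> cF; split; first exact: continuous_measurable_fun.
move=> r.
have [r0|r0] := ltP r 0.
  by exists 0 => x xr; have := le_lt_trans xr r0; rewrite normr_lt0.
have rr : -r <= r by lra.
have [c _ Hc] := @EVT_max R (fun x => `|F x|) (-r) r rr
  (continuous_subspaceT (fun x => cvg_norm (cF x))).
by exists `|F c| => x; rewrite ler_norml => xr; apply: Hc; rewrite in_itv.
Qed.

Lemma tameD F G : tame F -> tame G -> tame (fun x => F x + G x).
Proof.
move=> [mF bF] [mG bG]; split; first exact: measurable_funD.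
move=> r; have [M HM] := bF r; have [N HN] := bG r.
by exists (M + N) => x xr; rewrite (le_trans (ler_normD _ _))// lerD ?HM ?HN.
Qed.

Lemma tameM F G : tame F -> tame G -> tame (fun x => F x * G x).
Proof.
move=> [mF bF] [mG bG]; split; first exact: measurable_funM.
move=> r; have [M HM] := bF r; have [N HN] := bG r.
by exists (M * N) => x xr; rewrite normrM ler_pM ?HM ?HN.
Qed.

Lemma tame_cst (k : R) : tame (fun _ => k).
Proof. by split; [exact: measurable_cst | move=> r; exists `|k|]. Qed.

Lemma tameZ k F : tame F -> tame (fun x => k * F x).
Proof. by move=> tF; exact: (tameM (tame_cst k) tF). Qed.

Lemma tameN F : tame F -> tame (fun x => - F x).
Proof.
move=> tF; rewrite (_ : (fun x => - F x) = (fun x => -1 * F x)); first exact: tameZ.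
by apply/funext => x; rewrite mulN1r.
Qed.

Lemma tameB F G : tame F -> tame G -> tame (fun x => F x - G x).
Proof. by move=> tF /tameN; exact: tameD. Qed.

Lemma tame_norm F : tame F -> tame (fun x => `|F x|).
Proof.
move=> [mF bF]; split; first exact: measurableT_comp.
by move=> r; have [M HM] := bF r; exists M => x /HM; rewrite normr_id.
Qed.

Lemma sint_le a b F : a <= b -> sint a b F = \int[mu]_(x in `[a, b]) F x.
Proof. by rewrite /sint => ->. Qed.

Lemma sint0 a F : sint a a F = 0.
Proof. by rewrite sint_le// set_itv1 Rintegral_set1. Qed.

Lemma sintC a b F : sint b a F = - sint a b F.
Proof.
have [ab|ab|<-] := ltgtP a b; last by rewrite sint0 oppr0.
- by rewrite /sint (ltW ab) leNgt ab.
- by rewrite /sint (ltW ab) [a <= b]leNgt ab opprK.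
Qed.

Lemma sintD a b F G : tame F -> tame G ->
  sint a b (fun x => F x + G x) = sint a b F + sint a b G.
Proof.
by move=> tF tG; rewrite /sint; case: ifP => _;
  rewrite RintegralD//; do ?exact: tame_integrable; rewrite opprD.
Qed.

Lemma sintZ a b k F : tame F -> sint a b (fun x => k * F x) = k * sint a b F.
Proof.
by move=> tF; rewrite /sint; case: ifP => _;
  rewrite RintegralZl//; do ?exact: tame_integrable; rewrite mulrN.
Qed.

Lemma sintZr a b k F : tame F -> sint a b (fun x => F x * k) = sint a b F * k.
Proof.
move=> tF; rewrite mulrC -sintZ//; congr sint.
by apply/funext => x; rewrite mulrC.
Qed.

Lemma sintN a b F : tame F -> sint a b (fun x => - F x) = - sint a b F.
Proof.
move=> tF; rewrite -mulN1r -sintZ//; congr sint.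
by apply/funext => x; rewrite mulN1r.
Qed.

Lemma sintB a b F G : tame F -> tame G ->
  sint a b (fun x => F x - G x) = sint a b F - sint a b G.
Proof. by move=> tF tG; rewrite sintD ?sintN//; exact: tameN. Qed.

Lemma eq_sint a b F G : a <= b -> (forall x, a <= x <= b -> F x = G x) ->
  sint a b F = sint a b G.
Proof.
move=> ab FG; rewrite !sint_le//; apply: eq_Rintegral => x /set_mem.
by rewrite /= in_itv/= => /FG.
Qed.

Lemma sint_cst a b k : sint a b (fun _ => k) = k * (b - a).
Proof.
have H c d : c <= d -> \int[mu]_(x in `[c, d]) k = k * (d - c).
  move=> cd; rewrite Rintegral_cst//= lebesgue_measure_itv/= lte_fin.
  move: cd; rewrite le_eqVlt => /predU1P[->|->//].
  by rewrite ltxx subrr.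
rewrite /sint; case: ifPn => [/H//|]; rewrite -ltNge => /ltW/H ->.
by rewrite -mulrN opprB.
Qed.

Lemma ler_sint a b F G : a <= b -> tame F -> tame G ->
  (forall x, a <= x <= b -> F x <= G x) -> sint a b F <= sint a b G.
Proof.
move=> ab tF tG FG; rewrite !sint_le//; apply: le_Rintegral => //.
1,2: exact: tame_integrable.
Qed.

Let itv_chasles a b c F : tame F -> a <= b -> b <= c ->
  \int[mu]_(x in `[a, b]) F x + \int[mu]_(x in `[b, c]) F x
  = \int[mu]_(x in `[a, c]) F x.
Proof.
move=> tF ab bc.
have i1 : mu.-integrable `[a, c] (EFin \o F) by exact: tame_integrable.
rewrite -(Rintegral_itv_obnd_cbnd (r := b) (b := BRight c)); last first.
  apply: (@tame_integrableS F b c) => //.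
  by apply: subset_itvr; rewrite bnd_simp.
rewrite -(Rintegral_itvB i1) ?bnd_simp//.
by rewrite addrC subrK.
Qed.

Lemma sint_chasles b a c F : tame F -> sint a b F + sint b c F = sint a c F.
Proof.
move=> tF.
have H u v w : u <= v -> v <= w -> sint u v F + sint v w F = sint u w F.
  by move=> uv vw; rewrite !sint_le//; [exact: itv_chasles|exact: le_trans vw].
have [ab|/ltW ab] := leP a b; have [bc|/ltW bc] := leP b c.
- exact: H.
- have [ac|/ltW ac] := leP a c.
  + by rewrite -(H a c b)// (sintC c b) addrK.
  + by rewrite (sintC c b) (sintC c a) -(H c a b)// opprD addrCA subrr addr0.
- have [ac|/ltW ac] := leP a c.
  + by rewrite (sintC b a) -(H b a c)// addKr.
  + by rewrite (sintC b a) -(H b c a)// opprD addrAC addNr add0r sintC opprK.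
- by rewrite (sintC b a) (sintC c b) (sintC c a) -(H c b a)// opprD addrC.
Qed.

Lemma sint_bound M a b F : tame F ->
  (forall x, Num.min a b <= x <= Num.max a b -> `|F x| <= M) ->
  `|sint a b F| <= M * `|b - a|.
Proof.
wlog ab : a b / a <= b => [H|] tF FM.
  have [/H|/ltW ba] := leP a b; first exact.
  rewrite sintC normrN distrC; apply: H => // x.
  by rewrite minC maxC; exact: FM.
rewrite min_l// max_r// in FM; rewrite (ger0_norm (x := b - a)) ?subr_ge0//.
rewrite -(sint_cst a b M) ler_norml -sintN; last exact: tame_cst.
by apply/andP; split; apply: ler_sint => //; try exact: tame_cst;
  move=> x /FM; rewrite ler_norml => /andP[].
Qed.

Lemma ler_sint_norm a b F : a <= b -> tame F ->
  `|sint a b F| <= sint a b (fun x => `|F x|).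
Proof.
move=> ab tF; rewrite !sint_le//; apply: le_normr_Rintegral => //.
exact: tame_integrable.
Qed.

Lemma sint_eq0 a b F : (forall x, Num.min a b <= x <= Num.max a b -> F x = 0) ->
  sint a b F = 0.
Proof.
wlog ab : a b / a <= b => [H|] F0.
  have [/H|/ltW ba] := leP a b; first exact.
  by rewrite sintC H ?oppr0// => x; rewrite minC maxC; exact: F0.
rewrite min_l// max_r// in F0.
by rewrite (@eq_sint _ _ F (fun=> 0))// sint_cst mul0r.
Qed.

Lemma sint_ext a b F G : F =1 G -> sint a b F = sint a b G.
Proof. by move=> /funext ->. Qed.

Lemma is_derive_eps (f : R -> R) (x l : R) :
  (forall e, 0 < e -> \forall h \near (0 : R),
     `|f (x + h) - f x - h * l| <= e * `|h|) -> is_derive x 1 f l.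
Proof.
move=> H.
have Hc : h^-1 *: ((f \o shift x) (h *: (1:R)) - f x) @[h --> (0:R)^'] --> l.
  apply/cvgrPdist_le => e e0.
  rewrite /dnbhs near_withinE; near=> h => h0.
  rewrite /= scaler1 (addrC h x).
  rewrite distrC.
  have -> : h^-1 *: (f (x + h) - f x) - l = h^-1 * (f (x + h) - f x - h * l).
    by rewrite mulrBr mulrA mulVf// mul1r.
  rewrite normrM normfV mulrC ler_pdivrMr ?normr_gt0//.
  by near: h; exact: H.
by apply: DeriveDef; [apply/cvg_ex; exists l|exact/cvg_lim].
Unshelve. all: by end_near.
Qed.

Lemma is_derive_sint a F x : continuous F ->
  is_derive x 1 (fun y => sint a y F) (F x).
Proof.
move=> cF; have tF := continuous_tame cF; apply: is_derive_eps => e e0.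
have /cvgrPdist_le/(_ e e0) := cF x.
move=> /nbhs_ballP[d /= d0 Hd].
near=> h.
rewrite -(sint_chasles x a)// (addrC (sint a x F)) addrK.
have -> : sint x (x + h) F - h * F x = sint x (x + h) (fun y => F y - F x).
  rewrite sintB//; last exact: tame_cst.
  by rewrite sint_cst; ring.
have -> : e * `|h| = e * `|x + h - x| by congr (_ * `|_|); ring.
apply: sint_bound; first by apply: tameB => //; exact: tame_cst.
move=> y Hy; rewrite distrC; apply: Hd.
have hd : `|h| < d.
  by near: h; apply/nbhs_ballP; exists d => //= z; rewrite /ball/= sub0r normrN.
rewrite /ball/=.
move: hd Hy; rewrite !ltr_norml => /andP[h1 h2].
rewrite ge_min le_max => /andP[/orP[A|A] /orP[B|B]]; lra.
Unshelve. all: by end_near.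
Qed.

Lemma cvg_of_is_derive (f : R -> R) x l : is_derive x 1 f l -> {for x, continuous f}.
Proof.
move=> [d _]; apply: differentiable_continuous; exact/derivable1_diffP.
Qed.

Lemma FTC a b (G g : R -> R) : a <= b -> continuous g ->
  (forall x, a <= x <= b -> is_derive x 1 G (g x)) ->
  sint a b g = G b - G a.
Proof.
rewrite le_eqVlt => /predU1P[<- _ _|ab cg dG]; first by rewrite sint0 subrr.
have ab' := ltW ab.
pose H x := sint a x g - G x.
have dH x : a <= x <= b -> is_derive x 1 H 0.
  move=> xab; rewrite -(subrr (g x)).
  exact: (is_deriveB (is_derive_sint a x cg) (dG x xab)).
have [] := @MVT R H (fun=> 0) a b ab.
- by move=> x; rewrite in_itv/= => /andP[xa xb]; apply: dH; rewrite !ltW.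
- apply: continuous_in_subspaceT => x /set_mem /=; rewrite in_itv/= => xab.
  exact: (cvg_of_is_derive (dH x xab)).
- move=> c _; rewrite mul0r /H sint0 sub0r opprK => /eqP.
  by rewrite addrAC addr_eq0 => /eqP E; rewrite -(addrK (G a) (sint a b g)) E opprK.
Qed.

(** [H] has to match the transformed integrand on the segment only: the substitution by
    [y * cos / sin] in [polar] is singular at multiples of pi, where a globally continuous stand-in
    is supplied. *)
Lemma sint_subst a b (g g' H : R -> R) F : a <= b -> continuous F -> continuous H ->
  (forall x, a <= x <= b -> is_derive x 1 g (g' x)) ->
  (forall x, a <= x <= b -> H x = F (g x) * g' x) ->
  sint (g a) (g b) F = sint a b H.
Proof.
move=> ab cF cH dg HE.
have D x : a <= x <= b ->
    is_derive x 1 (fun y => sint (g a) (g y) F) (H x).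
  move=> xab; rewrite HE//.
  exact: (is_derive1_comp (is_derive_sint (g a) (g x) cF) (dg x xab)).
by rewrite (FTC ab cH D) sint0 subr0.
Qed.

Lemma sint_affine a b k c F : continuous F ->
  sint (k * a + c) (k * b + c) F = k * sint a b (fun x => F (k * x + c)).
Proof.
move=> cF.
wlog ab : a b / a <= b => [H|].
  have [/H//|/ltW /H E] := leP a b.
  by rewrite sintC E (sintC a b) mulrN opprK.
have cK : continuous (fun x => F (k * x + c)).
  move=> x; apply: continuous_comp; last exact: cF.
  by apply: cvgD; [apply: cvgM; [exact: cvg_cst|exact: cvg_id]|exact: cvg_cst].
rewrite -sintZ; last exact: continuous_tame.
have c2 : continuous (fun x => F (k * x + c) * k).
  by move=> x; apply: cvgM; [exact: cK|exact: cvg_cst].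
have D x : a <= x <= b -> is_derive x 1 (fun x => k * x + c) k.
  by move=> _; apply: is_derive_eq; rewrite ?scaler0 ?addr0 /GRing.scale/= ?mulr1 ?mulr0 ?addr0.
rewrite (sint_subst ab cF c2 D)//.
by apply: sint_ext => x; rewrite mulrC.
Qed.

Lemma sint_shift a b c F : continuous F ->
  sint a b (fun x => F (x + c)) = sint (a + c) (b + c) F.
Proof.
move=> cF; have := sint_affine a b 1 c cF; rewrite !mul1r => ->.
by apply: sint_ext => x; rewrite mul1r.
Qed.

Lemma sint_opp a b F : continuous F ->
  sint a b (fun x => F (- x)) = sint (- b) (- a) F.
Proof.
move=> cF; have := sint_affine a b (-1) 0 cF.
rewrite !mulN1r !addr0 sintC => /eqP; rewrite eqr_opp => /eqP ->.
by apply: sint_ext => x; rewrite mulN1r addr0.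
Qed.

Lemma sint_scale a b k F : continuous F ->
  k * sint a b (fun x => F (k * x)) = sint (k * a) (k * b) F.
Proof.
move=> cF; have := sint_affine a b k 0 cF; rewrite !addr0 => ->.
by congr (_ * _); apply: sint_ext => x; rewrite addr0.
Qed.

(** Bounds and convergence are asked on the open interval, because the kernels used below degenerate
    at 0 and pi, where the sine vanishes. The endpoints are null sets. *)
Lemma dct_sint a b (F_ : nat -> R -> R) F M : a <= b ->
  (forall n, tame (F_ n)) -> tame F ->
  (forall n x, a < x < b -> `|F_ n x| <= M) ->
  (forall x, a < x < b -> F_ n x @[n --> \oo] --> F x) ->
  sint a b (F_ n) @[n --> \oo] --> sint a b F.
Proof.
move=> ab tF_ tF FM cF.
have oE G : tame G -> sint a b G = \int[mu]_(x in `]a, b[) G x.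
  move=> tG; have [mG _] := tG.
  rewrite sint_le// -Rintegral_itv_obnd_cbnd; last first.
    apply: (@tame_integrableS G a b) => //.
    by apply: subset_itvr; rewrite bnd_simp.
  rewrite -Rintegral_itv_bndo_bndc//.
  apply: (@tame_integrableS G a b) => //.
  by apply: subset_itv; rewrite bnd_simp.
rewrite (_ : (fun n => _) = (fun n => \int[mu]_(x in `]a, b[) F_ n x)); last first.
  by apply/funext => n; exact: oE.
rewrite oE//.
have ifin G : tame G -> mu.-integrable `]a, b[ (EFin \o G).
  move=> tG; apply: (@tame_integrableS G a b) => //.
  by apply: subset_itv; rewrite bnd_simp.
apply: fine_cvg; rewrite fineK; last exact: integrable_fin_num (ifin _ tF).
apply: (@dominated_cvg _ _ _ mu `]a, b[ _ (fun n x => (F_ n x)%:E) _ (fun=> M%:E)) => //.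
- move=> n; apply/measurable_EFinP; apply: measurable_funTS; exact: (tF_ n).1.
- move=> x /=; rewrite in_itv/= => xab; apply: cvg_EFin; first exact: nearW.
  exact: cF.
- exact: (ifin _ (tame_cst M)).
Qed.

Lemma tame_cvg (F_ : nat -> R -> R) F M : (forall n, tame (F_ n)) ->
  (forall x, F_ n x @[n --> \oo] --> F x) ->
  (forall x, `|F x| <= M) -> tame F.
Proof.
move=> tF cF bF; split; last by move=> r; exists M.
apply: (@measurable_fun_cvg _ _ _ setT F_) => //.
by move=> n; exact: (tF n).1.
Qed.


(** A tube argument: compactness of the segment turns joint continuity at the points [(t0, x)] into
    one neighbourhood of [t0]. *)
Lemma near_segment_unif (T : topologicalType) a b (F : T -> R -> R) t0 e :
  continuous (fun p : T * R => F p.1 p.2) -> 0 < e ->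
  \forall t \near t0, forall x, a <= x <= b -> `|F t x - F t0 x| <= e.
Proof.
move=> cF e0.
have /compact_near_coveringP := @segment_compact R a b.
move=> /(_ T (nbhs t0) (fun t x => `|F t x - F t0 x| <= e) _) H.
have : \forall t \near t0, `[a, b]%classic `<=` (fun x => `|F t x - F t0 x| <= e).
  apply: H => x _.
  have e2 : 0 < e / 2 by rewrite divr_gt0.
  have /cvgrPdist_le/(_ _ e2) := cF (t0, x).
  move=> -[[A B] /= [nA nB] AB].
  exists (B, A); first by split.
  move=> [y t] /= [By At].
  have h1 : `|F t0 x - F t y| <= e / 2 by apply: (AB (t, y)).
  have h2 : `|F t0 x - F t0 y| <= e / 2.
    by apply: (AB (t0, y)); split => //=; exact: nbhs_singleton.
  rewrite (_ : F t y - F t0 y = (F t0 x - F t0 y) - (F t0 x - F t y)); last by ring.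
  by rewrite (le_trans (ler_normB _ _))// [leRHS]splitr lerD.
by apply: filterS => t Ht x xab; apply: Ht; rewrite /= in_itv.
Qed.

Lemma continuous_slice (T : topologicalType) (F : T -> R -> R) t :
  continuous (fun p : T * R => F p.1 p.2) -> continuous (F t).
Proof.
move=> cF; apply: (continuous_comp2 cF); first by move=> x; exact: cvg_cst.
by move=> x; exact: cvg_id.
Qed.

Lemma continuous_sint_param (T : topologicalType) a b (F : T -> R -> R) :
  continuous (fun p : T * R => F p.1 p.2) -> continuous (fun t => sint a b (F t)).
Proof.
move=> cF t0; apply/cvgrPdist_le => e e0.
have tF t : tame (F t) by apply: continuous_tame; exact: continuous_slice.
pose e' := e / (`|b - a| + 1).
have d0 : 0 < `|b - a| + 1 by rewrite ltr_pwDr.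
have e'0 : 0 < e' by rewrite divr_gt0.
have := near_segment_unif (Num.min a b) (Num.max a b) t0 cF e'0.
apply: filterS => t Ht.
rewrite distrC -sintB//.
apply: (le_trans (@sint_bound e' a b _ (tameB (tF t) (tF t0)) Ht)).
by rewrite /e' mulrAC ler_pdivrMr// ler_pM2l// lerDl.
Qed.

Lemma continuous_swap (F : R -> R -> R) :
  continuous (fun p : R * R => F p.1 p.2) -> continuous (fun p : R * R => F p.2 p.1).
Proof.
move=> cF; apply: (continuous_comp2 cF); first by move=> p; exact: cvg_snd.
by move=> p; exact: cvg_fst.
Qed.

(** As functions of the endpoint [b], the two iterated integrals have the same derivative, the
    integral of [F b] from [c] to [d], and both vanish at [b = a]. *)
Lemma sint_fubini a b c d (F : R -> R -> R) :
  continuous (fun p : R * R => F p.1 p.2) ->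
  sint a b (fun x => sint c d (F x)) = sint c d (fun y => sint a b (F^~ y)).
Proof.
move=> cF; have cF' := continuous_swap cF.
pose H z := sint c d (fun y => sint a z (F^~ y)) - sint a z (fun x => sint c d (F x)).
suff : H b = H a.
  have -> : H a = 0.
    rewrite /H (sint0 a) subr0 (@sint_ext c d _ (fun=> 0)) ?sint_cst ?mul0r//.
    by move=> y; rewrite (sint0 a).
  by move=> /eqP; rewrite /H subr_eq0 => /eqP <-.
have cI : continuous (fun x => sint c d (F x)) by exact: continuous_sint_param.
have tF y : tame (F^~ y).
  by apply: continuous_tame; exact: (@continuous_slice _ (fun y x => F x y)).
have tFx x : tame (F x) by apply: continuous_tame; exact: continuous_slice.
have cS u v : continuous (fun y => sint u v (F^~ y)).
  exact: (@continuous_sint_param _ u v (fun y x => F x y)).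
apply: is_derive_0_is_cst => z.
suff D : is_derive z 1 (fun z => sint c d (fun y => sint a z (F^~ y))) (sint c d (F z)).
  rewrite -(subrr (sint c d (F z))).
  exact: (is_deriveB D (is_derive_sint a z cI)).
apply: is_derive_eps => e e0.
pose e' := e / (`|d - c| + 1).
have d0 : 0 < `|d - c| + 1 by rewrite ltr_pwDr.
have e'0 : 0 < e' by rewrite divr_gt0.
have /nbhs_ballP[r /= r0 Hr] := near_segment_unif (Num.min c d) (Num.max c d) z cF e'0.
near=> h.
have hr : `|h| < r.
  by near: h; apply/nbhs_ballP; exists r => //= z'; rewrite /ball/= sub0r normrN.
rewrite -sintB; [|exact: continuous_tame|exact: continuous_tame].
rewrite -sintZ// -sintB; last 2 first.
- by apply: tameB; exact: continuous_tame.
- exact: tameZ.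
have E y : sint a (z + h) (F^~ y) - sint a z (F^~ y) - h * F z y =
   sint z (z + h) (fun x => F x y - F z y).
  rewrite -(@sint_chasles z a)// (addrC (sint a z _)) addrK sintB//; last exact: tame_cst.
  by rewrite sint_cst; ring.
rewrite (sint_ext _ _ E).
apply: (@le_trans _ _ (e' * `|h| * `|d - c|)); last first.
  rewrite mulrAC ler_wpM2r//.
  by rewrite /e' mulrAC ler_pdivrMr// ler_pM2l// lerDl.
apply: sint_bound.
  rewrite -(funext E); apply: tameB; last exact: tameZ.
  by apply: tameB; exact: continuous_tame.
move=> y Hy.
have -> : e' * `|h| = e' * `|z + h - z| by congr (_ * `|_|); ring.
apply: sint_bound; first by apply: tameB => //; exact: tame_cst.
move=> x Hx; apply: Hr => //.
rewrite /ball/=.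
move: hr Hx; rewrite !ltr_norml => /andP[h1 h2].
rewrite ge_min le_max => /andP[/orP[A|A] /orP[B|B]]; lra.
Unshelve. all: by end_near.
Qed.

End SignedIntegral.

(** * Complex-valued functions and vanishing Fourier coefficients *)

Section ComplexValued.
Local Open Scope complex_scope.
Context {R : realType}.
Local Notation C := R[i].
Local Notation Re := (@complex.Re R).
Local Notation Im := (@complex.Im R).
Implicit Types (z w : C) (t : R).

Lemma ReD z w : Re (z + w) = Re z + Re w. Proof. by case: z w => [? ?] [? ?]. Qed.
Lemma ImD z w : Im (z + w) = Im z + Im w. Proof. by case: z w => [? ?] [? ?]. Qed.
Lemma ReM z w : Re (z * w) = Re z * Re w - Im z * Im w.
Proof. by case: z w => [? ?] [? ?]. Qed.
Lemma ImM z w : Im (z * w) = Re z * Im w + Im z * Re w.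
Proof. by case: z w => [? ?] [? ?]. Qed.
Lemma ReN z : Re (- z) = - Re z. Proof. by case: z. Qed.
Lemma ImN z : Im (- z) = - Im z. Proof. by case: z. Qed.
Lemma ReC t : Re t%:C = t. Proof. by []. Qed.
Lemma ImC t : Im t%:C = 0. Proof. by []. Qed.
Lemma Re1 : Re 1 = 1. Proof. by []. Qed.
Lemma Im1 : Im 1 = 0. Proof. by []. Qed.
Lemma Re0 : Re 0 = 0. Proof. by []. Qed.
Lemma Im0 : Im 0 = 0. Proof. by []. Qed.
Definition ReImE := (ReD, ImD, ReM, ImM, ReN, ImN, ReC, ImC, Re1, Im1, Re0, Im0).

Lemma complex_ext z w : Re z = Re w -> Im z = Im w -> z = w.
Proof. by case: z w => [? ?] [? ?] /= -> ->. Qed.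

Definition cis t : C := cos t +i* sin t.
Definition cexp z : C := (expR (Re z))%:C * cis (Im z).

Lemma cisD s t : cis (s + t) = cis s * cis t.
Proof. by apply: complex_ext; rewrite !ReImE /= ?cosD ?sinD//; ring. Qed.

Lemma cis0 : cis 0 = 1.
Proof. by apply: complex_ext; rewrite /= ?cos0 ?sin0. Qed.

Lemma cisX t n : cis t ^+ n = cis (n%:R * t).
Proof.
elim: n => [|n IH]; first by rewrite expr0 mul0r cis0.
by rewrite exprS IH -cisD -[n.+1]addn1 natrD mulrDl mul1r addrC.
Qed.

Lemma cisK t : cis t * cis (- t) = 1.
Proof. by rewrite -cisD subrr cis0. Qed.

Lemma cexpD z w : cexp (z + w) = cexp z * cexp w.
Proof. by rewrite /cexp ReD ImD expRD rmorphM cisD/= mulrACA. Qed.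

Lemma cexp0 : cexp 0 = 1.
Proof. by rewrite /cexp /= expR0 cis0 mulr1. Qed.

Lemma cexpX z n : cexp (n%:R * z) = cexp z ^+ n.
Proof.
elim: n => [|n IH]; first by rewrite expr0 mul0r cexp0.
by rewrite exprS -IH -cexpD -[n.+1]addn1 natrD mulrDl mul1r addrC.
Qed.

(** A submultiplicative norm with values in [R], whereas the norm of [R[i]] is complex valued; it
    bounds both components. *)
Definition cnorm1 z : R := `|Re z| + `|Im z|.

Lemma cnorm1_ge0 z : 0 <= cnorm1 z. Proof. by rewrite addr_ge0. Qed.

Lemma cnorm1D z w : cnorm1 (z + w) <= cnorm1 z + cnorm1 w.
Proof. by rewrite /cnorm1 !ReImE addrACA lerD// ler_normD. Qed.

Lemma cnorm1N z : cnorm1 (- z) = cnorm1 z.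
Proof. by rewrite /cnorm1 !ReImE !normrN. Qed.

Lemma cnorm1M z w : cnorm1 (z * w) <= cnorm1 z * cnorm1 w.
Proof.
rewrite /cnorm1 !ReImE.
rewrite (le_trans (lerD (ler_normB _ _) (ler_normD _ _)))// !normrM.
by rewrite le_eqVlt; apply/orP; left; apply/eqP; ring.
Qed.

Lemma cnorm1X z n : cnorm1 (z ^+ n) <= cnorm1 z ^+ n.
Proof.
elim: n => [|n IH]; first by rewrite !expr0 /cnorm1 /= normr1 normr0 addr0.
rewrite !exprS (le_trans (cnorm1M _ _))// ler_wpM2l// cnorm1_ge0//.
Qed.

Lemma cnorm1_Re z : `|Re z| <= cnorm1 z. Proof. by rewrite lerDl. Qed.
Lemma cnorm1_Im z : `|Im z| <= cnorm1 z. Proof. by rewrite lerDr. Qed.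

Lemma cnorm1_cis t : cnorm1 (cis t) <= 2.
Proof. by rewrite /cnorm1 -[leRHS]/(1 + 1) lerD ?cos_max ?sin_max. Qed.

Lemma cnorm1C t : cnorm1 t%:C = `|t|.
Proof. by rewrite /cnorm1 /= normr0 addr0. Qed.

Lemma cnorm1_cexp z : cnorm1 (cexp z) <= 2 * expR (Re z).
Proof.
rewrite (le_trans (cnorm1M _ _))// cnorm1C ger0_norm ?expR_ge0// mulrC.
by rewrite ler_wpM2r ?expR_ge0// cnorm1_cis.
Qed.

Lemma ler_norm_sin t : `|sin t| <= `|t|.
Proof.
have H (s : R) : 0 <= s -> `|sin s| <= s.
  rewrite le_eqVlt => /predU1P[<-|s0]; first by rewrite sin0 normr0.
  have [] := @MVT R sin cos 0 s s0.
  - by apply: continuous_subspaceT; exact: continuous_sin.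
  - move=> c _; rewrite sin0 !subr0 => ->.
    by rewrite normrM (gtr0_norm s0) ler_piMl// ?cos_max// ltW.
have [t0|/ltW t0] := leP 0 t; first by rewrite (ger0_norm t0) H.
by rewrite -normrN -sinN (ler0_norm t0) H// oppr_ge0.
Qed.

(** Unlike [cnorm1_cexp], this bound has no factor 2, so its [n]-th power at [z / n] stays bounded.
    It rests on |cos t| + |sin t| <= 1 + |t| <= exp |t|. *)
Lemma cnorm1_cexp_le z : cnorm1 (cexp z) <= expR (cnorm1 z).
Proof.
rewrite (le_trans (cnorm1M _ _))// cnorm1C ger0_norm ?expR_ge0//.
rewrite /cnorm1 expRD ler_pM ?expR_ge0 ?addr_ge0//.
  by rewrite ler_expR ler_norm.
rewrite (le_trans _ (expR_ge1Dx _))// lerD ?cos_max//=.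
exact: ler_norm_sin.
Qed.

(** Telescoping; [1 <= r] allows the exponent [n] where [n - 1] would be natural. *)
Lemma cnorm1_subX z w r n : 1 <= r -> cnorm1 z <= r -> cnorm1 w <= r ->
  cnorm1 (z ^+ n - w ^+ n) <= n%:R * cnorm1 (z - w) * r ^+ n.
Proof.
move=> r1 zr wr; have r0 : 0 <= r by exact: le_trans r1.
elim: n => [|n IH]; first by rewrite subrr /cnorm1 /= normr0 addr0 !mul0r.
have -> : z ^+ n.+1 - w ^+ n.+1 = z * (z ^+ n - w ^+ n) + (z - w) * w ^+ n.
  by rewrite !exprS; ring.
rewrite (le_trans (cnorm1D _ _))//.
have -> : n.+1%:R * cnorm1 (z - w) * r ^+ n.+1 =
  r * (n%:R * cnorm1 (z - w) * r ^+ n) + cnorm1 (z - w) * r ^+ n.+1.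
  by rewrite -[n.+1]addn1 natrD exprD expr1; ring.
rewrite lerD//; rewrite (le_trans (cnorm1M _ _))//.
  by rewrite ler_pM ?cnorm1_ge0.
rewrite ler_wpM2l ?cnorm1_ge0// (le_trans (cnorm1X _ _))//.
rewrite exprS (le_trans (y := r ^+ n))//.
  by apply: lerXn2r => //; rewrite nnegrE ?cnorm1_ge0.
by rewrite ler_peMl// exprn_ge0.
Qed.

Definition ccvg (u : nat -> C) z :=
  (Re (u n) @[n --> \oo] --> Re z) /\ (Im (u n) @[n --> \oo] --> Im z).

Lemma ccvg_cnorm1 u z : cnorm1 (u n - z) @[n --> \oo] --> (0 : R) -> ccvg u z.
Proof.
move=> H; split.
- apply/cvgrPdist_lt => e e0.
  move/cvgr0Pnorm_lt : H => /(_ e e0); apply: filterS => n.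
  rewrite ger0_norm ?cnorm1_ge0// distrC; apply: le_lt_trans.
  by rewrite -ReN -ReD; exact: cnorm1_Re.
- apply/cvgrPdist_lt => e e0.
  move/cvgr0Pnorm_lt : H => /(_ e e0); apply: filterS => n.
  rewrite ger0_norm ?cnorm1_ge0// distrC; apply: le_lt_trans.
  by rewrite -ImN -ImD; exact: cnorm1_Im.
Qed.

Lemma ccvgM u v z w : ccvg u z -> ccvg v w -> ccvg (fun n => u n * v n) (z * w).
Proof.
move=> [u1 u2] [v1 v2]; split; rewrite ?ReM ?ImM.
- by under eq_fun do rewrite ReM; apply: cvgB; exact: cvgM.
- by under eq_fun do rewrite ImM; apply: cvgD; exact: cvgM.
Qed.

Lemma ccvg_cst z : ccvg (fun=> z) z.
Proof. by split; exact: cvg_cst. Qed.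

Lemma ccvg_cexp u z : ccvg u z -> ccvg (fun n => cexp (u n)) (cexp z).
Proof.
move=> [u1 u2].
have e1 : expR (Re (u n)) @[n --> \oo] --> expR (Re z).
  by apply: (cvg_comp _ _ u1); exact: continuous_expR.
have c1 : cos (Im (u n)) @[n --> \oo] --> cos (Im z).
  by apply: (cvg_comp _ _ u2); exact: continuous_cos.
have s1 : sin (Im (u n)) @[n --> \oo] --> sin (Im z).
  by apply: (cvg_comp _ _ u2); exact: continuous_sin.
by apply: ccvgM; split => //=; exact: cvg_cst.
Qed.

Lemma is_derive_quot_cvg (f : R -> R) (x l : R) : is_derive x 1 f l ->
  n.+1%:R * (f (x + n.+1%:R^-1) - f x) @[n --> \oo] --> l.
Proof.
move=> [df fl].
have H : h^-1 *: ((f \o shift x) (h *: (1:R)) - f x) @[h --> (0:R)^'] --> l.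
  by rewrite -fl; exact: df.
have K : (n.+1%:R^-1 : R) @[n --> \oo] --> (0:R)^'.
  move=> A; rewrite /dnbhs /within /= => HA.
  have H0 : (n.+1%:R^-1 : R) @[n --> \oo] --> (0:R) by exact: cvg_harmonic.
  have := H0 _ HA; rewrite /nbhs/=; apply: filterS => n /=; apply.
  by rewrite invr_neq0.
have := cvg_comp _ _ K H; rewrite /comp/=; apply: cvg_trans.
apply: near_eq_cvg; apply: nearW => n /=.
by rewrite invrK /GRing.scale/= mulr1 (addrC x).
Qed.

(** By [cnorm1_subX] the error is at most exp |z| times [E n], which is [n.+1] times the first-order
    remainder of [cexp] at [z / n.+1]. Differentiability at 0 makes [E n] tend to 0. *)
Lemma cexp_lim z : ccvg (fun n => (1 + n.+1%:R^-1 * z) ^+ n.+1) (cexp z).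
Proof.
pose g t : C := cexp (t%:C * z).
have dRe : is_derive (0 : R) 1 (fun t => Re (g t)) (Re z).
  rewrite (_ : (fun t => Re (g t)) = (fun t => expR (Re z * t) * cos (Im z * t))).
    apply: is_derive_eq.
    by rewrite !mulr0 expR0 sin0 cos0 /GRing.scale/= ; ring.
  apply/funext => t; rewrite /g /cexp !ReImE /= !mul0r !subr0 addr0.
  by congr (expR _ * cos _); ring.
have dIm : is_derive (0 : R) 1 (fun t => Im (g t)) (Im z).
  rewrite (_ : (fun t => Im (g t)) = (fun t => expR (Re z * t) * sin (Im z * t))).
    apply: is_derive_eq.
    by rewrite !mulr0 expR0 sin0 cos0 /GRing.scale/= ; ring.
  apply/funext => t; rewrite /g /cexp !ReImE /= !mul0r !subr0 !addr0.
  by congr (expR _ * sin _); ring.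
have g0 : g 0 = 1 by rewrite /g mul0r cexp0.
have qRe := is_derive_quot_cvg dRe.
have qIm := is_derive_quot_cvg dIm.
pose E n := n.+1%:R * cnorm1 (cexp (n.+1%:R^-1 * z) - (1 + n.+1%:R^-1 * z)).
have invC n : (n.+1%:R^-1 : C) = (n.+1%:R^-1 : R)%:C.
  by rewrite fmorphV rmorph_nat.
have EE n : E n = `|n.+1%:R * (Re (g (0 + n.+1%:R^-1)) - Re (g 0)) - Re z|
                + `|n.+1%:R * (Im (g (0 + n.+1%:R^-1)) - Im (g 0)) - Im z|.
  rewrite /E /cnorm1 mulrDr g0 add0r /g -invC.
  have n0 : (n.+1%:R : R) != 0 by rewrite pnatr_eq0.
  congr (_ + _); rewrite -{1}[n.+1%:R]ger0_norm// -normrM; congr `|_|;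
    rewrite invC !ReImE mul0r ?subr0 ?addr0; field;
    by rewrite ?nat1r ?natr1 pnatr_eq0.
have cE : E n @[n --> \oo] --> (0 : R).
  rewrite (funext EE) -[X in _ --> X](addr0 0).
  apply: cvgD.
    have := cvg_norm (cvgB qRe (cvg_cst (Re z))).
    by rewrite subrr normr0; apply.
  have := cvg_norm (cvgB qIm (cvg_cst (Im z))).
  by rewrite subrr normr0; apply.
apply: ccvg_cnorm1.
have cE' : expR (cnorm1 z) * E n @[n --> \oo] --> (0 : R).
  by rewrite -(mulr0 (expR (cnorm1 z))); apply: cvgM => //; exact: cvg_cst.
apply: (squeeze_cvgr _ (cvg_cst 0) cE').
apply: nearW => n; rewrite cnorm1_ge0 /=.
rewrite -[X in cnorm1 (_ - X)](_ : cexp (n.+1%:R^-1 * z) ^+ n.+1 = _); last first.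
  by rewrite -cexpX mulrA divff ?mul1r// pnatr_eq0.
rewrite -cnorm1N opprB.
have nN : cnorm1 (n.+1%:R^-1 * z) <= n.+1%:R^-1 * cnorm1 z.
  by rewrite (le_trans (cnorm1M _ _))// invC cnorm1C ger0_norm.
rewrite (le_trans (@cnorm1_subX _ _ (expR (n.+1%:R^-1 * cnorm1 z)) _ _ _ _))//.
- by rewrite -expR0 ler_expR mulr_ge0 ?cnorm1_ge0.
- by rewrite (le_trans (cnorm1_cexp_le _))// ler_expR.
- rewrite (le_trans (cnorm1D _ _))// (le_trans _ (expR_ge1Dx _))// lerD//.
  by rewrite /cnorm1 /= normr1 normr0 addr0.
- rewrite -expRM_natl -[_ *+ _]mulr_natl mulrA divff ?pnatr_eq0// mul1r.
  by rewrite mulr1 [leLHS]mulrC.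
Qed.

Lemma cexp_lim_bound z n : cnorm1 ((1 + n.+1%:R^-1 * z) ^+ n.+1) <= expR (cnorm1 z).
Proof.
have invC : (n.+1%:R^-1 : C) = (n.+1%:R^-1 : R)%:C by rewrite fmorphV rmorph_nat.
rewrite (le_trans (cnorm1X _ _))//.
rewrite -[cnorm1 z]mul1r -(@divff _ (n.+1%:R : R)) ?pnatr_eq0// -mulrA expRM_natl.
apply: lerXn2r; rewrite ?nnegrE ?cnorm1_ge0 ?expR_ge0//.
rewrite (le_trans (cnorm1D _ _))// (le_trans _ (expR_ge1Dx _))// lerD//.
  by rewrite /cnorm1 /= normr1 normr0 addr0.
by rewrite (le_trans (cnorm1M _ _))// invC cnorm1C ger0_norm.
Qed.


Section Continuity.
Variables (T : topologicalType).
Implicit Types (F G : T -> C) (f g : T -> R).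

Definition ccont F :=
  continuous (fun s => Re (F s)) /\ continuous (fun s => Im (F s)).

Lemma ccontD F G : ccont F -> ccont G -> ccont (fun s => F s + G s).
Proof.
move=> [F1 F2] [G1 G2]; split=> s.
- by under eq_fun do rewrite ReD; apply: cvgD; [exact: F1|exact: G1].
- by under eq_fun do rewrite ImD; apply: cvgD; [exact: F2|exact: G2].
Qed.

Lemma ccontM F G : ccont F -> ccont G -> ccont (fun s => F s * G s).
Proof.
move=> [F1 F2] [G1 G2]; split=> s.
- under eq_fun do rewrite ReM; apply: cvgB; apply: cvgM;
    by [exact: F1|exact: G1|exact: F2|exact: G2].
- under eq_fun do rewrite ImM; apply: cvgD; apply: cvgM;
    by [exact: F1|exact: G1|exact: F2|exact: G2].
Qed.

Lemma ccont_cst z : ccont (fun=> z).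
Proof. by split => s; exact: cvg_cst. Qed.

Lemma ccont_real f : continuous f -> ccont (fun s => (f s)%:C).
Proof. by move=> cf; split => // s; exact: cvg_cst. Qed.

Lemma ccontX F n : ccont F -> ccont (fun s => F s ^+ n).
Proof.
move=> cF; elim: n => [|n IH].
  by rewrite (_ : (fun s => _) = fun=> 1) //; exact: ccont_cst.
rewrite (_ : (fun s => _) = (fun s => F s * F s ^+ n)); first exact: ccontM.
by apply/funext => s; rewrite exprS.
Qed.

Lemma ccont_cis f : continuous f -> ccont (fun s => cis (f s)).
Proof.
move=> cf; split => s /=.
- by apply: continuous_comp; [exact: cf|exact: continuous_cos].
- by apply: continuous_comp; [exact: cf|exact: continuous_sin].
Qed.

Lemma ccont_cexp F : ccont F -> ccont (fun s => cexp (F s)).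
Proof.
move=> [F1 F2]; apply: ccontM; last exact: ccont_cis.
apply: ccont_real => s.
by apply: continuous_comp; [exact: F1|exact: continuous_expR].
Qed.

Lemma ccont_horner F (P : {poly C}) : ccont F -> ccont (fun s => P.[F s]).
Proof.
move=> cF; elim/poly_ind: P => [|P c IH].
  by rewrite (_ : (fun s => _) = fun=> 0); [exact: ccont_cst|apply/funext => s; rewrite horner0].
rewrite (_ : (fun s => _) = (fun s => P.[F s] * F s + c)).
  by apply: ccontD; [exact: ccontM|exact: ccont_cst].
by apply/funext => s; rewrite hornerMXaddC.
Qed.

End Continuity.

Section Cint.
Implicit Types (F G : R -> C) (a b : R).

Definition cint a b F : C :=
  sint a b (fun s => Re (F s)) +i* sint a b (fun s => Im (F s)).

Lemma cint_ext a b F G : F =1 G -> cint a b F = cint a b G.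
Proof. by move=> /funext ->. Qed.

Lemma eq_cint a b F G : a <= b -> (forall s, a <= s <= b -> F s = G s) ->
  cint a b F = cint a b G.
Proof.
by move=> ab FG; congr (_ +i* _); apply: eq_sint => // s sab; rewrite FG.
Qed.

Lemma ccont_tame F : ccont F ->
  tame (fun s => Re (F s)) /\ tame (fun s => Im (F s)).
Proof. by move=> [? ?]; split; exact: continuous_tame. Qed.

Lemma cintD a b F G : ccont F -> ccont G ->
  cint a b (fun s => F s + G s) = cint a b F + cint a b G.
Proof.
move=> /ccont_tame[F1 F2] /ccont_tame[G1 G2].
apply: complex_ext; rewrite !ReImE /= -sintD//; apply: sint_ext => s.
- exact: ReD.
- exact: ImD.
Qed.

Lemma cintZ a b z F : ccont F -> cint a b (fun s => z * F s) = z * cint a b F.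
Proof.
move=> /ccont_tame[F1 F2].
apply: complex_ext; rewrite !ReImE /= -!sintZ//.
  rewrite -sintB; do ?exact: tameZ.
  by apply: sint_ext => s; exact: ReM.
rewrite -sintD; do ?exact: tameZ.
by apply: sint_ext => s; exact: ImM.
Qed.

Lemma cint0 a b : cint a b (fun=> 0) = 0.
Proof. by rewrite /cint !sint_cst !mul0r. Qed.

Lemma cint_param (T : topologicalType) a b (F : T -> R -> C) :
  ccont (fun p : T * R => F p.1 p.2) -> ccont (fun s => cint a b (F s)).
Proof.
move=> [F1 F2]; split => /=.
- exact (@continuous_sint_param R T a b (fun (u : T) s => Re (F u s)) F1).
- exact (@continuous_sint_param R T a b (fun (u : T) s => Im (F u s)) F2).
Qed.

Lemma cint_fubini a b c d (F : R -> R -> C) :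
  ccont (fun p : R * R => F p.1 p.2) ->
  cint a b (fun x => cint c d (F x)) = cint c d (fun y => cint a b (F^~ y)).
Proof.
move=> [F1 F2]; apply: complex_ext => /=.
- exact: (sint_fubini a b c d (F := fun t s => Re (F t s)) F1).
- exact: (sint_fubini a b c d (F := fun t s => Im (F t s)) F2).
Qed.

Lemma cint_cvg a b M (F_ : nat -> R -> C) F : a <= b ->
  (forall n, ccont (F_ n)) -> ccont F ->
  (forall n s, a < s < b -> cnorm1 (F_ n s) <= M) ->
  (forall s, a < s < b -> ccvg (fun n => F_ n s) (F s)) ->
  ccvg (fun n => cint a b (F_ n)) (cint a b F).
Proof.
move=> ab cF_ /ccont_tame[tF1 tF2] FM cF.
have tF_ n := ccont_tame (cF_ n).
split => /=.
- apply: (@dct_sint _ a b (fun n s => Re (F_ n s)) _ M) => //.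
  + by move=> n; exact: (tF_ n).1.
  + by move=> n s sab; rewrite (le_trans (cnorm1_Re _))// FM.
  + by move=> s sab; exact: (cF s sab).1.
- apply: (@dct_sint _ a b (fun n s => Im (F_ n s)) _ M) => //.
  + by move=> n; exact: (tF_ n).2.
  + by move=> n s sab; rewrite (le_trans (cnorm1_Im _))// FM.
  + by move=> s sab; exact: (cF s sab).2.
Qed.

Lemma ccvg_eq0 (u : nat -> C) z : ccvg u z -> (forall n, u n = 0) -> z = 0.
Proof.
move=> [u1 u2] u0; apply: complex_ext.
- apply: (cvg_unique _ u1) => //.
  by rewrite (funext u0); exact: cvg_cst.
- apply: (cvg_unique _ u2) => //.
  by rewrite (funext u0); exact: cvg_cst.
Qed.

Lemma ccont_bound a b F : ccont F ->
  exists M, 0 <= M /\ forall s, a <= s <= b -> cnorm1 (F s) <= M.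
Proof.
move=> /ccont_tame[[_ F1] [_ F2]].
have [M1 H1] := F1 (Num.max `|a| `|b|); have [M2 H2] := F2 (Num.max `|a| `|b|).
exists (`|M1| + `|M2|); split; first by rewrite addr_ge0.
move=> s /andP[as_ sb].
have sab : `|s| <= Num.max `|a| `|b|.
  rewrite ler_norml; apply/andP; split.
    apply: le_trans as_; rewrite lerNl; apply: le_trans (ler_norm _) _.
    by rewrite normrN le_max lexx.
  by apply: le_trans sb _; apply: le_trans (ler_norm _) _; rewrite le_max lexx orbT.
by apply: lerD; apply: le_trans (ler_norm _); [exact: H1|exact: H2].
Qed.

(* [hardy L G m0] says that the Fourier coefficients of [G] of order [<= -m0]
   vanish, i.e. that [G] times [cis ^+ m0] extends to the unit disc. *)
Definition hardy L G m0 := forall m, (m0 <= m)%N ->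
  cint 0 L (fun s => G s * cis s ^+ m) = 0.

Lemma ccont_cisid : ccont (@cis).
Proof. by apply: ccont_cis => s; exact: cvg_id. Qed.

(** Multiplying by ['X] turns the condition at [m] into the one at [m.+1], still above [m0]. *)
Lemma hardy_poly L G m0 (P : {poly C}) : ccont G -> hardy L G m0 ->
  hardy L (fun s => G s * P.[cis s]) m0.
Proof.
move=> cG HG; elim/poly_ind: P => [|P c IH] m m0m.
  rewrite -[RHS](cint0 0 L); apply: cint_ext => s.
  by rewrite horner0 mulr0 mul0r.
have cX k : ccont (fun s => cis s ^+ k) by apply: ccontX; exact: ccont_cisid.
have cP : ccont (fun s => P.[cis s]) by apply: ccont_horner; exact: ccont_cisid.
rewrite (@cint_ext _ _ _ (fun s => G s * P.[cis s] * cis s ^+ m.+1 + c * (G s * cis s ^+ m))).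
  rewrite cintD; last 2 first.
  - by apply: ccontM => //; exact: ccontM.
  - by apply: ccontM; [exact: ccont_cst|exact: ccontM].
  rewrite IH; last by rewrite ltnW.
  by rewrite cintZ; [rewrite HG// mulr0 addr0|exact: ccontM].
by move=> s; rewrite hornerMXaddC exprS; ring.
Qed.

(** The exponential is approached by the polynomials [Q n], uniformly bounded by [cexp_lim_bound],
    and dominated convergence passes to the limit. *)
Lemma hardy_cexp_poly L G m0 (P : {poly C}) : 0 <= L -> ccont G -> hardy L G m0 ->
  hardy L (fun s => G s * cexp P.[cis s]) m0.
Proof.
move=> L0 cG HG m m0m.
have cX k : ccont (fun s => cis s ^+ k) by apply: ccontX; exact: ccont_cisid.
have cP (Q : {poly C}) : ccont (fun s => Q.[cis s]).
  by apply: ccont_horner; exact: ccont_cisid.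
pose Q n : {poly C} := (1 + n.+1%:R^-1%:P * P) ^+ n.+1.
have QE n s : (Q n).[cis s] = (1 + n.+1%:R^-1 * P.[cis s]) ^+ n.+1.
  by rewrite /Q horner_exp !hornerE.
have cGm : ccont (fun s => G s * cis s ^+ m) by exact: ccontM.
have [M1 [M10 HM1]] := ccont_bound 0 L cGm.
have [M2 [_ HM2]] := ccont_bound 0 L (cP P).
apply: (@ccvg_eq0 (fun n => cint 0 L (fun s => G s * (Q n).[cis s] * cis s ^+ m))).
  apply: (@cint_cvg _ _ (M1 * expR M2)) => //.
  - by move=> n; apply: ccontM => //; exact: ccontM.
  - by apply: ccontM => //; apply: ccontM => //; apply: ccont_cexp.
  - move=> n s /andP[/ltW s0 /ltW sL]; rewrite mulrAC (le_trans (cnorm1M _ _))//.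
    have sI : 0 <= s <= L by rewrite s0 sL.
    apply: ler_pM; rewrite ?cnorm1_ge0// ?HM1// QE.
    by rewrite (le_trans (cexp_lim_bound _ _))// ler_expR HM2.
  - move=> s _; apply: ccvgM; last exact: ccvg_cst.
    apply: ccvgM; first exact: ccvg_cst.
    by rewrite (_ : (fun n => _) = fun n => (1 + n.+1%:R^-1 * P.[cis s]) ^+ n.+1);
      [exact: cexp_lim|apply/funext => n; exact: QE].
by move=> n; exact: (hardy_poly (Q n) cG HG m0m).
Qed.

(** Pointwise convergence is enough: the size of an exponential depends on the real part alone, so
    an upper bound on the real parts gives the domination. *)
Lemma hardy_cexp_lim L G m0 (P : nat -> {poly C}) (h : R -> C) K :
  0 <= L -> ccont G -> ccont h -> hardy L G m0 ->
  (forall s, 0 < s < L -> ccvg (fun n => (P n).[cis s]) (h s)) ->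
  (forall n s, 0 < s < L -> Re (P n).[cis s] <= K) ->
  hardy L (fun s => G s * cexp (h s)) m0.
Proof.
move=> L0 cG ch HG Ph PK m m0m.
have cX k : ccont (fun s => cis s ^+ k) by apply: ccontX; exact: ccont_cisid.
have cP (Q : {poly C}) : ccont (fun s => Q.[cis s]).
  by apply: ccont_horner; exact: ccont_cisid.
have cGm : ccont (fun s => G s * cis s ^+ m) by exact: ccontM.
have [M1 [M10 HM1]] := ccont_bound 0 L cGm.
apply: (@ccvg_eq0 (fun n => cint 0 L (fun s => G s * cexp (P n).[cis s] * cis s ^+ m))).
  apply: (@cint_cvg _ _ (M1 * (2 * expR K))) => //.
  - by move=> n; apply: ccontM => //; apply: ccontM => //; exact: ccont_cexp.
  - by apply: ccontM => //; apply: ccontM => //; exact: ccont_cexp.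
  - move=> n s /[dup] s0L /andP[/ltW s0 /ltW sL].
    rewrite mulrAC (le_trans (cnorm1M _ _))//.
    have sI : 0 <= s <= L by rewrite s0 sL.
    apply: ler_pM; rewrite ?cnorm1_ge0// ?HM1//.
    by rewrite (le_trans (cnorm1_cexp _))// ler_pM2l// ler_expR PK.
  - move=> s sL; apply: ccvgM; last exact: ccvg_cst.
    apply: ccvgM; first exact: ccvg_cst.
    by apply: ccvg_cexp; exact: Ph.
by move=> n; exact: (hardy_cexp_poly (P n) L0 cG HG m0m).
Qed.

End Cint.

End ComplexValued.

(** * The conjugate function on the circle *)

Section Circle.
Local Open Scope complex_scope.
Context {R : realType}.
Local Notation C := R[i].
Local Notation Re := (@complex.Re R).
Local Notation Im := (@complex.Im R).
Implicit Types (F G e b : R -> R).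

Lemma cont_cosM (k : R) : continuous (fun x : R => cos (k * x)).
Proof.
move=> x; apply: continuous_comp; last exact: continuous_cos.
by apply: cvgM; [exact: cvg_cst|exact: cvg_id].
Qed.

Lemma cont_sinM (k : R) : continuous (fun x : R => sin (k * x)).
Proof.
move=> x; apply: continuous_comp; last exact: continuous_sin.
by apply: cvgM; [exact: cvg_cst|exact: cvg_id].
Qed.

Lemma sint_cosM (k L : R) : 0 <= L -> k != 0 ->
  sint 0 L (fun x => cos (k * x)) = sin (k * L) / k.
Proof.
move=> L0 k0.
have D x : 0 <= x <= L -> is_derive x 1 (fun x => sin (k * x) / k) (cos (k * x)).
  move=> _; apply: is_derive_eq; rewrite /GRing.scale/= ; field.
  exact: k0.
by rewrite (FTC L0 (@cont_cosM k) D) mulr0 sin0 mul0r subr0.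
Qed.

Lemma sint_sinM (k L : R) : 0 <= L -> k != 0 ->
  sint 0 L (fun x => sin (k * x)) = (1 - cos (k * L)) / k.
Proof.
move=> L0 k0.
have D x : 0 <= x <= L -> is_derive x 1 (fun x => - cos (k * x) / k) (sin (k * x)).
  move=> _; apply: is_derive_eq; rewrite /GRing.scale/= ; field.
  exact: k0.
rewrite (FTC L0 (@cont_sinM k) D) mulr0 cos0; field; exact: k0.
Qed.

Lemma cis_2pi n : cis (n%:R * (2 * pi)) = 1 :> C.
Proof.
rewrite -cisX (_ : cis (2 * pi) = 1) ?expr1n//.
by apply: complex_ext => /=; rewrite mulr_natl ?cos2pi ?sin2pi.
Qed.

Lemma cos_2pin n : cos (n%:R * (2 * pi)) = 1 :> R.
Proof. by have /(congr1 Re) := cis_2pi n. Qed.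

Lemma sin_2pin n : sin (n%:R * (2 * pi)) = 0 :> R.
Proof. by have /(congr1 Im) := cis_2pi n. Qed.

Section Bessel.
Variables (L c : R) (e : nat -> R -> R).
Hypotheses (L0 : 0 <= L) (c0 : 0 < c) (te : forall n, tame (e n)).
Hypothesis orth : forall n m,
  sint 0 L (fun x => e n x * e m x) = if n == m then c else 0.

(** [G N] is [F] minus its first [N] projections. The integral of its square is nonnegative, which
    bounds the sum of the squared coefficients, so these tend to 0. *)
Lemma bessel_cvg F : tame F -> sint 0 L (fun x => F x * e n x) @[n --> \oo] --> (0 : R).
Proof.
move=> tF.
pose a n := sint 0 L (fun x => F x * e n x).
pose fix G N := if N is N'.+1 then (fun x => G N' x - (a N' / c) * e N' x) else F.
have tG N : tame (G N) by elim: N => [//|N IH] /=; apply: tameB => //; exact: tameZ.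
have Ge N m : (N <= m)%N -> sint 0 L (fun x => G N x * e m x) = a m.
  elim: N m => [//|N IH] m Nm /=.
  rewrite (@sint_ext _ 0 L _ (fun x => G N x * e m x - (a N / c) * (e N x * e m x))).
    rewrite sintB ?sintZ ?IH ?orth ?ltn_eqF ?mulr0 ?subr0//; do ?exact: tameM.
    - exact: ltnW.
    - by apply: tameZ; exact: tameM.
  by move=> x; ring.
have GG N : sint 0 L (fun x => G N x * G N x) =
    sint 0 L (fun x => F x * F x) - (\sum_(n < N) a n ^+ 2) / c.
  elim: N => [|N IH]; first by rewrite big_ord0 mul0r subr0.
  rewrite (@sint_ext _ 0 L _ (fun x => G N x * G N x - (2 * (a N / c)) * (G N x * e N x)
     + (a N / c) ^+ 2 * (e N x * e N x))); last by move=> x /=; ring.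
  rewrite sintD; last 2 first.
  - by apply: tameB; [exact: tameM|apply: tameZ; exact: tameM].
  - by apply: tameZ; exact: tameM.
  rewrite sintB; [|exact: tameM|by apply: tameZ; exact: tameM].
  rewrite !sintZ; do ?exact: tameM.
  rewrite IH Ge// orth eqxx big_ord_recr /=; field.
  by rewrite gt_eqF.
pose u := [series a n ^+ 2]_n.
have ub N : u N <= c * sint 0 L (fun x => F x * F x).
  have : 0 <= sint 0 L (fun x => G N x * G N x).
    rewrite -[X in X <= _](mul0r (L - 0)) -(sint_cst 0 L 0).
    apply: ler_sint => //; first exact: tame_cst.
    - exact: tameM.
    - by move=> x _; rewrite -expr2 sqr_ge0.
  by rewrite GG subr_ge0 ler_pdivrMr// mulrC /u /series/= big_mkord.
have cu : cvgn u.
  apply: nondecreasing_is_cvgn.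
    apply/nondecreasing_seqP => n; rewrite /u /series/= big_nat_recr//=.
    by rewrite lerDl sqr_ge0.
  by exists (c * sint 0 L (fun x => F x * F x)) => _ [N _ <-]; exact: ub.
have := cvg_series_cvg_0 cu => a2.
apply/cvgrPdist_lt => r r0.
have r2 : 0 < r ^+ 2 by rewrite exprn_gt0.
move/cvgr0Pnorm_lt : a2 => /(_ _ r2); apply: filterS => n.
rewrite sub0r normrN ger0_norm ?sqr_ge0// -real_normK ?num_real//.
by rewrite /= (gtr0_norm r0) -[a n ^+ 2]real_normK ?num_real// ltr_sqr ?nnegrE// ltW.
Qed.

End Bessel.

Lemma tame_cosM k : tame (fun x : R => cos (k * x)).
Proof. by apply: continuous_tame; exact: cont_cosM. Qed.
Lemma tame_sinM k : tame (fun x : R => sin (k * x)).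
Proof. by apply: continuous_tame; exact: cont_sinM. Qed.

Section RiemannLebesgue.
Variables (L w : R).
Hypotheses (L0 : 0 < L) (w0 : 0 < w) (wL : w * L = 2 * pi).

Let kn (n m : nat) : sin ((n%:R - m%:R) * w * L) = 0 /\ cos ((n%:R - m%:R) * w * L) = 1.
Proof.
rewrite -mulrA wL mulrBl.
by rewrite sinB cosB !cos_2pin !sin_2pin; split; ring.
Qed.

Let kp (n m : nat) : sin ((n%:R + m%:R) * w * L) = 0 /\ cos ((n%:R + m%:R) * w * L) = 1.
Proof.
rewrite -mulrA wL mulrDl.
by rewrite sinD cosD !cos_2pin !sin_2pin; split; ring.
Qed.

(** Product-to-sum formulas: [s = 1] stands for products of two cosines, [s = -1] for products of
    two sines. *)
Let orth_aux (s : R) : s ^+ 2 = 1 -> forall n m : nat,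
  sint 0 L (fun x => (cos ((n.+1%:R - m.+1%:R) * w * x) + s * cos ((n.+1%:R + m.+1%:R) * w * x)) / 2)
  = if n == m then L / 2 else 0.
Proof.
move=> s1 n m.
have -> : sint 0 L (fun x => (cos ((n.+1%:R - m.+1%:R) * w * x)
    + s * cos ((n.+1%:R + m.+1%:R) * w * x)) / 2)
  = (sint 0 L (fun x => cos ((n.+1%:R - m.+1%:R) * w * x)) +
     s * sint 0 L (fun x => cos ((n.+1%:R + m.+1%:R) * w * x))) / 2.
  rewrite -sintZ; last exact: tame_cosM.
  rewrite -sintD; [|exact: tame_cosM|apply: tameZ; exact: tame_cosM].
  rewrite -sintZr//.
  by apply: tameD; [exact: tame_cosM|apply: tameZ; exact: tame_cosM].
have np : (n.+1%:R + m.+1%:R) * w != 0.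
  by rewrite mulf_neq0 ?gt_eqF// -natrD ltr0n.
rewrite [X in _ + s * X]sint_cosM ?(ltW L0)// (kp n.+1 m.+1).1 mul0r mulr0 addr0.
have [->|nm] := eqVneq n m.
  rewrite (@sint_ext _ 0 L _ (fun=> 1)); last by move=> x; rewrite subrr !mul0r cos0.
  by rewrite sint_cst subr0 mul1r.
have nm0 : (n.+1%:R - m.+1%:R) * w != 0.
  by rewrite mulf_neq0 ?(gt_eqF w0)// subr_eq0 eqr_nat eqSS.
by rewrite sint_cosM ?(ltW L0)// (kn n.+1 m.+1).1 !mul0r.
Qed.

Lemma riemann_lebesgue F : tame F ->
  (sint 0 L (fun x => F x * cos (n.+1%:R * w * x)) @[n --> \oo] --> (0 : R)) /\
  (sint 0 L (fun x => F x * sin (n.+1%:R * w * x)) @[n --> \oo] --> (0 : R)).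
Proof.
move=> tF; have L2 : 0 < L / 2 by rewrite divr_gt0.
split.
- apply: (@bessel_cvg L (L / 2) (fun n x => cos (n.+1%:R * w * x))) => //.
  + exact: ltW.
  + by move=> n; exact: tame_cosM.
  + move=> n m; rewrite -(@orth_aux 1) ?expr1n//; apply: sint_ext => x.
    by rewrite !mulrBl !mulrDl cosB cosD; field.
- apply: (@bessel_cvg L (L / 2) (fun n x => sin (n.+1%:R * w * x))) => //.
  + exact: ltW.
  + by move=> n; exact: tame_sinM.
  + move=> n m; rewrite -(@orth_aux (-1)) ?sqrrN ?expr1n//; apply: sint_ext => x.
    by rewrite !mulrBl !mulrDl cosB cosD; field.
Qed.

End RiemannLebesgue.

Lemma sint_periodic L F c : continuous F -> (forall x, F (x + L) = F x) ->
  sint c (c + L) F = sint 0 L F.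
Proof.
move=> cF pF; have tF := continuous_tame cF.
rewrite -(@sint_chasles _ 0 c (c + L))// -(@sint_chasles _ L 0 (c + L))//.
have -> : sint L (c + L) F = sint 0 c F.
  by rewrite -[in LHS](add0r L) addrA addr0 -sint_shift//; exact: sint_ext.
by rewrite (sintC 0 c F); ring.
Qed.

(** * Dirichlet kernels of odd frequencies *)

Definition dcos M (x : R) : R := \sum_(j < M) cos ((2 * j%:R + 1) * x).
Definition dsin M (x : R) : R := \sum_(j < M) sin ((2 * j%:R + 1) * x).

Lemma dcosE M x : 2 * sin x * dcos M x = sin (M%:R * 2 * x).
Proof.
elim: M => [|M IH]; first by rewrite /dcos big_ord0 !mul0r sin0 mulr0.
rewrite /dcos big_ord_recr /= mulrDr -/(dcos M x) IH -[M.+1]addn1 (natrD _ M).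
have -> : (M%:R + 1) * 2 * x = M%:R * 2 * x + (x + x) by ring.
have -> : (2 * M%:R + 1) * x = M%:R * 2 * x + x by ring.
rewrite !(sinD, cosD).
have := cos2Dsin2 x; set s := sin x; set k := cos x => E.
have -> : s * k + k * s = 2 * (s * k) by ring.
apply/eqP; rewrite -subr_eq0; apply/eqP.
transitivity (sin (M%:R * 2 * x) * (1 - (k ^+ 2 + s ^+ 2))); first by ring.
by rewrite E subrr mulr0.
Qed.

Lemma dsinE M x : 2 * sin x * dsin M x = 1 - cos (M%:R * 2 * x).
Proof.
elim: M => [|M IH]; first by rewrite /dsin big_ord0 !mul0r cos0 mulr0 subrr.
rewrite /dsin big_ord_recr /= mulrDr -/(dsin M x) IH -[M.+1]addn1 (natrD _ M).
have -> : (M%:R + 1) * 2 * x = M%:R * 2 * x + (x + x) by ring.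
have -> : (2 * M%:R + 1) * x = M%:R * 2 * x + x by ring.
rewrite !(sinD, cosD).
have := cos2Dsin2 x; set s := sin x; set k := cos x => E.
apply/eqP; rewrite -subr_eq0; apply/eqP.
transitivity (- cos (M%:R * 2 * x) * (1 - (k ^+ 2 + s ^+ 2))); first by ring.
by rewrite E subrr mulr0.
Qed.

Lemma continuous_sum n (F : 'I_n -> R -> R) : (forall i, continuous (F i)) ->
  continuous (fun x => \sum_i F i x).
Proof.
elim: n F => [|n IH] F cF.
  rewrite (_ : (fun s => _) = fun=> 0); first by move=> x; exact: cvg_cst.
  by apply/funext => s; rewrite big_ord0.
rewrite (_ : (fun s => _) = fun s => F ord0 s + \sum_(i < n) F (lift ord0 i) s).
  by move=> x; apply: cvgD; [exact: cF|apply: IH => i; exact: cF].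
by apply/funext => s; rewrite big_ord_recl.
Qed.

Lemma sint_sum (a b : R) n (F : 'I_n -> R -> R) : (forall i, continuous (F i)) ->
  sint a b (fun s => \sum_i F i s) = \sum_i sint a b (F i).
Proof.
elim: n F => [|n IH] F cF.
  rewrite big_ord0 (@sint_ext _ _ _ _ (fun=> 0)) ?sint_cst ?mul0r// => s.
  exact: big_ord0.
rewrite big_ord_recl -IH; last by move=> i; exact: cF.
rewrite -sintD; [|exact: continuous_tame|].
  by apply: sint_ext => s; rewrite big_ord_recl.
by apply: continuous_tame; apply: continuous_sum => i; exact: cF.
Qed.

(** The product is a sum of cosines of even frequencies, of which only the frequency 0, coming from
    [j = 0], has a nonzero integral. Hence [M.+1]: the empty sum would give 0. *)
Lemma sint_cos_dcos M : sint 0 pi (fun x => cos x * dcos M.+1 x) = pi / 2.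
Proof.
have pi0 := @pi_ge0 R.
have z k : (0 < k)%N -> sint 0 pi (fun x : R => cos (2 * k%:R * x)) = 0.
  move=> k0; rewrite sint_cosM// ?mulf_neq0 ?pnatr_eq0 -?lt0n//.
  by rewrite (mulrC 2) -mulrA sin_2pin mul0r.
have E (j : nat) (x : R) : cos x * cos ((2 * j%:R + 1) * x) =
    2^-1 * cos (2 * j.+1%:R * x) + 2^-1 * cos (2 * j%:R * x).
  rewrite -[j.+1]addn1 (natrD _ j).
  have -> : 2 * (j%:R + 1) * x = (2 * j%:R + 1) * x + x by ring.
  have -> : 2 * j%:R * x = (2 * j%:R + 1) * x - x by ring.
  by rewrite cosD cosB; field.
rewrite (@sint_ext _ _ _ _ (fun x => \sum_(j < M.+1) cos x * cos ((2 * j%:R + 1) * x))); last first.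
  by move=> x; rewrite /dcos mulr_sumr.
rewrite sint_sum; last first.
  move=> i x; apply: cvgM; [exact: continuous_cos|exact: cont_cosM].
have I (j : nat) : sint 0 pi (fun x : R => cos x * cos ((2 * j%:R + 1) * x)) =
    2^-1 * sint 0 pi (fun x : R => cos (2 * j%:R * x)).
  rewrite (sint_ext _ _ (E j)) sintD; do ?(apply: tameZ; exact: tame_cosM).
  by rewrite !sintZ; do ?exact: tame_cosM; rewrite z// mulr0 add0r.
rewrite big_ord_recl /= I mulr0 big1 ?addr0.
  rewrite (@sint_ext _ 0 pi _ (fun=> 1)); last by move=> x; rewrite mul0r cos0.
  by rewrite sint_cst; field.
by move=> i _; rewrite I z ?mulr0// lift0.
Qed.

Lemma sint_cos_dsin M : sint 0 pi (fun x => cos x * dsin M x) = 0.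
Proof.
have pi0 := @pi_ge0 R.
have z k : sint 0 pi (fun x : R => sin (2 * k%:R * x)) = 0.
  have [->|k0] := eqVneq k 0%N.
    rewrite (@sint_ext _ 0 pi _ (fun=> 0)); last by move=> x; rewrite mulr0 mul0r sin0.
    by rewrite sint_cst mul0r.
  rewrite sint_sinM// ?mulf_neq0 ?pnatr_eq0//.
  by rewrite (mulrC 2) -mulrA cos_2pin subrr mul0r.
have E (j : nat) (x : R) : cos x * sin ((2 * j%:R + 1) * x) =
    2^-1 * sin (2 * j.+1%:R * x) + 2^-1 * sin (2 * j%:R * x).
  rewrite -[j.+1]addn1 (natrD _ j).
  have -> : 2 * (j%:R + 1) * x = (2 * j%:R + 1) * x + x by ring.
  have -> : 2 * j%:R * x = (2 * j%:R + 1) * x - x by ring.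
  by rewrite sinD sinB; field.
rewrite (@sint_ext _ _ _ _ (fun x => \sum_(j < M) cos x * sin ((2 * j%:R + 1) * x))); last first.
  by move=> x; rewrite /dsin mulr_sumr.
rewrite sint_sum; last first.
  move=> i x; apply: cvgM; [exact: continuous_cos|exact: cont_sinM].
rewrite big1// => j _.
rewrite (sint_ext _ _ (E j)) sintD; do ?(apply: tameZ; exact: tame_sinM).
by rewrite !sintZ; do ?exact: tame_sinM; rewrite !z mulr0 addr0.
Qed.


(** For a function with [b (x + pi) = - b x], the conjugate kernel cot (x / 2) / 2 over a period
    folds into 1 / sin x over half a period. Subtracting [b s * cos x], whose quotient by the sine
    has principal value 0, cancels the singularities at both 0 and pi. *)
Definition cdiff b s x := (b (s - x) - b s * cos x) / sin x.
Definition conjf b s := pi^-1 * sint 0 pi (cdiff b s).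

(** Minus twice the Fourier coefficient of order [2 * j + 1], taken over half a period: for odd
    frequencies the integrand is pi-periodic, and the even coefficients of an antiperiodic [b]
    vanish. So [hpoly] is a partial sum of the analytic completion of [- b]. *)
Definition hcoef b (j : nat) : C :=
  (- (2 / pi))%:C * (sint 0 pi (fun t => b t * cos ((2 * j%:R + 1) * t))
     -i* sint 0 pi (fun t => b t * sin ((2 * j%:R + 1) * t))).
Definition hpoly b M : {poly C} := \sum_(j < M) (hcoef b j)%:P * 'X ^+ (2 * j).+1.

Lemma cis_oddpi j : cis ((2 * j%:R + 1) * pi) = -1 :> C.
Proof.
rewrite mulrDl mul1r cisD (mulrC 2) -mulrA cis_2pi mul1r.
by apply: complex_ext => /=; rewrite ?cospi ?sinpi ?oppr0.
Qed.

Lemma cos_sub_oddpi j y : cos (y - (2 * j%:R + 1) * pi) = - cos y :> R.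
Proof.
rewrite cosB; have /(congr1 Re)/= -> := cis_oddpi j.
by have /(congr1 Im)/= -> := cis_oddpi j; ring.
Qed.

Lemma sin_sub_oddpi j y : sin (y - (2 * j%:R + 1) * pi) = - sin y :> R.
Proof.
rewrite sinB; have /(congr1 Re)/= -> := cis_oddpi j.
by have /(congr1 Im)/= -> := cis_oddpi j; ring.
Qed.

Lemma sint_reflect_periodic L F s : continuous F -> (forall x, F (x + L) = F x) ->
  sint 0 L (fun x => F (s - x)) = sint 0 L F.
Proof.
move=> cF pF.
have := sint_affine 0 L (-1) s cF.
rewrite mulr0 add0r mulN1r mulN1r => E.
rewrite (@sint_ext _ _ _ _ (fun x => F (-1 * x + s))); last first.
  by move=> x; rewrite mulN1r addrC.
rewrite -[LHS]opprK -E -sintC -(@sint_periodic L F (- L + s))//.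
by rewrite addrAC addNr add0r.
Qed.

Section ConjugateFunction.
Variables (b : R -> R) (K : R).
Hypotheses (K0 : 0 <= K) (cb : continuous b) (bpi : forall x, b (x + pi) = - b x).
(** A Lipschitz condition compatible with the sign change under pi: both sides vanish at [t = s] and
    at [t = s + pi]. It says that [cdiff] is bounded by [K]. *)
Hypothesis bK : forall s t, `|b t - b s * cos (s - t)| <= K * `|sin (s - t)|.

Let cb_refl s : continuous (fun x => b (s - x)).
Proof.
move=> x; apply: continuous_comp; last exact: cb.
by apply: cvgB; [exact: cvg_cst|exact: cvg_id].
Qed.

Lemma cdiff_num s x : `|b (s - x) - b s * cos x| <= K * `|sin x|.
Proof. by have := bK s (s - x); rewrite subKr. Qed.

Lemma cdiffK s x : b (s - x) = b s * cos x + cdiff b s x * sin x.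
Proof.
rewrite /cdiff; have [s0|s0] := eqVneq (sin x) 0; last by field.
have := cdiff_num s x; rewrite s0 normr0 !mulr0 normr_le0 subr_eq0 addr0.
by move/eqP.
Qed.

Lemma cdiff_bound s x : `|cdiff b s x| <= K.
Proof.
rewrite /cdiff; have [s0|s0] := eqVneq (sin x) 0.
  by rewrite s0 invr0 mulr0 normr0.
by rewrite normrM normfV ler_pdivrMr ?normr_gt0// cdiff_num.
Qed.

Lemma tame_cdiff s : tame (cdiff b s).
Proof.
(* Continuous regularizations of the quotient; where the sine vanishes they are 0, in agreement with
   [0^-1 = 0] in [cdiff]. *)
pose F_ n x := (b (s - x) - b s * cos x) * (sin x / (sin x ^+ 2 + n.+1%:R^-1)).
apply: (@tame_cvg _ F_ _ K); last exact: cdiff_bound.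
  move=> n; apply: continuous_tame => x; apply: cvgM.
    apply: cvgB; first exact: cb_refl.
    by apply: cvgM; [exact: cvg_cst|exact: continuous_cos].
  apply: cvgM; first exact: continuous_sin.
  apply: cvgV; first by rewrite gt_eqF// ltr_wpDl// sqr_ge0.
  apply: cvgD; last exact: cvg_cst.
  by apply: cvgM; exact: continuous_sin.
move=> x; rewrite /F_ /cdiff.
have [s0|s0] := eqVneq (sin x) 0.
  rewrite s0 invr0 !mulr0 (_ : (fun n => _) = fun=> 0); first exact: cvg_cst.
  by apply/funext => n; rewrite mul0r mulr0.
apply: cvgM; first exact: cvg_cst.
rewrite -[X in _ --> X](_ : sin x / (sin x ^+ 2 + 0) = _); last by rewrite addr0; field.
apply: cvgM; first exact: cvg_cst.
apply: cvgV; first by rewrite addr0 sqrf_eq0.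
apply: cvgD; first exact: cvg_cst.
exact: cvg_harmonic.
Qed.

Let cbM s f : continuous f -> continuous (fun x => b (s - x) * f x).
Proof. by move=> cf x; apply: cvgM; [exact: cb_refl|exact: cf]. Qed.

Let cdcos M : continuous (dcos M).
Proof. by apply: continuous_sum => i; exact: cont_cosM. Qed.
Let cdsin M : continuous (dsin M).
Proof. by apply: continuous_sum => i; exact: cont_sinM. Qed.

(** Partial sums are convolutions with [dcos] and [dsin]. The reflection [t = s - x] can stay on
    [[0, pi]] because [b] and the odd frequencies both change sign under pi, so that their product
    is pi-periodic. *)
Lemma hpoly_eval M s : (hpoly b M).[cis s] =
  (- (2 / pi))%:C * (sint 0 pi (fun x => b (s - x) * dcos M x)
                   +i* sint 0 pi (fun x => b (s - x) * dsin M x)).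
Proof.
have shiftc j : sint 0 pi (fun x => b (s - x) * cos ((2 * j%:R + 1) * x)) =
    sint 0 pi (fun t => b t * cos ((2 * j%:R + 1) * (s - t))).
  rewrite -(@sint_reflect_periodic pi (fun t => b t * cos ((2 * j%:R + 1) * (s - t))) s).
  - by apply: sint_ext => x; rewrite subKr.
  - move=> x; apply: cvgM; first exact: cb.
    apply: continuous_comp; last exact: continuous_cos.
    apply: cvgM; first exact: cvg_cst.
    by apply: cvgB; [exact: cvg_cst|exact: cvg_id].
  - move=> x; rewrite bpi.
    have -> : (2 * j%:R + 1) * (s - (x + pi)) =
       (2 * j%:R + 1) * (s - x) - (2 * j%:R + 1) * pi by ring.
    by rewrite cos_sub_oddpi mulrNN.
have shifts j : sint 0 pi (fun x => b (s - x) * sin ((2 * j%:R + 1) * x)) =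
    sint 0 pi (fun t => b t * sin ((2 * j%:R + 1) * (s - t))).
  rewrite -(@sint_reflect_periodic pi (fun t => b t * sin ((2 * j%:R + 1) * (s - t))) s).
  - by apply: sint_ext => x; rewrite subKr.
  - move=> x; apply: cvgM; first exact: cb.
    apply: continuous_comp; last exact: continuous_sin.
    apply: cvgM; first exact: cvg_cst.
    by apply: cvgB; [exact: cvg_cst|exact: cvg_id].
  - move=> x; rewrite bpi.
    have -> : (2 * j%:R + 1) * (s - (x + pi)) =
       (2 * j%:R + 1) * (s - x) - (2 * j%:R + 1) * pi by ring.
    by rewrite sin_sub_oddpi mulrNN.
have Ec : sint 0 pi (fun x => b (s - x) * dcos M x) =
    \sum_(j < M) sint 0 pi (fun x => b (s - x) * cos ((2 * j%:R + 1) * x)).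
  rewrite -sint_sum; last by move=> i; apply: cbM; exact: cont_cosM.
  by apply: sint_ext => x; rewrite mulr_sumr.
have Es : sint 0 pi (fun x => b (s - x) * dsin M x) =
    \sum_(j < M) sint 0 pi (fun x => b (s - x) * sin ((2 * j%:R + 1) * x)).
  rewrite -sint_sum; last by move=> i; apply: cbM; exact: cont_sinM.
  by apply: sint_ext => x; rewrite mulr_sumr.
have -> : sint 0 pi (fun x => b (s - x) * dcos M x)
    +i* sint 0 pi (fun x => b (s - x) * dsin M x) =
    \sum_(j < M) (sint 0 pi (fun x => b (s - x) * cos ((2 * j%:R + 1) * x)) +i*
      sint 0 pi (fun x => b (s - x) * sin ((2 * j%:R + 1) * x))).
  by rewrite Ec Es; apply: complex_ext => /=; rewrite raddf_sum.
rewrite /hpoly horner_sum mulr_sumr; apply: eq_bigr => j _.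
rewrite hornerM hornerC hornerXn cisX /hcoef -mulrA; congr (_ * _).
rewrite shiftc shifts.
have k1 : (2 * j).+1%:R * s = (2 * j%:R + 1) * s by rewrite -addn1 natrD natrM.
have tb g : continuous g -> tame (fun t => b t * g t).
  by move=> cg; apply: tameM; exact: continuous_tame.
apply: complex_ext; rewrite !ReImE /= k1.
- rewrite mulNr opprK -!sintZr; [|exact/tb/cont_sinM|exact/tb/cont_cosM].
  rewrite -sintD; [|by apply: tameM; [exact/tb/cont_cosM|exact: tame_cst]
                   |by apply: tameM; [exact/tb/cont_sinM|exact: tame_cst]].
  by apply: sint_ext => t; rewrite mulrBr cosB; ring.
- rewrite mulNr -!sintZr; [|exact/tb/cont_sinM|exact/tb/cont_cosM].
  rewrite -sintB; [|by apply: tameM; [exact/tb/cont_cosM|exact: tame_cst]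
                   |by apply: tameM; [exact/tb/cont_sinM|exact: tame_cst]].
  by apply: sint_ext => t; rewrite mulrBr sinB; ring.
Qed.

(** In [b (s - x) = b s * cos x + cdiff b s x * sin x] the first term yields exactly [b s]. In the
    second, [2 * sin x * dcos] collapses to a single sine, so the error is a Fourier coefficient of
    a bounded function. *)
Lemma hpoly_Re M s : Re (hpoly b M.+1).[cis s] =
  - b s - pi^-1 * sint 0 pi (fun x => cdiff b s x * sin (M.+1%:R * 2 * x)).
Proof.
rewrite hpoly_eval !ReImE /= mul0r subr0.
have tD := tame_cdiff s.
rewrite (@sint_ext _ _ _ (fun x => b (s - x) * dcos M.+1 x)
  (fun x => b s * (cos x * dcos M.+1 x) + 2^-1 * (cdiff b s x * sin (M.+1%:R * 2 * x)))).
  rewrite sintD; last 2 first.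
  - by apply: tameZ; apply: tameM; apply: continuous_tame => //; exact: continuous_cos.
  - by apply: tameZ; apply: tameM => //; exact: tame_sinM.
  rewrite !sintZ; [|by apply: tameM => //; exact: tame_sinM|].
    rewrite sint_cos_dcos; have p0 : (pi : R) != 0 by rewrite gt_eqF ?pi_gt0.
    by move: (pi : R) p0 => P p0; field.
  by apply: tameM; apply: continuous_tame => //; exact: continuous_cos.
by move=> x; rewrite cdiffK -dcosE; field.
Qed.

(** Here [2 * sin x * dsin] is 1 minus a cosine: the 1 produces [conjf], and the cosine an error
    that tends to 0. *)
Lemma hpoly_Im M s : Im (hpoly b M.+1).[cis s] =
  - conjf b s + pi^-1 * sint 0 pi (fun x => cdiff b s x * cos (M.+1%:R * 2 * x)).
Proof.
rewrite hpoly_eval !ReImE /= mul0r addr0 /conjf.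
have tD := tame_cdiff s.
rewrite (@sint_ext _ _ _ (fun x => b (s - x) * dsin M.+1 x)
  (fun x => b s * (cos x * dsin M.+1 x) + 2^-1 * (cdiff b s x - cdiff b s x * cos (M.+1%:R * 2 * x)))).
  have tc : tame (fun x => cdiff b s x * cos (M.+1%:R * 2 * x)).
    by apply: tameM => //; exact: tame_cosM.
  rewrite sintD; last 2 first.
  - by apply: tameZ; apply: tameM; apply: continuous_tame => //; exact: continuous_cos.
  - by apply: tameZ; exact: tameB.
  rewrite !sintZ; [|exact: tameB|].
    rewrite sintB// sint_cos_dsin; have p0 : (pi : R) != 0 by rewrite gt_eqF ?pi_gt0.
    by move: (pi : R) p0 => P p0; field.
  by apply: tameM; apply: continuous_tame => //; exact: continuous_cos.
move=> x; rewrite cdiffK; have := dsinE M.+1 x.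
set d := dsin _ _ => E.
have -> : cos (M.+1%:R * 2 * x) = 1 - 2 * sin x * d by rewrite E; ring.
by field.
Qed.

Lemma hpoly_cvg s : ccvg (fun n => (hpoly b n.+1).[cis s]) (- b s -i* conjf b s).
Proof.
have [] := @riemann_lebesgue pi 2 (pi_gt0 R) (ltr0n _ 2) erefl _ (tame_cdiff s).
move=> rc rs; split => /=.
- rewrite (funext (fun n => hpoly_Re n s)).
  have := cvgB (cvg_cst (- b s)) (cvgM (cvg_cst pi^-1) rs).
  by rewrite mulr0 subr0; apply.
- rewrite (funext (fun n => hpoly_Im n s)).
  have := cvgD (cvg_cst (- conjf b s)) (cvgM (cvg_cst pi^-1) rc).
  by rewrite mulr0 addr0; apply.
Qed.

Lemma hpoly_bound n s : `|Re (hpoly b n.+1).[cis s]| <= `|b s| + K.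
Proof.
have p0 := pi_gt0 R.
rewrite hpoly_Re (le_trans (ler_normB _ _))// normrN lerD//.
rewrite normrM ger0_norm ?invr_ge0 ?(ltW p0)// ler_pdivrMl// mulrC.
rewrite (le_trans (y := K * `|pi - 0|))//; last by rewrite subr0 gtr0_norm// mulrC.
apply: sint_bound; first by apply: tameM; [exact: tame_cdiff|exact: tame_sinM].
move=> x _; rewrite normrM -[leRHS]mulr1 ler_pM//; first exact: cdiff_bound.
exact: sin_max.
Qed.

Lemma hardy1 : hardy (2 * pi) (fun=> 1 : C) 1.
Proof.
have p0 : 0 <= 2 * pi :> R by rewrite mulr_ge0// pi_ge0.
move=> m m0; have m0' : (m%:R : R) != 0 by rewrite pnatr_eq0 -lt0n.
rewrite (@cint_ext _ _ _ _ (fun s => cis (m%:R * s))); last first.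
  by move=> s; rewrite mul1r cisX.
apply: complex_ext => /=.
- by rewrite sint_cosM// sin_2pin mul0r.
- by rewrite sint_sinM// cos_2pin subrr mul0r.
Qed.

Hypothesis cconj : continuous (conjf b).

Variable (M : R).
Hypothesis HM : forall s, `|b s| <= M.

Let ch : ccont (fun s => - b s -i* conjf b s).
Proof.
split => s /=; first by apply: cvgN; exact: cb.
by apply: cvgN; exact: cconj.
Qed.

(** The exponent is the limit of the polynomials [hpoly] in [cis], and the constant 1 has no
    coefficient of negative order. *)
Lemma hardy_cexp_conj : hardy (2 * pi) (fun s => cexp (- b s -i* conjf b s)) 1.
Proof.
have p0 : 0 <= 2 * pi :> R by rewrite mulr_ge0// pi_ge0.
have := @hardy_cexp_lim R (2 * pi) (fun=> 1) 1 (fun n => hpoly b n.+1)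
  (fun s => - b s -i* conjf b s) (M + K) p0 (ccont_cst _ _) ch hardy1
  (fun s _ => hpoly_cvg s).
move=> H m m1.
have {}H := H _ m m1.
rewrite -[RHS]H; first by apply: cint_ext => s; rewrite mul1r.
move=> n s _; rewrite (le_trans (ler_norm _))// (le_trans (hpoly_bound _ _))//.
by rewrite lerD2r.
Qed.

Lemma hardy_cexp_conjN (G : R -> C) m0 : ccont G -> hardy (2 * pi) G m0 ->
  hardy (2 * pi) (fun s => G s * cexp (b s +i* conjf b s)) m0.
Proof.
have p0 : 0 <= 2 * pi :> R by rewrite mulr_ge0// pi_ge0.
move=> cG HG; apply: (@hardy_cexp_lim R (2 * pi) G m0 (fun n => - hpoly b n.+1) _ (M + K)) => //.
- move=> s _; have [c1 c2] := hpoly_cvg s; split => /=.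
  + have E : (fun n => Re (- hpoly b n.+1).[cis s]) = (fun n => - Re (hpoly b n.+1).[cis s]).
      by apply/funext => n; rewrite hornerN ReN.
    by have := cvgN c1; rewrite opprK E; apply.
  + have E : (fun n => Im (- hpoly b n.+1).[cis s]) = (fun n => - Im (hpoly b n.+1).[cis s]).
      by apply/funext => n; rewrite hornerN ImN.
    by have := cvgN c2; rewrite opprK E; apply.
- move=> n s _; rewrite hornerN ReN (le_trans (ler_norm _))// normrN.
  by rewrite (le_trans (hpoly_bound _ _))// lerD2r.
Qed.

End ConjugateFunction.

End Circle.

(** * Moments and Fourier coefficients that determine a function *)

Section Uniqueness.
Local Open Scope complex_scope.
Context {R : realType}.
Local Notation C := R[i].
Local Notation Re := (@complex.Re R).
Local Notation Im := (@complex.Im R).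
Implicit Types (F N K : R -> R) (G : R -> C).

Lemma ler_sintW (M a b : R) F : a <= b -> tame F ->
  (forall x, a <= x <= b -> M <= F x) -> M * (b - a) <= sint a b F.
Proof.
by move=> ab tF MF; rewrite -(sint_cst a b M); apply: ler_sint => //; exact: tame_cst.
Qed.

(** Laplace's argument: if [N x1 > 0], the integral near the peak is at least a multiple of
    [k' ^+ n], and the negative part elsewhere is at most a multiple of [k ^+ n] with [k < k']. The
    two cannot cancel for large [n]. *)
Lemma peak_ge (a b x1 : R) N K : a < x1 < b -> continuous N -> continuous K ->
  (forall x, a <= x <= b -> 0 <= K x) -> K x1 = 1 ->
  (forall x, a <= x <= b -> x != x1 -> K x < 1) ->
  (forall n, sint a b (fun x => N x * K x ^+ n) = 0) -> N x1 <= 0.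
Proof.
move=> /andP[ax xb] cN cK K0 K1 Klt HN; rewrite leNgt; apply/negP => N0.
have ab : a <= b by rewrite (le_trans (ltW ax) (ltW xb)).
pose eta := N x1 / 2.
have eta0 : 0 < eta by rewrite divr_gt0.
have [d [d0 [da db dN]]] : exists d, 0 < d /\ [/\ a <= x1 - d, x1 + d <= b &
    forall x, `|x1 - x| < d -> eta <= N x].
  have /cvgrPdist_lt/(_ _ eta0)/nbhs_ballP[e /= e0 He] := cN x1.
  exists (Num.min e (Num.min (x1 - a) (b - x1))); split.
    by rewrite !lt_min e0 !subr_gt0 ax xb.
  split.
  - by rewrite lerBrDl -lerBrDr !ge_min lexx !orbT.
  - by rewrite -lerBrDl !ge_min lexx !orbT.
  - move=> x; rewrite lt_min => /andP[xe _].
    have := He x xe; rewrite ltr_norml => /andP[_].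
    by rewrite /eta => h; apply: ltW; lra.
have [k [k0 k1 kK]] : exists k, [/\ 0 <= k, k < 1 &
    forall x, a <= x <= b -> d <= `|x1 - x| -> K x <= k].
  have cKs u v : {within `[u, v], continuous K} by exact: continuous_subspaceT.
  have [c1 c1I H1] := EVT_max da (cKs a (x1 - d)).
  have [c2 c2I H2] := EVT_max db (cKs (x1 + d) b).
  move: c1I c2I; rewrite !in_itv/= => /andP[c1a c1b] /andP[c2a c2b].
  have c1K : K c1 < 1 by apply: Klt; [lra|rewrite lt_eqF//; lra].
  have c2K : K c2 < 1 by apply: Klt; [lra|rewrite gt_eqF//; lra].
  exists (Num.max (K c1) (K c2)); split.
  - by rewrite le_max K0//; lra.
  - by rewrite gt_max c1K c2K.
  - move=> x /andP[xa xb']; rewrite le_max ler_normr => /orP[h|h]; apply/orP.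
    + by left; apply: H1; rewrite in_itv/=; lra.
    + by right; apply: H2; rewrite in_itv/=; lra.
(* Strictly between the bound [k] of [K] away from the peak and the peak value 1. *)
pose k' := (1 + k) / 2.
have k'1 : 0 < k' by rewrite /k'; lra.
have kk' : k < k' by rewrite /k'; lra.
have [r [r0 rd rK]] : exists r, [/\ 0 < r, r < d & forall x, `|x1 - x| <= r -> k' <= K x].
  have e0 : 0 < 1 - k' by rewrite /k'; lra.
  have /cvgrPdist_lt/(_ _ e0)/nbhs_ballP[e /= e1 He] := cK x1.
  exists (Num.min e d / 2); split.
  - by rewrite divr_gt0// lt_min e1.
  - rewrite ltr_pdivrMr//; rewrite (le_lt_trans (y := d))// ?ge_min ?lexx ?orbT//.
    by rewrite mulr_natr mulr2n ltrDl.
  - move=> x xr; have : `|x1 - x| < e.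
      apply: le_lt_trans xr _; rewrite ltr_pdivrMr//.
      rewrite (le_lt_trans (y := e))// ?ge_min ?lexx//.
      by rewrite mulr_natr mulr2n ltrDl.
    move=> /He; rewrite K1 ltr_norml => /andP[_ h]; apply: ltW; lra.
have [_ /(_ (`|a| + `|b|)) [M0 HM0]] := continuous_tame cN.
have [M [M1 HM]] : exists M, 0 <= M /\ forall x, a <= x <= b -> `|N x| <= M.
  exists `|M0|; split => // x /andP[xa xb'].
  apply: le_trans (ler_norm M0); apply: HM0; rewrite ler_norml.
  have := ler_norm (- a); have := ler_norm b; rewrite normrN => h1 h2.
  by have := normr_ge0 a; have := normr_ge0 b => h3 h4; lra.
have cF n : continuous (fun x => N x * K x ^+ n).
  move=> x; apply: cvgM; first exact: cN.
  by apply: (continuous_comp (f := K) (g := fun y => y ^+ n)); [exact: cK|exact: exprn_continuous].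
have tF n := continuous_tame (cF n).
have key n : eta * (2 * r) * k' ^+ n <= M * (b - a) * k ^+ n.
  (* Within distance [d] of the peak the integrand is nonnegative, since [N] is at least [eta]
     there; only farther away can it be negative. *)
  have low x : a <= x <= b -> - (M * k ^+ n) <= N x * K x ^+ n.
    move=> xab; have [h|h] := ltP `|x1 - x| d.
      apply: (@le_trans _ _ 0).
        by rewrite oppr_le0 mulr_ge0// exprn_ge0.
      by rewrite mulr_ge0 ?exprn_ge0 ?K0// (le_trans (ltW eta0))// dN.
    rewrite lerNl -mulNr (le_trans (y := `|N x| * K x ^+ n))//.
      by rewrite ler_wpM2r ?exprn_ge0 ?K0// -normrN ler_norm.
    rewrite ler_pM ?exprn_ge0 ?K0 ?HM//.
    by apply: lerXn2r; rewrite ?nnegrE ?K0// kK.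
  have := HN n.
  rewrite -(@sint_chasles _ (x1 - r) a b)// -(@sint_chasles _ (x1 + r) (x1 - r) b)//.
  have l1 : a <= x1 - r by lra.
  have l2 : x1 - r <= x1 + r by lra.
  have l3 : x1 + r <= b by lra.
  have g1 : - (M * k ^+ n) * (x1 - r - a) <= sint a (x1 - r) (fun x => N x * K x ^+ n).
    by apply: ler_sintW => // x xI; apply: low; lra.
  have g3 : - (M * k ^+ n) * (b - (x1 + r)) <= sint (x1 + r) b (fun x => N x * K x ^+ n).
    by apply: ler_sintW => // x xI; apply: low; lra.
  have g2 : eta * k' ^+ n * (x1 + r - (x1 - r)) <=
      sint (x1 - r) (x1 + r) (fun x => N x * K x ^+ n).
    apply: ler_sintW => // x xI.
    have xr : `|x1 - x| <= r by rewrite ler_norml; lra.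
    rewrite ler_pM// ?(ltW eta0)// ?exprn_ge0 ?(ltW k'1)//.
      by apply: dN; exact: le_lt_trans rd.
    apply: lerXn2r; rewrite ?nnegrE ?(ltW k'1)// ?rK//.
    by rewrite (le_trans (ltW k'1))// rK.
  have kn0 : 0 <= M * k ^+ n * r by rewrite !mulr_ge0// ?exprn_ge0// ltW.
  move: g1 g2 g3; set A := sint a _ _; set B := sint _ (x1 + r) _; set D := sint _ b _.
  set P := M * k ^+ n; set Q := k' ^+ n => g1 g2 g3 E.
  have -> : M * (b - a) * k ^+ n = P * (b - a) by rewrite /P; ring.
  have e1 : eta * Q * (x1 + r - (x1 - r)) = eta * (2 * r) * Q by ring.
  have e2 : - P * (x1 - r - a) + - P * (b - (x1 + r)) = 2 * (P * r) - P * (b - a) by ring.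
  rewrite -/P in kn0; lra.
pose q := k / k'.
have q0 : 0 <= q by rewrite divr_ge0// ltW.
have q1 : `|q| < 1 by rewrite ger0_norm// ltr_pdivrMr// mul1r.
pose c := M * (b - a) + 1.
have c0 : 0 < c by rewrite ltr_wpDl// mulr_ge0// subr_ge0.
have er0 : 0 < eta * (2 * r) / c by rewrite divr_gt0// !mulr_gt0.
have /cvgr0Pnorm_lt/(_ _ er0)[n0 _ /(_ n0 (leqnn _))] := cvg_expr q1.
rewrite /= ger0_norm ?exprn_ge0// ltr_pdivlMr// => h.
have k'n : 0 < k' ^+ n0 by rewrite exprn_gt0.
have := key n0.
have -> : k ^+ n0 = q ^+ n0 * k' ^+ n0 by rewrite -exprMn /q divfK// gt_eqF.
rewrite mulrA ler_pM2r//.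
have qn : 0 <= q ^+ n0 by rewrite exprn_ge0.
move: h; rewrite /c mulrDr mulr1 => h1 h2.
rewrite [leRHS]mulrC in h2; lra.
Qed.

Lemma peak_eq0 (a b x1 : R) N K : a < x1 < b -> continuous N -> continuous K ->
  (forall x, a <= x <= b -> 0 <= K x) -> K x1 = 1 ->
  (forall x, a <= x <= b -> x != x1 -> K x < 1) ->
  (forall n, sint a b (fun x => N x * K x ^+ n) = 0) -> N x1 = 0.
Proof.
move=> xab cN cK K0 K1 Klt HN; apply/eqP; rewrite eq_le; apply/andP; split.
  exact: peak_ge HN.
rewrite -oppr_le0; apply: (@peak_ge a b x1 (fun x => - N x) K) => //.
  by move=> x; apply: cvgN; exact: cN.
move=> n; rewrite -[RHS]oppr0 -(HN n) -sintN.
  by apply: sint_ext => x; rewrite mulNr.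
apply: continuous_tame => x; apply: cvgM; first exact: cN.
by apply: (continuous_comp (f := K) (g := fun y => y ^+ n)); [exact: cK|exact: exprn_continuous].
Qed.

Lemma continuous_horner (P : {poly R}) : continuous (fun x => P.[x]).
Proof.
elim/poly_ind: P => [|P c IH].
  rewrite (_ : (fun x => _) = fun=> 0); first by move=> x; exact: cvg_cst.
  by apply/funext => x; rewrite horner0.
rewrite (_ : (fun x => _) = fun x => P.[x] * x + c).
  move=> x; apply: cvgD; last exact: cvg_cst.
  by apply: cvgM; [exact: IH|exact: cvg_id].
by apply/funext => x; rewrite hornerMXaddC.
Qed.

(** Vanishing moments extend to all polynomials by linearity, among them the powers of one
    polynomial with a single peak at [x1]. *)
Lemma moments_eq0 (X x1 : R) N : continuous N -> - X < x1 < X ->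
  (forall k, sint (- X) X (fun x => N x * x ^+ k) = 0) -> N x1 = 0.
Proof.
move=> cN xX HN.
have X0 : 0 < X by lra.
have cX k : continuous (fun x : R => x ^+ k) by exact: exprn_continuous.
have tN k : tame (fun x => N x * x ^+ k).
  by apply: continuous_tame => x; apply: cvgM; [exact: cN|exact: cX].
have HP (P : {poly R}) : sint (- X) X (fun x => N x * P.[x]) = 0.
  suff H k : sint (- X) X (fun x => N x * P.[x] * x ^+ k) = 0.
    by rewrite -(H 0%N); apply: sint_ext => x; rewrite expr0 mulr1.
  elim/poly_ind: P k => [|P c IH] k.
    rewrite (@sint_ext _ _ _ _ (fun=> 0)) ?sint_cst ?mul0r// => x.
    by rewrite horner0 mulr0 mul0r.
  rewrite (@sint_ext _ _ _ _ (fun x => N x * P.[x] * x ^+ k.+1 + c * (N x * x ^+ k))).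
    rewrite sintD; [|apply: continuous_tame|exact: tameZ].
      by rewrite IH sintZ// HN mulr0 addr0.
    move=> x; apply: cvgM; last exact: cX.
    by apply: cvgM; [exact: cN|exact: continuous_horner].
  by move=> x; rewrite hornerMXaddC exprS; ring.
(* On [[- X, X]] the distance to [x1] is at most [2 * X], so this scaling keeps the values in
   [[0, 1]]. *)
pose P : {poly R} := 1 - ((2 * X)^-1 *: ('X - x1%:P)) ^+ 2.
have PE x : P.[x] = 1 - ((x - x1) / (2 * X)) ^+ 2.
  by rewrite /P !hornerE mulrC.
have Xn : 2 * X != 0 by rewrite mulf_neq0// gt_eqF.
apply: (@peak_eq0 (- X) X x1 N (fun x => P.[x])) => //.
- exact: continuous_horner.
- move=> x xI; rewrite PE subr_ge0 -[leRHS](expr1n _ 2) -real_normK ?num_real//.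
  apply: lerXn2r; rewrite ?nnegrE// normrM normfV ler_pdivrMr; last first.
    by rewrite normr_gt0.
  by rewrite mul1r (gtr0_norm (x := 2 * X)) ?mulr_gt0// ler_norml; lra.
- by rewrite PE subrr mul0r expr0n/= subr0.
- move=> x xI xx1; rewrite PE ltrBlDr ltrDl exprn_even_gt0//=.
  by rewrite mulf_neq0 ?invr_neq0// subr_eq0.
- move=> n; rewrite -[RHS](HP (P ^+ n)); apply: sint_ext => x.
  by rewrite horner_exp.
Qed.

Lemma cos_lt1 (x : R) : 0 < `|x| < 2 * pi -> cos x < 1.
Proof.
wlog x0 : x / 0 <= x => [H|].
  have [/H//|/ltW xn] := leP 0 x; rewrite -cosN -normrN; apply: H.
  by rewrite oppr_ge0.
rewrite ger0_norm// => /andP[x1 x2].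
have -> : cos x = cos (x / 2 + x / 2) by congr cos; field.
rewrite cosD -!expr2.
have s0 : 0 < sin (x / 2).
  by apply: sin_gt0_pi; rewrite divr_gt0//= ltr_pdivrMr// mulrC.
have := cos2Dsin2 (x / 2); have : 0 < sin (x / 2) ^+ 2 by rewrite exprn_gt0.
by lra.
Qed.

(** For a real function the coefficients of orders [m] and [- m] are conjugate, so all but the mean
    vanish. [F] minus its mean is then tested against powers of a trigonometric peak at [s1]. *)
Lemma fourier_const F : continuous F ->
  hardy (2 * pi) (fun s => (F s)%:C) 1 ->
  exists k, forall s, 0 < s < 2 * pi -> F s = k.
Proof.
move=> cF HF; have p0 := pi_gt0 R; have pp0 : 0 < 2 * pi :> R by rewrite mulr_gt0.
have tF := continuous_tame cF.
have Fc m : (0 < m)%N -> sint 0 (2 * pi) (fun s => F s * cos (m%:R * s)) = 0.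
  move=> m0; transitivity (Re (cint 0 (2 * pi) (fun s => (F s)%:C * cis s ^+ m))); last by rewrite HF.
  apply: sint_ext => s.
  by rewrite cisX ReM /= mul0r subr0.
have Fs m : (0 < m)%N -> sint 0 (2 * pi) (fun s => F s * sin (m%:R * s)) = 0.
  move=> m0; transitivity (Im (cint 0 (2 * pi) (fun s => (F s)%:C * cis s ^+ m))); last by rewrite HF.
  apply: sint_ext => s.
  by rewrite cisX ImM /= mul0r addr0.
pose k := sint 0 (2 * pi) F / (2 * pi); exists k => s1 s1I.
pose H s := F s - k.
have cH : continuous H by move=> s; apply: cvgB; [exact: cF|exact: cvg_cst].
have Hm m : sint 0 (2 * pi) (fun s => H s * cos (m%:R * s)) = 0 /\
            sint 0 (2 * pi) (fun s => H s * sin (m%:R * s)) = 0.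
  have tc := @tame_cosM R m%:R; have ts := @tame_sinM R m%:R.
  have -> : sint 0 (2 * pi) (fun s => H s * cos (m%:R * s)) =
     sint 0 (2 * pi) (fun s => F s * cos (m%:R * s)) - k * sint 0 (2 * pi) (fun s => cos (m%:R * s)).
    rewrite -sintZ// -sintB; [|exact: tameM|exact: tameZ].
    by apply: sint_ext => s; rewrite mulrBl.
  have -> : sint 0 (2 * pi) (fun s => H s * sin (m%:R * s)) =
     sint 0 (2 * pi) (fun s => F s * sin (m%:R * s)) - k * sint 0 (2 * pi) (fun s => sin (m%:R * s)).
    rewrite -sintZ// -sintB; [|exact: tameM|exact: tameZ].
    by apply: sint_ext => s; rewrite mulrBl.
  have [->|m0] := posnP m.
    rewrite !(@sint_ext _ 0 (2 * pi) (fun s => _ s * cos (0 * s)) F); last first.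
      by move=> s; rewrite mul0r cos0 mulr1.
    rewrite (@sint_ext _ 0 (2 * pi) (fun s => cos (0 * s)) (fun=> 1)); last first.
      by move=> s; rewrite mul0r cos0.
    rewrite (@sint_ext _ 0 (2 * pi) (fun s => _ s * sin (0 * s)) (fun=> 0)); last first.
      by move=> s; rewrite mul0r sin0 mulr0.
    rewrite (@sint_ext _ 0 (2 * pi) (fun s => sin (0 * s)) (fun=> 0)); last first.
      by move=> s; rewrite mul0r sin0.
    rewrite !sint_cst !subr0 !mul0r mulr0 subr0 mul1r /k divfK ?gt_eqF//.
    by rewrite subrr.
  have mr0 : (m%:R : R) != 0 by rewrite pnatr_eq0 -lt0n.
  rewrite Fc// Fs// sint_cosM ?(ltW pp0)// sint_sinM ?(ltW pp0)//.
  by rewrite sin_2pin cos_2pin !subrr !mul0r mulr0 subr0.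
have Hz (m : int) : sint 0 (2 * pi) (fun s => H s * cos (m%:~R * s)) = 0 /\
            sint 0 (2 * pi) (fun s => H s * sin (m%:~R * s)) = 0.
  case: m => [m|m]; first exact: Hm.
  have [c1 c2] := Hm m.+1; rewrite NegzE mulrNz; split.
    by rewrite -[RHS]c1; apply: sint_ext => s; rewrite mulNr cosN.
  rewrite -[RHS]oppr0 -[in RHS]c2 -sintN.
    by apply: sint_ext => s; rewrite mulNr sinN mulrN.
  by apply: tameM; [exact: continuous_tame|exact: tame_sinM].
pose K s := (1 + cos (s - s1)) / 2.
have cK : continuous K.
  move=> s; apply: cvgM; last exact: cvg_cst.
  apply: cvgD; first exact: cvg_cst.
  apply: continuous_comp; last exact: continuous_cos.
  by apply: cvgB; [exact: cvg_id|exact: cvg_cst].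
have cHK n : continuous (fun s => H s * K s ^+ n).
  move=> s; apply: cvgM; first exact: cH.
  by apply: (continuous_comp (f := K) (g := fun y => y ^+ n)); [exact: cK|exact: exprn_continuous].
(* Each factor [K] shifts frequencies by 1 up and down and mixes sine with cosine, hence an
   induction over integer frequencies for both at once. *)
have Hn n (m : int) : sint 0 (2 * pi) (fun s => H s * K s ^+ n * cos (m%:~R * s)) = 0 /\
            sint 0 (2 * pi) (fun s => H s * K s ^+ n * sin (m%:~R * s)) = 0.
  elim: n m => [|n IH] m.
    have [c1 c2] := Hz m; split; [rewrite -[RHS]c1|rewrite -[RHS]c2];
      by apply: sint_ext => s; rewrite expr0 mulr1.
  have tc (j : int) : tame (fun s => H s * K s ^+ n * cos (j%:~R * s)).
    by apply: tameM; [exact: continuous_tame|exact: tame_cosM].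
  have ts (j : int) : tame (fun s => H s * K s ^+ n * sin (j%:~R * s)).
    by apply: tameM; [exact: continuous_tame|exact: tame_sinM].
  have [c1 d1] := IH m; have [c2 d2] := IH (m + 1); have [c3 d3] := IH (m - 1).
  have lin A1 A2 A3 A4 A5 (F1 F2 F3 F4 F5 : R -> R) : tame F1 -> tame F2 -> tame F3 ->
    tame F4 -> tame F5 -> sint 0 (2 * pi) F1 = 0 -> sint 0 (2 * pi) F2 = 0 ->
    sint 0 (2 * pi) F3 = 0 -> sint 0 (2 * pi) F4 = 0 -> sint 0 (2 * pi) F5 = 0 ->
    sint 0 (2 * pi) (fun s => A1 * F1 s + (A2 * F2 s + (A3 * F3 s + (A4 * F4 s + A5 * F5 s)))) = 0.
    move=> t1 t2 t3 t4 t5 e1 e2 e3 e4 e5.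
    by rewrite !sintD ?sintZ ?e1 ?e2 ?e3 ?e4 ?e5 ?mulr0 ?addr0//;
      do ?(exact: tameZ || apply: tameD).
  split.
  - rewrite -[RHS](lin 2^-1 (4^-1 * cos s1) (4^-1 * sin s1) (4^-1 * cos s1) (- (4^-1 * sin s1))
      _ _ _ _ _ (tc m) (tc (m + 1)) (ts (m + 1)) (tc (m - 1)) (ts (m - 1)))//.
    apply: sint_ext => s; rewrite exprS /K !intrD mulrNz !mulrDl !mulNr !mul1r.
    by rewrite !cosB !sinB !cosD !sinD; field.
  - rewrite -[RHS](lin 2^-1 (4^-1 * cos s1) (- (4^-1 * sin s1)) (4^-1 * cos s1) ((4^-1 * sin s1))
      _ _ _ _ _ (ts m) (ts (m + 1)) (tc (m + 1)) (ts (m - 1)) (tc (m - 1)))//.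
    apply: sint_ext => s; rewrite exprS /K !intrD mulrNz !mulrDl !mulNr !mul1r.
    by rewrite !cosB !sinB !cosD !sinD; field.
apply/eqP; rewrite -subr_eq0; apply/eqP.
apply: (@peak_eq0 0 (2 * pi) s1 H K) => //.
- by move=> s _; rewrite divr_ge0// -lerBlDl sub0r cos_geN1.
- by rewrite /K subrr cos0 divff.
- move=> s sI ss1; rewrite ltr_pdivrMr// mul1r.
  have : cos (s - s1) < 1; last by lra.
  apply: cos_lt1; rewrite normr_gt0 subr_eq0 ss1/= ltr_norml; lra.
- move=> n; have [c _] := Hn n 0; rewrite -[RHS]c; apply: sint_ext => s.
  by rewrite mul0r cos0 mulr1.
Qed.

Lemma cvg_ext (u v : nat -> R) (l : R) : (forall n, u n = v n) ->
  u n @[n --> \oo] --> l -> v n @[n --> \oo] --> l.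
Proof. by move=> /funext ->. Qed.

Lemma riemann_lebesgue_cis G : ccont G ->
  ccvg (fun n => cint 0 (2 * pi) (fun s => G s * cis s ^+ n.+1)) 0.
Proof.
move=> /ccont_tame[t1 t2]; have p0 := pi_gt0 R.
have pp0 : 0 < 2 * pi :> R by rewrite mulr_gt0.
have [a1 a2] := @riemann_lebesgue R (2 * pi) 1 pp0 ltr01 (mul1r _) _ t1.
have [b1 b2] := @riemann_lebesgue R (2 * pi) 1 pp0 ltr01 (mul1r _) _ t2.
split => /=.
- have h := @cvgB R R nat \oo _ _ _ _ _ a1 b2; rewrite subr0 in h.
  apply: cvg_ext (h _) => n /=; rewrite ?fctE -sintB.
  + by apply: sint_ext => s; rewrite cisX ReM /= mulr1.
  + by apply: tameM => //; exact: tame_cosM.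
  + by apply: tameM => //; exact: tame_sinM.
- have h := @cvgD R R nat \oo _ _ _ _ _ a2 b1; rewrite addr0 in h.
  apply: cvg_ext (h _) => n /=; rewrite ?fctE -sintD.
  + by apply: sint_ext => s; rewrite cisX ImM /= mulr1.
  + by apply: tameM => //; exact: tame_sinM.
  + by apply: tameM => //; exact: tame_cosM.
Qed.

(* [sin s * cis s = (cis s ^+ 2 - 1) / 2i]: multiplication by it acts on Fourier
   coefficients as a difference operator, injective on null sequences. *)
Lemma hardy_div_sin G k m0 : (0 < m0)%N -> ccont G ->
  hardy (2 * pi) (fun s => G s * ((sin s)%:C * cis s) ^+ k) m0 ->
  hardy (2 * pi) G m0.
Proof.
move=> m00; elim: k G => [|k IH] G cG.
  move=> H m m1; rewrite -[RHS](H m m1); apply: cint_ext => s.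
  by rewrite expr0 mulr1.
have cX j : ccont (fun s : R => cis s ^+ j) by apply: ccontX; exact: ccont_cisid.
have cs : ccont (fun s : R => (sin s)%:C * cis s).
  by apply: ccontM; [apply: ccont_real; exact: continuous_sin|exact: ccont_cisid].
move=> H; apply: IH => // m m0m.
pose T j := cint 0 (2 * pi) (fun s => G s * ((sin s)%:C * cis s) ^+ k * cis s ^+ j).
have cT j : ccont (fun s : R => G s * ((sin s)%:C * cis s) ^+ k * cis s ^+ j).
  by apply: ccontM => //; apply: ccontM => //; exact: ccontX.
(* [ih] is 1 / (2i), kept opaque behind its two components. *)
have [ih [ihR ihI]] : exists z : C, Re z = 0 /\ Im z = - 2^-1.
  by exists (Complex 0 (- 2^-1)).
have E s : (sin s)%:C * cis s = ih * (cis s ^+ 2 - 1) :> C.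
  rewrite cisX; have := cos2Dsin2 s => e.
  have -> : 2%:R * s = s + s by ring.
  have cR (t : R) : Re (cis t) = cos t by [].
  have cI (t : R) : Im (cis t) = sin t by [].
  apply: complex_ext; rewrite !ReImE ?cR ?cI ihR ihI ?cosD ?sinD; first by field.
  transitivity (2^-1 * (1 - cos s ^+ 2 + sin s ^+ 2)); last by field.
  have -> : 1 - cos s ^+ 2 = sin s ^+ 2 by rewrite -e addrAC subrr add0r.
  by field.
have step j : (m0 <= j)%N -> T j.+2 = T j.
  move=> jm; have := H j jm.
  rewrite (@cint_ext _ _ _ _ (fun s => ih * (G s * ((sin s)%:C * cis s) ^+ k * cis s ^+ j.+2)
     + - ih * (G s * ((sin s)%:C * cis s) ^+ k * cis s ^+ j))); last first.
    move=> s; rewrite exprSr {2}E -[j.+2]addn2 exprD; ring.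
  rewrite cintD; [|by apply: ccontM => //; exact: ccont_cst..].
  rewrite !cintZ// -/(T j) -/(T j.+2) mulNr => /eqP; rewrite subr_eq0.
  move=> /eqP; apply: mulfI; apply/eqP => ih0.
  by move/eqP: ihI; rewrite ih0 /= eq_sym oppr_eq0 invr_eq0 pnatr_eq0.
have steps j : T (m + 2 * j)%N = T m.
  elim: j => [|j IHj]; first by rewrite muln0 addn0.
  rewrite -IHj (_ : (m + 2 * j.+1 = (m + 2 * j).+2)%N); last by rewrite mulnS addnCA.
  by apply: step; rewrite (leq_trans m0m)// leq_addr.
have [r1 r2] := riemann_lebesgue_cis (ccontM cG (ccontX k cs)).
(* [riemann_lebesgue_cis] is about the exponent [n.+1], hence the predecessor of the positive
   [m]. *)
have mono : (m.-1 + 2 * j)%N @[j --> \oo] --> \oo.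
  move=> A [N _ NA]; exists N => // j /= Nj; apply: NA => /=.
  by rewrite (leq_trans Nj)// mul2n -addnn addnA leq_addl.
have mS j : (m.-1 + 2 * j).+1 = (m + 2 * j)%N.
  by rewrite -addSn prednK// (leq_trans m00).
apply: complex_ext => /=.
- apply: (cvg_unique _ _ (cvg_comp _ _ mono r1)) => //.
  rewrite (_ : _ \o _ = fun=> Re (T m)); first exact: cvg_cst.
  by apply/funext => j; rewrite -(steps j) -mS.
- apply: (cvg_unique _ _ (cvg_comp _ _ mono r2)) => //.
  rewrite (_ : _ \o _ = fun=> Im (T m)); first exact: cvg_cst.
  by apply/funext => j; rewrite -(steps j) -mS.
Qed.

End Uniqueness.

(** * Polar coordinates *)

Section ContinuityRules.
Context {R : realType} (T : topologicalType).
Implicit Types f g : T -> R.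

Lemma cnt_cst (k : R) : continuous (fun _ : T => k).
Proof. by move=> s; exact: cvg_cst. Qed.
Lemma cnt_add f g : continuous f -> continuous g -> continuous (fun s => f s + g s).
Proof. by move=> cf cg s; apply: cvgD; [exact: cf|exact: cg]. Qed.
Lemma cnt_opp f : continuous f -> continuous (fun s => - f s).
Proof. by move=> cf s; apply: cvgN; exact: cf. Qed.
Lemma cnt_mul f g : continuous f -> continuous g -> continuous (fun s => f s * g s).
Proof. by move=> cf cg s; apply: cvgM; [exact: cf|exact: cg]. Qed.
Lemma cnt_comp (h : R -> R) f : continuous h -> continuous f -> continuous (fun s => h (f s)).
Proof.
by move=> ch cf s; apply: (@continuous_comp _ _ _ f h); [exact: cf|exact: ch].
Qed.
Lemma cnt_cos f : continuous f -> continuous (fun s => cos (f s)).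
Proof. by apply: cnt_comp; exact: continuous_cos. Qed.
Lemma cnt_sin f : continuous f -> continuous (fun s => sin (f s)).
Proof. by apply: cnt_comp; exact: continuous_sin. Qed.
Lemma cnt_exp f : continuous f -> continuous (fun s => expR (f s)).
Proof. by apply: cnt_comp; exact: continuous_expR. Qed.
Lemma cnt_pow n f : continuous f -> continuous (fun s => f s ^+ n).
Proof. by apply: (@cnt_comp (fun y => y ^+ n)); exact: exprn_continuous. Qed.
Lemma cnt_norm f : continuous f -> continuous (fun s => `|f s|).
Proof. by move=> cf s; apply: cvg_norm; exact: cf. Qed.
Lemma cnt_inv f : (forall s, f s != 0) -> continuous f -> continuous (fun s => (f s)^-1).
Proof. by move=> f0 cf s; apply: cvgV => //; exact: cf. Qed.
Lemma cnt_max f g : continuous f -> continuous g -> continuous (fun s => Num.max (f s) (g s)).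
Proof. by move=> cf cg s; apply: continuous_max; [exact: cf|exact: cg]. Qed.

End ContinuityRules.

Lemma cnt_fst (T U V : topologicalType) (f : T -> U * V) :
  continuous f -> continuous (fun s => (f s).1).
Proof.
by move=> cf s; apply: (@continuous_comp _ _ _ f fst); [exact: cf|exact: cvg_fst].
Qed.
Lemma cnt_snd (T U V : topologicalType) (f : T -> U * V) :
  continuous f -> continuous (fun s => (f s).2).
Proof.
by move=> cf s; apply: (@continuous_comp _ _ _ f snd); [exact: cf|exact: cvg_snd].
Qed.
Lemma cnt_id (T : topologicalType) : continuous (fun s : T => s).
Proof. by move=> s; exact: cvg_id. Qed.

Ltac cnt1 := match goal with
  | |- continuous (fun s => s) => apply: cnt_id
  | |- continuous (fun _ => ?k) => exact: cnt_cst
  | |- continuous (GRing.mul ?k) => refine (@cnt_mul _ _ (fun _ => k) (fun s => s) _ _)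
  | |- continuous snd => by move=> ?; exact: cvg_snd
  | |- continuous fst => by move=> ?; exact: cvg_fst
  | |- continuous sin => exact: continuous_sin
  | |- continuous cos => exact: continuous_cos
  | |- continuous expR => exact: continuous_expR
  | H : continuous ?h |- continuous ?h => exact: H
  | |- continuous (fun s => GRing.add (@?f s) (@?g s)) => refine (@cnt_add _ _ f g _ _)
  | |- continuous (fun s => GRing.opp (@?f s)) => refine (@cnt_opp _ _ f _)
  | |- continuous (fun s => GRing.mul (@?f s) (@?g s)) => refine (@cnt_mul _ _ f g _ _)
  | |- continuous (fun s => cos (@?f s)) => refine (@cnt_cos _ _ f _)
  | |- continuous (fun s => sin (@?f s)) => refine (@cnt_sin _ _ f _)
  | |- continuous (fun s => expR (@?f s)) => refine (@cnt_exp _ _ f _)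
  | |- continuous (fun s => GRing.exp (@?f s) ?n) => refine (@cnt_pow _ _ n f _)
  | |- continuous (fun s => Num.norm (@?f s)) => refine (@cnt_norm _ _ f _)
  | |- continuous (fun s => (@?f s).1) => refine (@cnt_fst _ _ _ f _)
  | |- continuous (fun s => (@?f s).2) => refine (@cnt_snd _ _ _ f _)
  | H : continuous (fun p => ?h p.1 p.2) |- continuous (fun s => ?h (@?f s) (@?g s)) =>
        refine (@continuous_comp2 _ _ _ _ f g h H _ _)
  | H : continuous ?h |- continuous (fun s => ?h (@?f s)) => refine (@cnt_comp _ _ h f H _)
  end.
Ltac cnt := repeat cnt1.

Section Polar.
Context {R : realType}.
Variables (F : R -> R -> R) (q : R).
Hypotheses (q0 : 0 < q) (cF : continuous (fun p : R * R => F p.1 p.2)).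
Hypothesis F0 : forall x y, q <= `|x| \/ q <= `|y| -> F x y = 0.
(** A point at distance at least [2 * q] from the origin has a coordinate of size at least [q],
    because [2 * q ^+ 2 < (2 * q) ^+ 2]; there [F] is 0. *)
Let T := 2 * q.

Let F0r t al : T <= t -> F (t * cos al) (t * sin al) = 0.
Proof.
move=> tT; apply: F0.
have t0 : 0 < t by rewrite (lt_le_trans _ tT)// mulr_gt0.
have [h|/ltW h] := leP q `|t * cos al|; [by left|right; rewrite leNgt; apply/negP => /ltW h'].
have : (t * cos al) ^+ 2 + (t * sin al) ^+ 2 <= q ^+ 2 + q ^+ 2.
  by apply: lerD; rewrite -real_normK ?num_real//; apply: lerXn2r; rewrite ?nnegrE// ltW.
rewrite !exprMn -mulrDr cos2Dsin2 mulr1.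
have : T ^+ 2 <= t ^+ 2.
  by apply: lerXn2r => //; rewrite nnegrE ?(ltW t0)// mulr_ge0// ltW.
have : 0 < q ^+ 2 by rewrite exprn_gt0.
by rewrite /T; lra.
Qed.

Let Fb : exists M, 0 <= M /\ forall x y, `|F x y| <= M.
Proof.
have /compact_bounded H : compact ((fun p : R * R => F p.1 p.2) @` (`[- q, q] `*` `[- q, q])).
  apply: continuous_compact; first exact: continuous_subspaceT.
  by apply: compact_setX; exact: segment_compact.
have [M [_ HM]] := H.
exists (`|M| + 1); split; first by rewrite addr_ge0.
move=> x y.
have [h|/ltW h] := leP q `|x|; first by rewrite F0 ?normr0 ?addr_ge0//; left.
have [h'|/ltW h'] := leP q `|y|; first by rewrite F0 ?normr0 ?addr_ge0//; right.
apply: (HM (`|M| + 1)); first by rewrite ltr_pwDr// ler_norm.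
exists (x, y) => //=; split; rewrite /= in_itv/= -ler_norml; lra.
Qed.

Let T0 : 0 < T. Proof. by rewrite mulr_gt0. Qed.

(** Passing from radius and angle to [y], then to [x], degenerates at the horizontal directions. Two
    wedges of slope [t] are cut off, the rest is treated by one-variable substitutions and
    [sint_fubini], and the total error is at most a multiple of [t]. *)
Lemma polar : sint 0 pi (fun al => sint 0 T (fun t => t * F (t * cos al) (t * sin al)))
  = sint 0 q (fun y => sint (- q) q (F^~ y)).
Proof.
have [M [M0 FM]] := Fb; have p0 := pi_gt0 R.
set A := LHS; set B := RHS.
suff H t : 0 < t < 1 -> `|A - B| <= (2 * (T * M * T) + 4 * (q * M) * q) * t.
  set K := 2 * (T * M * T) + 4 * (q * M) * q in H.
  have K0 : 0 <= K.
    by rewrite addr_ge0// !mulr_ge0// ?ltW.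
  apply/eqP; rewrite -subr_eq0 -normr_le0; apply/ler_addgt0Pl => e e0; rewrite addr0.
  pose t := Num.min (e / (K + 1)) (2^-1).
  have K1 : 0 < K + 1 by rewrite ltr_wpDl.
  have t0 : 0 < t by rewrite lt_min divr_gt0//= invr_gt0.
  apply: (le_trans (H t _)).
    by rewrite t0 /= (le_lt_trans (y := 2^-1)) ?ge_min ?lexx ?orbT// invf_lt1// ltr1n.
  apply: (@le_trans _ _ (K * (e / (K + 1)))).
    by rewrite ler_wpM2l// ge_min lexx.
  by rewrite mulrCA ger_pMr// ler_pdivrMr// mul1r lerDl.
move=> /andP[t0 t1].
(* The angle of slope [t]: its cotangent is [t^-1], and [e <= t] bounds the contribution of the
   wedges. *)
pose e := atan t.
have te : tan e = t by rewrite atanK.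
have [c cI atE] : exists2 c, c \in `]0, t[ & atan t = (1 + c ^+ 2)^-1 * t.
  have [] := @MVT R atan (fun x => (1 + x ^+ 2)^-1) 0 t t0.
  - by apply: continuous_subspaceT => x; exact: continuous_atan.
  - by move=> c cI; rewrite atan0 !subr0 => E; exists c.
have c20 : 0 <= c ^+ 2 by rewrite sqr_ge0.
have e0 : 0 < e by rewrite /e atE mulr_gt0// invr_gt0 ltr_pwDl.
have et : e <= t by rewrite /e atE ler_piMl// ?(ltW t0)// invf_le1 ?ltr_pwDl// lerDl.
have e1 : e < pi / 2 by rewrite atan_ltpi2.
have se0 : 0 < sin e by apply: sin_gt0_pi; rewrite e0/=; lra.
have ce0 : 0 < cos e by apply: cos_gt0_pihalf; lra.
have cte : cos e / sin e = t^-1 by rewrite -te /tan invf_div.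
(* Equal to the sine on [[e, pi - e]] and nowhere 0, which keeps the integrands continuous on the
   whole line. *)
pose S al := Num.max (sin al) (sin e).
have S0 al : S al != 0 by rewrite gt_eqF// lt_max se0 orbT.
have epi : e <= pi - e by lra.
have sinS al : e <= al <= pi - e -> sin e <= sin al.
  move=> /andP[h1 h2].
  have -> : al = (al + e) / 2 + (al - e) / 2 by field.
  have {1}-> : e = (al + e) / 2 - (al - e) / 2 by field.
  rewrite sinB sinD -subr_ge0.
  have c0 : 0 <= cos ((al + e) / 2) by apply: cos_ge0_pihalf; lra.
  have s0 : 0 <= sin ((al - e) / 2) by apply: sin_ge0_pi; lra.
  have : 0 <= 2 * (cos ((al + e) / 2) * sin ((al - e) / 2)) by rewrite !mulr_ge0.
  lra.
have SE al : e <= al <= pi - e -> S al = sin al by move=> /sinS h; rewrite /S max_l.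
have cS : continuous S by apply: cnt_max; [exact: continuous_sin|cnt].
have cSi : continuous (fun al => (S al)^-1) by exact: cnt_inv.
pose G al y := y / S al ^+ 2 * F (y * cos al / S al) y.
have cS2i : continuous (fun al => (S al ^+ 2)^-1).
  by apply: cnt_inv => [s|]; [rewrite expf_neq0|cnt].
have cG : continuous (fun p : R * R => G p.1 p.2).
  rewrite /G; apply: cnt_mul.
    apply: cnt_mul; first by cnt.
    by apply: (@cnt_comp _ _ (fun al => (S al ^+ 2)^-1)) => //; cnt.
  apply: (continuous_comp2 cF); last by cnt.
  apply: cnt_mul; first by cnt.
  by apply: (@cnt_comp _ _ (fun al => (S al)^-1)) => //; cnt.
have cP : continuous (fun p : R * R => p.2 * F (p.2 * cos p.1) (p.2 * sin p.1)) by cnt.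
pose I al := sint 0 T (fun u => u * F (u * cos al) (u * sin al)).
have cI' : continuous I.
  exact: (@continuous_sint_param R _ 0 T (fun al u => u * F (u * cos al) (u * sin al))).
have tI := continuous_tame cI'.
have Ib al : `|I al| <= T * M * T.
  rewrite (le_trans (y := T * M * `|T - 0|))//; last first.
    by rewrite subr0 (gtr0_norm T0).
  apply: sint_bound.
    apply: continuous_tame.
    exact: (@continuous_slice _ _ (fun al u => u * F (u * cos al) (u * sin al))).
  move=> u; rewrite min_l ?max_r ?(ltW T0)// => /andP[u0 uT].
  by rewrite normrM ler_pM// ger0_norm.
have IG al : e <= al <= pi - e -> I al = sint 0 T (G al).
  move=> alI; have s0 : 0 < sin al by rewrite (lt_le_trans se0)// sinS.
  have cGa : continuous (G al) by exact: continuous_slice.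
  rewrite -(@sint_chasles _ (sin al * T) 0 T) ?(continuous_tame cGa)//; last exact: continuous_tame.
  rewrite [X in _ + X]sint_eq0 ?addr0; last first.
    move=> y; rewrite min_l ?max_r; last 2 first.
    - by rewrite ger_pMl// sin_le1.
    - by rewrite ger_pMl// sin_le1.
    move=> /andP[yT _]; rewrite /G SE//.
    have -> : F (y * cos al / sin al) y = F ((y / sin al) * cos al) ((y / sin al) * sin al).
      by congr F; [ring|rewrite divfK// gt_eqF].
    by rewrite F0r ?mulr0// ler_pdivlMr// mulrC.
  rewrite -[X in sint X _ _](mulr0 (sin al)) -sint_scale// -sintZ; last first.
    apply: continuous_tame; apply: (cnt_comp cGa); cnt.
  apply: sint_ext => u; rewrite /G SE//.
  have -> : sin al * u * cos al / sin al = u * cos al by field; rewrite gt_eqF.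
  rewrite (mulrC (sin al) u) !mulrA; congr (_ * _); field; by rewrite gt_eqF.
pose mid y := sint e (pi - e) (G^~ y).
have cmid : continuous mid.
  apply: (@continuous_sint_param R _ e (pi - e) (fun y al => G al y)).
  exact: continuous_swap.
have tmid := continuous_tame cmid.
(* Over the angles kept, the cotangent runs from [t^-1] down to [- t^-1], so the row at height [y]
   is cut at [y / t] on both sides. *)
have midE y : mid y = sint (- (y / t)) (y / t) (F^~ y).
  pose g al := y * cos al / sin al.
  have cFy : continuous (F^~ y) by apply: (continuous_comp2 cF); cnt.
  pose H al := - G al y.
  have cH : continuous H.
    by rewrite /H; apply: cnt_opp; apply: (continuous_comp2 cG); cnt.
  have dg x : e <= x <= pi - e -> is_derive x 1 g (- (y / sin x ^+ 2)).
    move=> xI; have s0 : sin x != 0 by rewrite gt_eqF// (lt_le_trans se0)// sinS.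
    have d1 : is_derive x 1 (fun x : R => (sin x)^-1) (- (sin x) ^- 2 *: cos x).
      exact: is_deriveV.
    have d2 : is_derive x 1 (fun x : R => y * cos x) (y * - sin x).
      exact: is_derive_eq.
    have d3 := is_deriveM d2 d1.
    apply: (is_derive_eq d3); rewrite /GRing.scale/=.
    have := cos2Dsin2 x; set u := sin x; set v := cos x => E.
    rewrite (_ : y / u ^+ 2 = y * (v ^+ 2 + u ^+ 2) / u ^+ 2); last by rewrite E mulr1.
    by field.
  have HE x : e <= x <= pi - e -> H x = F (g x) y * (- (y / sin x ^+ 2)).
    by move=> xI; rewrite /H /G SE// /g; ring.
  have := sint_subst epi cFy cH dg HE.
  have -> : g e = y / t by rewrite /g -mulrA cte.
  have -> : g (pi - e) = - (y / t).
    have c1 : cos (pi - e) = - cos e by rewrite cosB cospi sinpi; ring.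
    have s1 : sin (pi - e) = sin e by rewrite sinB cospi sinpi; ring.
    by rewrite /g c1 s1 mulrN mulNr -mulrA cte.
  rewrite sintC /H sintN; first by move=> /oppr_inj.
  by apply: continuous_tame; apply: (continuous_comp2 cG); cnt.
have Fy0 y x : q <= `|y| -> F x y = 0 by move=> h; apply: F0; right.
have mid0 y : q <= y -> mid y = 0.
  move=> qy; rewrite midE sint_eq0// => x _; apply: Fy0.
  by rewrite (le_trans qy)// ler_norm.
have midI : sint e (pi - e) I = sint 0 q mid.
  rewrite (eq_sint epi IG) sint_fubini//.
  have -> : sint 0 T (fun y => sint e (pi - e) (G^~ y)) = sint 0 T mid by [].
  rewrite -(@sint_chasles _ q 0 T mid)// [X in _ + X](@sint_eq0 _ q T mid) ?addr0// => y.
  have qT : q <= T by rewrite /T mulr_natl mulr2n lerDl ltW.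
  by rewrite min_l// => /andP[/mid0].
have A0 : A = sint 0 pi I := erefl _.
clearbody A I; clear cI' IG cG cS cSi cS2i cP.
have [cFy tFy] : (forall y, continuous (F^~ y)) /\ (forall y, tame (F^~ y)).
  have cFy y : continuous (F^~ y) by apply: (continuous_comp2 cF); cnt.
  by split=> // y; exact: continuous_tame.
clearbody mid; clear S S0 SE G sinS.
have AE : A = sint 0 e I + (sint 0 q mid + sint (pi - e) pi I).
  by rewrite -midI (sint_chasles _ _ _ tI) (sint_chasles _ _ _ tI).
have cB : continuous (fun y => sint (- q) q (F^~ y)).
  apply: (@continuous_sint_param R _ (- q) q (fun y x => F x y)).
  exact: continuous_swap.
have tB := continuous_tame cB.
(* At heights [y >= q * t] the cut row contains the whole support; below, both rows have length at
   most [2 * q]. *)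
have BE : `|sint 0 q mid - B| <= 4 * (q * M) * q * t.
  rewrite /B -(sintB _ _ tmid tB).
  have tD := tameB tmid tB.
  rewrite -(sint_chasles (q * t) 0 q tD).
  have qt : q * t <= q by rewrite ger_pMr// ltW.
  have qt0 : 0 <= q * t by rewrite mulr_ge0// ltW.
  rewrite [X in _ + X]sint_eq0 ?addr0; last first.
    move=> y; rewrite min_l// max_r// => /andP[y1 y2].
    have qyt : q <= y / t by rewrite ler_pdivlMr.
    rewrite midE -(sint_chasles (- q) (- (y / t)) _ (tFy y)).
    rewrite -(sint_chasles q (- q) (y / t) (tFy y)).
    rewrite (@sint_eq0 _ (- (y / t)) (- q)); last first.
      move=> x; rewrite min_l ?max_r ?lerN2// => /andP[_ h]; apply: F0; left.
      by rewrite ler_normr; apply/orP; right; rewrite lerNr.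
    rewrite (@sint_eq0 _ q (y / t)); last first.
      move=> x; rewrite min_l ?max_r// => /andP[h _]; apply: F0; left.
      by rewrite ler_normr h.
    by rewrite add0r addr0 subrr.
  have -> : 4 * (q * M) * q * t = 4 * (q * M) * `|q * t - 0|.
    by rewrite subr0 (ger0_norm qt0); ring.
  apply: sint_bound => // y; rewrite min_l// max_r// => /andP[y0 yt].
  have yt' : y / t <= q by rewrite ler_pdivrMr.
  have yt0 : 0 <= y / t by rewrite divr_ge0// ltW.
  rewrite (le_trans (ler_normB _ _))//.
  have -> : 4 * (q * M) = M * (2 * q) + M * (2 * q) by ring.
  apply: lerD.
    rewrite midE (le_trans (y := M * `|y / t - - (y / t)|))//.
      by apply: sint_bound => // x _; exact: FM.
    by rewrite ler_wpM2l// ger0_norm; lra.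
  rewrite (le_trans (y := M * `|q - - q|))//.
    by apply: sint_bound => // x _; exact: FM.
  by rewrite ler_wpM2l// ger0_norm; lra.
have I1 : `|sint 0 e I| <= T * M * T * t.
  rewrite (le_trans (y := T * M * T * `|e - 0|))//.
    by apply: sint_bound => // x _; exact: Ib.
  by rewrite subr0 gtr0_norm// ler_wpM2l// !mulr_ge0// ltW.
have I2 : `|sint (pi - e) pi I| <= T * M * T * t.
  rewrite (le_trans (y := T * M * T * `|pi - (pi - e)|))//.
    by apply: sint_bound => // x _; exact: Ib.
  by rewrite subKr gtr0_norm// ler_wpM2l// !mulr_ge0// ltW.
have -> : A - B = sint 0 e I + (sint 0 q mid - B) + sint (pi - e) pi I by rewrite AE; ring.
rewrite (le_trans (ler_normD _ _))//.
have := ler_normD (sint 0 e I) (sint 0 q mid - B).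
have -> : (2 * (T * M * T) + 4 * (q * M) * q) * t =
  T * M * T * t + 4 * (q * M) * q * t + T * M * T * t by ring.
move=> h; apply: lerD I2; apply: le_trans h _; exact: lerD I1 BE.
Qed.

End Polar.

(** * The attenuation and its conjugate along lines *)

Lemma sint_supp (R : realType) (r A B : R) (F : R -> R) : 0 < r -> A <= - r -> r <= B -> continuous F ->
  (forall u, r <= `|u| -> F u = 0) -> sint A B F = sint (- r) r F.
Proof.
move=> r0 hA hB cF F0; have tF := continuous_tame cF.
have rr : - r <= r by rewrite ge0_cp// ltW.
rewrite -(sint_chasles (- r) A B tF) -(sint_chasles r (- r) B tF).
rewrite [sint A _ _]sint_eq0 ?add0r ?[sint r _ _]sint_eq0 ?addr0// => u.
- by rewrite min_l// => /andP[ru _]; apply: F0; rewrite (le_trans ru)// ler_norm.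
- rewrite max_r// => /andP[_ ru]; apply: F0.
  by rewrite lerNr in ru; rewrite (le_trans ru)// -normrN ler_norm.
Qed.

Section Attenuation.
Context {R : realType}.
Variables (a : R -> R -> R) (L r : R).
Hypotheses (L0 : 0 <= L) (r0 : 0 < r).
Hypothesis aL : forall x y x' y', `|a x y - a x' y'| <= L * (`|x - x'| + `|y - y'|).
Hypothesis a0 : forall x y, r <= `|x| \/ r <= `|y| -> a x y = 0.
(** Seen from one of its points, the box of half-width [r] lies in a box of half-width [2 * r]; the
    other factor 2 is the one in [polar]. *)
Let T := 2 * (2 * r).
Let T0 : 0 < T. Proof. by rewrite !mulr_gt0. Qed.

Lemma continuous_lip : continuous (fun p : R * R => a p.1 p.2).
Proof.
move=> p; apply/cvgrPdist_lt => e e0.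
have d0 : 0 < e / (2 * (L + 1)) by rewrite divr_gt0// mulr_gt0// ltr_wpDl.
have h1 : \forall u \near p, `|p.1 - u.1| < e / (2 * (L + 1)).
  have c1 : continuous (fun u : R * R => u.1) by cnt.
  by have /cvgrPdist_lt/(_ _ d0) := c1 p.
have h2 : \forall u \near p, `|p.2 - u.2| < e / (2 * (L + 1)).
  have c1 : continuous (fun u : R * R => u.2) by cnt.
  by have /cvgrPdist_lt/(_ _ d0) := c1 p.
near=> u.
have u1 : `|p.1 - u.1| < e / (2 * (L + 1)) by near: u.
have u2 : `|p.2 - u.2| < e / (2 * (L + 1)) by near: u.
apply: (le_lt_trans (aL _ _ _ _)).
apply: (@le_lt_trans _ _ (L * (e / (L + 1)))).
  rewrite ler_wpM2l//.
  have -> : e / (L + 1) = e / (2 * (L + 1)) + e / (2 * (L + 1)).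
    by field; rewrite gt_eqF// ltr_wpDl.
  by apply: lerD; exact: ltW.
by rewrite mulrCA gtr_pMr// ltr_pdivrMr ?ltr_wpDl// mul1r ltrDl.
Unshelve. all: by end_near. Qed.

Let ca := continuous_lip.
Let M := 3 * L * r.

(** The 3 comes from comparing with [(2 * r, y)], where [a] is 0, at distance at most [3 * r]. *)
Let aM x y : `|a x y| <= M.
Proof.
have M0 : 0 <= M by rewrite !mulr_ge0// ltW.
have [h|/ltW h] := leP r `|x|; first by rewrite a0 ?normr0//; left.
have h2 : a (2 * r) y = 0.
  by apply: a0; left; rewrite gtr0_norm ?mulr_gt0// mulr_natl mulr2n lerDl ltW.
rewrite -[a x y]subr0 -h2 (le_trans (aL _ _ _ _))// subrr normr0 addr0.
rewrite /M (mulrC 3) -mulrA ler_wpM2l// (le_trans (ler_normB _ _))//.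
by rewrite (gtr0_norm (x := 2 * r)) ?mulr_gt0//; lra.
Qed.

(** The direction [(c, s)] may have any length: [bet_rot] passes through shortened directions, and
    [regularized_line] absorbs the polar radius into it. *)
Definition bet x y t c s := (a (x + t * c) (y + t * s) - a (x - t * c) (y - t * s)) / 2.
Definition bf x y phi := sint 0 T (fun t => bet x y t (cos phi) (sin phi)).

Lemma bet_lip x y t c s c' s' :
  `|bet x y t c s - bet x y t c' s'| <= L * `|t| * (`|c - c'| + `|s - s'|).
Proof.
have E : bet x y t c s - bet x y t c' s' =
  ((a (x + t * c) (y + t * s) - a (x + t * c') (y + t * s'))
  - (a (x - t * c) (y - t * s) - a (x - t * c') (y - t * s'))) / 2.
  by rewrite /bet; field.
rewrite E normrM (ger0_norm (x := 2^-1)) ?invr_ge0// ler_pdivrMr//.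
rewrite (le_trans (ler_normB _ _))//.
rewrite mulr_natr mulr2n; apply: lerD; rewrite (le_trans (aL _ _ _ _))//.
- have -> : x + t * c - (x + t * c') = t * (c - c') by ring.
  have -> : y + t * s - (y + t * s') = t * (s - s') by ring.
  by rewrite !normrM -mulrDr mulrA.
- have -> : x - t * c - (x - t * c') = - (t * (c - c')) by ring.
  have -> : y - t * s - (y - t * s') = - (t * (s - s')) by ring.
  by rewrite !normrN !normrM -mulrDr mulrA.
Qed.

Lemma bet_odd x y t c s : bet x y t (- c) (- s) = - bet x y t c s.
Proof. by rewrite /bet !mulrN !opprK; ring. Qed.

Lemma bet_bound x y t c s : `|bet x y t c s| <= M.
Proof.
rewrite normrM (ger0_norm (x := 2^-1)) ?invr_ge0// ler_pdivrMr//.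
by rewrite (le_trans (ler_normB _ _))// mulr_natr mulr2n lerD.
Qed.

Let K0 := 4 * (L * T) + M.

(** The hypothesis [bK] of the conjugate function, before integration in [t]. The direction [al] is
    [cos z] times the direction [phi] plus an orthogonal part of length |sin z|. Dropping that part
    costs one Lipschitz term; moving the factor [cos z] out of [bet] costs another, of order 1 -
    |cos z|. *)
Lemma bet_rot x y t al phi : 0 <= t <= T ->
  `|bet x y t (cos al) (sin al) - bet x y t (cos phi) (sin phi) * cos (phi - al)|
  <= K0 * `|sin (phi - al)|.
Proof.
move=> /andP[t0 tT].
have LT : 0 <= L * T by rewrite mulr_ge0// ltW.
have Lt : L * `|t| <= L * T by rewrite ler_wpM2l// ger0_norm.
have M0 : 0 <= M by rewrite !mulr_ge0// ltW.
set z := phi - al.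
have Ec : cos al = cos z * cos phi + sin z * sin phi.
  by rewrite {1}(_ : al = phi - z) ?cosB; [ring|rewrite /z subKr].
have Es : sin al = cos z * sin phi - sin z * cos phi.
  by rewrite {1}(_ : al = phi - z) ?sinB; [ring|rewrite /z subKr].
have := cos2Dsin2 z; have sm := @sin_max R z; have cm := @cos_max R z.
set k := cos z in Ec Es cm *; set s := sin z in Ec Es sm * => cs.
have st1 : `|bet x y t (cos al) (sin al) - bet x y t (k * cos phi) (k * sin phi)|
    <= 2 * (L * T) * `|s|.
  rewrite (le_trans (bet_lip _ _ _ _ _ _ _))// Ec Es.
  have -> : k * cos phi + s * sin phi - k * cos phi = s * sin phi by ring.
  have -> : k * sin phi - s * cos phi - k * sin phi = - (s * cos phi) by ring.
  rewrite normrN !normrM -mulrDr.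
  have -> : 2 * (L * T) * `|s| = L * T * (`|s| * (1 + 1)) by ring.
  apply: ler_pM => //; first by rewrite mulr_ge0.
  by rewrite ler_wpM2l// lerD ?sin_max ?cos_max.
have st2 : `|bet x y t (k * cos phi) (k * sin phi) - bet x y t (cos phi) (sin phi) * k|
    <= (2 * (L * T) + M) * `|s|.
  (* [bet] is odd in the direction, so the sign of [k] can be flipped. For [0 <= k <= 1],
     [1 - k <= 1 - k ^+ 2 = s ^+ 2 <= |s|]. *)
  wlog k0 : k {st1 Ec Es} cs cm / 0 <= k => [H|].
    have [/H|/ltW kn] := leP 0 k; first exact.
    have := H (- k); rewrite sqrrN normrN oppr_ge0 => /(_ cs cm kn).
    by rewrite !mulNr mulrN bet_odd -opprD normrN.
  have k1 : k <= 1 by rewrite (le_trans (ler_norm _)).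
  have sk : 1 - k <= `|s|.
    have s2 : s ^+ 2 <= `|s|.
      by rewrite -real_normK ?num_real// expr2 ler_piMl.
    have k2 : k ^+ 2 <= k by rewrite expr2 ler_piMl.
    by move: cs s2 k2; lra.
  have -> : bet x y t (k * cos phi) (k * sin phi) - bet x y t (cos phi) (sin phi) * k =
    (bet x y t (k * cos phi) (k * sin phi) - bet x y t (cos phi) (sin phi)) +
    (1 - k) * bet x y t (cos phi) (sin phi) by ring.
  rewrite (le_trans (ler_normD _ _))// [leRHS]mulrDl; apply: lerD; last first.
    rewrite normrM mulrC ler_pM ?bet_bound// ger0_norm// subr_ge0//.
  rewrite (le_trans (bet_lip _ _ _ _ _ _ _))//.
  have -> : k * cos phi - cos phi = - ((1 - k) * cos phi) by ring.
  have -> : k * sin phi - sin phi = - ((1 - k) * sin phi) by ring.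
  rewrite !normrN !normrM -mulrDr.
  have -> : 2 * (L * T) * `|s| = L * T * (`|s| * (1 + 1)) by ring.
  apply: ler_pM => //; first by rewrite mulr_ge0.
  rewrite ler_pM ?addr_ge0//; first by rewrite ger0_norm// subr_ge0.
  by rewrite lerD ?sin_max ?cos_max.
have -> : K0 * `|s| = 2 * (L * T) * `|s| + (2 * (L * T) + M) * `|s| by rewrite /K0; ring.
rewrite (le_trans _ (lerD st1 st2))//.
by rewrite (le_trans _ (ler_normD _ _))// addrA subrK.
Qed.

Lemma cnt_bet (X : topologicalType) (f1 f2 f3 f4 f5 : X -> R) :
  continuous f1 -> continuous f2 -> continuous f3 -> continuous f4 -> continuous f5 ->
  continuous (fun p => bet (f1 p) (f2 p) (f3 p) (f4 p) (f5 p)).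
Proof. by move=> h1 h2 h3 h4 h5; rewrite /bet; cnt. Qed.

Lemma cnt_bf (X : topologicalType) (f1 f2 f3 : X -> R) :
  continuous f1 -> continuous f2 -> continuous f3 ->
  continuous (fun p => bf (f1 p) (f2 p) (f3 p)).
Proof.
move=> h1 h2 h3; rewrite /bf.
apply: (@continuous_sint_param R X 0 T
  (fun p t => bet (f1 p) (f2 p) t (cos (f3 p)) (sin (f3 p)))).
have cc (f : X -> R) : continuous f -> continuous (fun p : X * R => f p.1).
  move=> cf p; apply: (@continuous_comp _ _ _ fst f); [exact: cvg_fst|exact: cf].
by apply: cnt_bet; cnt; exact: cc.
Qed.

Let tbet x y c s : tame (fun t => bet x y t c s).
Proof. by apply: continuous_tame; apply: cnt_bet; cnt. Qed.

Lemma bf_pi x y phi : bf x y (phi + pi) = - bf x y phi.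
Proof.
rewrite /bf -sintN//; apply: sint_ext => t.
by rewrite cosDpi sinDpi bet_odd.
Qed.

Lemma bf_bound x y phi : `|bf x y phi| <= M * T.
Proof.
rewrite (le_trans (y := M * `|T - 0|))//; last by rewrite subr0 gtr0_norm.
by apply: sint_bound => // t _; exact: bet_bound.
Qed.

Let K := K0 * T.

Let K00 : 0 <= K0. Proof. by rewrite addr_ge0 ?mulr_ge0// ltW. Qed.
Lemma attK_ge0 : 0 <= K. Proof. by rewrite mulr_ge0// ltW. Qed.

Lemma bf_rot x y phi al :
  `|bf x y al - bf x y phi * cos (phi - al)| <= K * `|sin (phi - al)|.
Proof.
rewrite /bf -sintZr// -sintB//; last by apply: tameM => //; exact: tame_cst.
rewrite (le_trans (y := K0 * `|sin (phi - al)| * `|T - 0|))//; last first.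
  by rewrite subr0 (gtr0_norm T0) mulrAC.
apply: sint_bound.
  by apply: tameB => //; apply: tameM => //; exact: tame_cst.
by move=> t; rewrite min_l ?max_r ?(ltW T0)// => tT; exact: bet_rot.
Qed.

Definition Cf x y phi := conjf (bf x y) phi.

Let cbf x y : continuous (bf x y).
Proof. by apply: cnt_bf; cnt. Qed.

(** A uniform limit of continuous functions: [C_ n] has the denominator [h n], and as [cdiff] is
    bounded by [K] at every point, the error is at most [K / pi] times the integral of [g n], in
    which the point does not occur. *)
Lemma Cf_continuous : continuous (fun p : R * R * R => Cf p.1.1 p.1.2 p.2).
Proof.
have p0 := pi_gt0 R.
pose num (p : R * R * R) z := bf p.1.1 p.1.2 (p.2 - z) - bf p.1.1 p.1.2 p.2 * cos z.
have cnum : continuous (fun u : (R * R * R) * R => num u.1 u.2).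
  apply: cnt_add; first by apply: cnt_bf; cnt.
  by apply: cnt_opp; apply: cnt_mul; [apply: cnt_bf; cnt|cnt].
pose h n (z : R) := Num.max (sin z) n.+1%:R^-1.
have h0 n z : h n z != 0 by rewrite gt_eqF// lt_max invr_gt0 ltr0n orbT.
have ch n : continuous (h n) by apply: cnt_max; cnt.
have chi n : continuous (fun z => (h n z)^-1) by apply: cnt_inv.
pose C_ n p := pi^-1 * sint 0 pi (fun z => num p z / h n z).
have cnumh n : continuous (fun u : (R * R * R) * R => num u.1 u.2 / h n u.2).
  apply: cnt_mul => //.
  by apply: (@cnt_comp _ _ (fun z => (h n z)^-1) snd) => //; cnt.
have cC n : continuous (C_ n).
  apply: cnt_mul; first by cnt.
  exact: (@continuous_sint_param R _ 0 pi (fun p z => num p z / h n z)).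
pose g n (z : R) := `|1 - sin z / h n z|.
have cg n : continuous (g n).
  by apply: cnt_norm; apply: cnt_add; [cnt|apply: cnt_opp; apply: cnt_mul => //; cnt].
have g0 : sint 0 pi (g n) @[n --> \oo] --> (0 : R).
  rewrite -[X in _ --> X](_ : sint 0 pi (fun=> 0) = _); last by rewrite sint_cst mul0r.
  apply: (@dct_sint _ _ _ _ _ 1) => //.
  - exact: ltW.
  - by move=> n; exact: continuous_tame.
  - exact: tame_cst.
  - move=> n z /andP[/ltW z0 /ltW zp]; rewrite normr_id ger0_norm.
      by rewrite gerBl divr_ge0// ?sin_ge0_pi ?z0// le_max sin_ge0_pi// z0.
    rewrite subr_ge0 ler_pdivrMr ?mul1r; last by rewrite lt_def h0 le_max sin_ge0_pi// z0.
    by rewrite le_max lexx.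
  - move=> z zI; have s0 : 0 < sin z by exact: sin_gt0_pi.
    apply: (@cvg_trans _ ((fun=> 0 : R) @ \oo)); last exact: cvg_cst.
    apply: near_eq_cvg.
    have := @cvg_harmonic R => /cvgrPdist_lt/(_ _ s0); apply: filterS => n.
    rewrite sub0r normrN /harmonic /= ger0_norm ?invr_ge0// => hn.
    by rewrite /g /h max_l ?(ltW hn)// divff ?gt_eqF// subrr normr0.
have CC n p : `|Cf p.1.1 p.1.2 p.2 - C_ n p| <= pi^-1 * K * sint 0 pi (g n).
  set b := bf p.1.1 p.1.2.
  have bK := bf_rot p.1.1 p.1.2.
  have tD := tame_cdiff attK_ge0 (@cbf p.1.1 p.1.2) bK p.2.
  have tn : tame (fun z => num p z / h n z).
    apply: continuous_tame.
    exact: (@continuous_slice _ _ (fun p z => num p z / h n z)).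
  rewrite /Cf /conjf /C_ -mulrBr -sintB// normrM -mulrA.
  rewrite (ger0_norm (x := pi^-1)) ?invr_ge0 ?(ltW p0)// ler_wpM2l ?invr_ge0 ?(ltW p0)//.
  have tg := continuous_tame (cg n).
  rewrite (le_trans (ler_sint_norm (ltW p0) (tameB tD tn)))// -sintZ//.
  apply: ler_sint => //; first exact: ltW.
  - by apply: tame_norm; exact: tameB.
  - exact: tameZ.
  move=> z zI.
  have -> : cdiff b p.2 z - num p z / h n z = cdiff b p.2 z * (1 - sin z / h n z).
    have := cdiffK bK p.2 z; rewrite -/b /num -/b => ->.
    rewrite [X in X / _](_ : _ = cdiff b p.2 z * sin z); last by ring.
    by rewrite mulrBr mulr1 mulrA.
  by rewrite normrM ler_wpM2r// (cdiff_bound attK_ge0 bK).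
move=> p; apply/cvgrPdist_lt => e e0.
have e3 : 0 < e / 3 by rewrite divr_gt0.
have : pi^-1 * K * sint 0 pi (g n) @[n --> \oo] --> (0 : R).
  by rewrite -[X in _ --> X](mulr0 (pi^-1 * K)); apply: cvgM g0; exact: cvg_cst.
move=> /cvgrPdist_lt/(_ _ e3)[n _ /(_ n (leqnn n))]; rewrite sub0r normrN => gn.
have Cn u : `|Cf u.1.1 u.1.2 u.2 - C_ n u| < e / 3.
  by rewrite (le_lt_trans (CC n u))// (le_lt_trans (ler_norm _)).
have /cvgrPdist_lt/(_ _ e3) := cC n p; apply: filterS => u hu.
move: (Cn u) (Cn p) hu.
move: (Cf u.1.1 u.1.2 u.2) (Cf p.1.1 p.1.2 p.2) (C_ n u) (C_ n p) => u1 u2 u3 u4.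
rewrite !ltr_norml.
by move=> /andP[? ?] /andP[? ?] /andP[? ?]; apply/andP; split; lra.
Qed.

(** * The conjugate of the attenuation as a singular integral over the plane *)

Section Line.
Variables (d : R).
Hypothesis d0 : 0 < d.

(** A continuous odd regularization of [1 / s]. *)
Let kap (s : R) := s / (s ^+ 2 + d).
Let den s : s ^+ 2 + d != 0. Proof. by rewrite gt_eqF// ltr_wpDl// sqr_ge0. Qed.
Let ckap : continuous kap.
Proof. by rewrite /kap; cnt; apply: cnt_inv => //; cnt. Qed.
Let kapN s : kap (- s) = - kap s. Proof. by rewrite /kap sqrrN mulNr. Qed.

Let regC x y phi := sint 0 pi (fun z => sint 0 T (fun t =>
  bet x y t (cos (phi - z)) (sin (phi - z)) * (t * kap (t * sin z)))).

(** Polar coordinates centred at [(x, y)]: the factor [t] is the Jacobian, and [t * sin z] the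
    signed distance from the point reached to the line through [(x, y)] of direction [phi]. On the
    right the centre occurs only through [x * sin phi - y * cos phi], the label of that line. *)
Lemma regularized_line x y phi : `|x| <= r -> `|y| <= r ->
  regC x y phi = 2^-1 * sint (- r) r (fun v => sint (- r) r (fun u =>
    a u v * kap (u * sin phi - v * cos phi - (x * sin phi - y * cos phi)))).
Proof.
move=> xr yr.
pose q := 2 * r.
have q0 : 0 < q by rewrite mulr_gt0.
pose F x' y' := bet x y 1 x' y' * kap (x' * sin phi - y' * cos phi).
have cF : continuous (fun p : R * R => F p.1 p.2).
  by apply: cnt_mul; [apply: cnt_bet; cnt|apply: cnt_comp => //; cnt].
have far (u v : R) : `|u| <= r -> q <= `|v| -> r <= `|u + v| /\ r <= `|u - v|.
  move=> ur qv; have := ler_normB (u + v) u; have := ler_normD (u - v) (- u).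
  rewrite [u + v - u]addrAC subrr add0r.
  rewrite [u - v - u]addrAC subrr add0r !normrN => h1 h2.
  by move: ur qv h1 h2; rewrite /q => *; split; lra.
have F0 x' y' : q <= `|x'| \/ q <= `|y'| -> F x' y' = 0.
  move=> h; rewrite /F /bet !mul1r; case: h => h.
    by have [h1 h2] := far _ _ xr h; rewrite !a0 ?subrr ?mul0r//; left.
  by have [h1 h2] := far _ _ yr h; rewrite !a0 ?subrr ?mul0r//; right.
pose G al := sint 0 (2 * q) (fun t => t * F (t * cos al) (t * sin al)).
have cG : continuous G.
  apply: (@continuous_sint_param R _ 0 (2 * q)
    (fun al t => t * F (t * cos al) (t * sin al))).
  by cnt.
(* [bet] and [kap] are both odd, so [G] is pi-periodic and the reflected angle [phi - z] can be
   replaced by [z]. *)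
have pG al : G (al + pi) = G al.
  apply: sint_ext => t; rewrite cosDpi sinDpi /F.
  rewrite !mulrN bet_odd (_ : - (t * cos al) * sin phi - - (t * sin al) * cos phi =
    - (t * cos al * sin phi - t * sin al * cos phi)); last by ring.
  by rewrite kapN mulrNN.
have -> : regC x y phi = sint 0 pi (fun z => G (phi - z)).
  apply: sint_ext => z; apply: sint_ext => t.
  rewrite /F /bet !mul1r.
  have -> : t * cos (phi - z) * sin phi - t * sin (phi - z) * cos phi = t * sin z.
    have -> : t * sin z = t * sin (phi - (phi - z)) by rewrite subKr.
    by rewrite (sinB phi (phi - z)); ring.
  by rewrite mulrCA.
rewrite (@sint_reflect_periodic R pi G phi)//.
rewrite (polar q0 cF F0).
pose A y' := sint (- q) q (fun x' => a (x + x') (y + y') * kap (x' * sin phi - y' * cos phi)).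
have cA2 y' : continuous (fun x' => a (x + x') (y + y') * kap (x' * sin phi - y' * cos phi)).
  by cnt.
have cA : continuous A.
  apply: (@continuous_sint_param R _ (- q) q
    (fun y' x' => a (x + x') (y + y') * kap (x' * sin phi - y' * cos phi))).
  by cnt.
(* Central symmetry carries the subtracted half of [bet] to the lower half plane; together the
   halves cover the whole plane. *)
have E1 y' : sint (- q) q (F^~ y') = 2^-1 * (A y' + A (- y')).
  rewrite -[X in A y' + X](_ : sint (- q) q (fun x' => a (x - x') (y - y') *
      kap (- x' * sin phi + y' * cos phi)) = _); last first.
    have := sint_opp (- q) q (cA2 (- y')); rewrite opprK => E.
    rewrite /A -[RHS]E.
    by apply: sint_ext => x0; congr (_ * kap _); ring.
  have t1 : tame (fun x' => a (x - x') (y - y') * kap (- x' * sin phi + y' * cos phi)).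
    by apply: continuous_tame; cnt.
  have t2 := continuous_tame (cA2 y').
  rewrite -sintD// -sintZ; last exact: tameD.
  apply: sint_ext => x'; rewrite /F /bet !mul1r.
  rewrite (_ : - x' * sin phi + y' * cos phi = - (x' * sin phi - y' * cos phi)); last by ring.
  by rewrite kapN; ring.
have tA := continuous_tame cA.
have cAN : continuous (fun y' => A (- y')) by cnt.
rewrite (@sint_ext _ _ _ _ _ E1) sintZ; last by apply: tameD => //; exact: continuous_tame.
rewrite sintD//; last exact: continuous_tame.
rewrite (sint_opp 0 q cA) oppr0 addrC (sint_chasles 0 (- q) q tA).
apply: (congr1 (fun u => 2^-1 * u)).
pose H v u := a u v * kap (u * sin phi - v * cos phi - (x * sin phi - y * cos phi)).
have cH : continuous (fun p : R * R => H p.1 p.2) by rewrite /H; cnt.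
have xq := xr; have yq := yr.
rewrite !ler_norml in xq yq; case/andP: xq => x1 x2; case/andP: yq => y1 y2.
have cHv v : continuous (H v) by exact: continuous_slice cH.
have E2 y' : A y' = sint (- r) r (H (y' + y)).
  rewrite -(@sint_supp _ r (- q + x) (q + x))//; last 3 first.
  - by rewrite /q; lra.
  - by rewrite /q; lra.
  - by move=> u ru; rewrite /H a0 ?mul0r//; left.
  rewrite -sint_shift//; apply: sint_ext => x'; rewrite /H.
  by congr (a _ _ * kap _); ring.
rewrite (@sint_ext _ _ _ _ _ E2).
have cS : continuous (fun v => sint (- r) r (H v)) by exact: continuous_sint_param.
rewrite (@sint_shift _ _ _ _ (fun v => sint (- r) r (H v)))//.
apply: sint_supp => //; rewrite /q; try lra.
by move=> v rv; apply: sint_eq0 => u _; rewrite /H a0 ?mul0r//; right.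
Qed.

End Line.

(** The substitution [u = sin z] sends both endpoints to 0. *)
Lemma sint_odd_sin (h : R -> R) : continuous h ->
  sint 0 pi (fun z => cos z * h (sin z)) = 0.
Proof.
move=> ch; have p0 := pi_gt0 R.
pose G z := sint 0 (sin z) h.
have cg : continuous (fun z => cos z * h (sin z)) by cnt.
have D z : 0 <= z <= pi -> is_derive z 1 G (cos z * h (sin z)).
  move=> _; have dh := is_derive_sint 0 (sin z) ch.
  by rewrite mulrC; exact: (@is_derive1_comp R (fun y => sint 0 y h) sin z _ _ dh).
by rewrite (FTC (ltW p0) cg D) /G sinpi sin0 subrr.
Qed.

Let dn (n : nat) : 0 < (n.+1%:R^-1 : R). Proof. by rewrite invr_gt0. Qed.
Let kap (n : nat) (s : R) := s / (s ^+ 2 + n.+1%:R^-1).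
Let den n s : s ^+ 2 + n.+1%:R^-1 != 0 :> R.
Proof. by rewrite gt_eqF// ltr_wpDl// sqr_ge0. Qed.
Let ckap n : continuous (kap n).
Proof. by rewrite /kap; cnt; apply: cnt_inv => //; cnt. Qed.

Let reg x y phi n := sint 0 pi (fun z => sint 0 T (fun t =>
  bet x y t (cos (phi - z)) (sin (phi - z)) * (t * kap n (t * sin z)))).

(** The term [bet * cos z] integrates to 0 against the regularized kernel, so it can be subtracted
    before the limit. What remains is at most [K0 * |sin z|] by [bet_rot], which balances the kernel
    and gives the bound [K0] for dominated convergence. *)
Let reg_cvg x y phi : reg x y phi n @[n --> \oo] --> pi * Cf x y phi.
Proof.
have p0 := pi_gt0 R.
pose D t z := bet x y t (cos (phi - z)) (sin (phi - z)) - bet x y t (cos phi) (sin phi) * cos z.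
have cD : continuous (fun p : R * R => D p.1 p.2).
  by apply: cnt_add; [apply: cnt_bet; cnt|apply: cnt_opp; apply: cnt_mul; [apply: cnt_bet|]; cnt].
pose w n t z := t * kap n (t * sin z).
have cw n : continuous (fun p : R * R => w n p.1 p.2).
  by have c := @ckap n; rewrite /w; cnt.
have cDw n : continuous (fun p : R * R => D p.1 p.2 * w n p.1 p.2).
  by apply: cnt_mul.
have regE n : reg x y phi n = sint 0 pi (fun z => sint 0 T (fun t => D t z * w n t z)).
  pose B t z := bet x y t (cos phi) (sin phi) * (cos z * w n t z).
  have cB : continuous (fun p : R * R => B p.1 p.2).
    by apply: cnt_mul; [apply: cnt_bet; cnt|apply: cnt_mul => //; cnt].
  have B0 : sint 0 pi (fun z => sint 0 T (B^~ z)) = 0.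
    rewrite -(sint_fubini 0 T 0 pi cB); apply: sint_eq0 => t _.
    have cwt : continuous (fun s => t * kap n (t * s)) by have c := @ckap n; cnt.
    have cB' : continuous (fun z => cos z * w n t z).
      by apply: cnt_mul; [cnt|exact: (continuous_slice (cw n))].
    by rewrite (sintZ _ _ _ (continuous_tame cB')) [X in _ * X](sint_odd_sin cwt) mulr0.
  have tB z : tame (B^~ z).
    by apply: continuous_tame; apply: (continuous_slice (F := fun z t => B t z)); exact: continuous_swap.
  have tDw z : tame (fun t => D t z * w n t z).
    apply: continuous_tame; apply: (continuous_slice (F := fun z t => D t z * w n t z)).
    exact: (@continuous_swap _ (fun t z => D t z * w n t z)).
  transitivity (sint 0 pi (fun z => sint 0 T (fun t => D t z * w n t z)) +
      sint 0 pi (fun z => sint 0 T (B^~ z))); last by rewrite B0 addr0.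
  rewrite -sintD; last 2 first.
  - apply: continuous_tame.
    apply: (@continuous_sint_param _ _ 0 T (fun z t => D t z * w n t z)).
    exact: (@continuous_swap _ (fun t z => D t z * w n t z)).
  - apply: continuous_tame.
    by apply: (@continuous_sint_param _ _ 0 T (fun z t => B t z)); exact: continuous_swap.
  apply: sint_ext => z; rewrite -sintD//; apply: sint_ext => t.
  by rewrite /D /B /w; ring.
under eq_fun do rewrite regE.
have -> : pi * Cf x y phi = sint 0 pi (cdiff (bf x y) phi).
  by rewrite /Cf /conjf mulrA divff ?mul1r// gt_eqF.
have cDz z : continuous (D^~ z).
  exact: (continuous_slice (F := fun z t => D t z)) (continuous_swap cD).
have cdz z : sin z != 0 -> sint 0 T (fun t => D t z / sin z) = cdiff (bf x y) phi z.
  move=> s0; rewrite sintZr; last exact: continuous_tame.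
  rewrite /cdiff; congr (_ / _); rewrite /D sintB//; last by apply: tameM => //; exact: tame_cst.
  by rewrite sintZr.
have Dw n t z : 0 <= t <= T -> 0 < sin z -> `|D t z * w n t z| <= K0.
  move=> tT s0.
  have h : `|D t z| <= K0 * `|sin z| by have := bet_rot x y (phi - z) phi tT; rewrite subKr.
  have [t0 _] := andP tT.
  have h2 : `|w n t z| <= (sin z)^-1.
    rewrite /w /kap ger0_norm; last first.
      by rewrite mulr_ge0// divr_ge0 ?mulr_ge0 ?(ltW s0)// addr_ge0 ?sqr_ge0// ltW.
    rewrite -[leRHS]mul1r ler_pdivlMr// mulrA -mulrAC -mulrA mulrA.
    rewrite ler_pdivrMr ?mul1r ?ltr_wpDl ?sqr_ge0//.
    rewrite (_ : t * (t * sin z) * sin z = (t * sin z) ^+ 2); last by ring.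
    by rewrite lerDl ltW.
  rewrite normrM (le_trans (ler_pM _ _ h h2))// (gtr0_norm s0) mulfK// gt_eqF//.
apply: (@dct_sint _ _ _ _ _ (K0 * T)); first exact: ltW.
- move=> n; apply: continuous_tame.
  apply: (@continuous_sint_param _ _ 0 T (fun z t => D t z * w n t z)).
  exact: (@continuous_swap _ (fun t z => D t z * w n t z)).
- exact: (tame_cdiff attK_ge0 (@cbf x y) (bf_rot x y)).
- move=> n z zI; have s0 := sin_gt0_pi zI.
  rewrite -[T in leRHS]subr0 -[T - 0 in leRHS]gtr0_norm ?subr0//.
  rewrite -[T in leRHS]subr0; apply: sint_bound.
    apply: continuous_tame; apply: (continuous_slice (F := fun z t => D t z * w n t z)).
    exact: (@continuous_swap _ (fun t z => D t z * w n t z)).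
  by move=> t; rewrite min_l ?max_r ?(ltW T0)// => tT; exact: Dw.
move=> z zI; have s0 := sin_gt0_pi zI.
rewrite -cdz ?gt_eqF//.
apply: (@dct_sint _ _ _ _ _ K0); first exact: ltW.
- move=> n.
  apply: continuous_tame; apply: (continuous_slice (F := fun z t => D t z * w n t z)).
  exact: (@continuous_swap _ (fun t z => D t z * w n t z)).
- by apply: continuous_tame; cnt; exact: cDz.
- by move=> n t /andP[/ltW t0 /ltW t1]; apply: Dw => //; rewrite t0.
move=> t /andP[t0 _].
apply: cvgM; first exact: cvg_cst.
rewrite -[X in _ --> X](_ : t * (t * sin z / ((t * sin z) ^+ 2 + 0)) = _); last first.
  by rewrite addr0; field; rewrite !gt_eqF.
apply: cvgM; first exact: cvg_cst.
apply: cvgM; first exact: cvg_cst.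
apply: cvgV; first by rewrite addr0 gt_eqF// exprn_gt0// mulr_gt0.
apply: cvgD; first exact: cvg_cst.
exact: cvg_harmonic.
Qed.

Lemma Cf_line x y x1 y1 phi : `|x| <= r -> `|y| <= r -> `|x1| <= r -> `|y1| <= r ->
  x * sin phi - y * cos phi = x1 * sin phi - y1 * cos phi -> Cf x y phi = Cf x1 y1 phi.
Proof.
move=> h1 h2 h3 h4 E; have p0 := pi_gt0 R.
have E1 n : reg x y phi n = reg x1 y1 phi n.
  have := regularized_line (dn n) phi h1 h2; have := regularized_line (dn n) phi h3 h4.
  by rewrite /reg E => -> ->.
apply: (@mulfI _ pi); first by rewrite gt_eqF.
apply: (cvg_unique _ (@reg_cvg x y phi)) => //.
by rewrite /= (funext E1); exact: reg_cvg.
Qed.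

End Attenuation.

(** * Vanishing of the vertical integrals *)

Section Core.
Context {R : realType}.
Local Notation C := R[i].
Local Open Scope complex_scope.

Lemma cint_real a b (w : R -> R) : cint a b (fun s => (w s)%:C) = (sint a b w)%:C.
Proof. by rewrite /cint /= sint_cst mul0r. Qed.

Lemma cint_shift a b c (F : R -> C) : ccont F ->
  cint a b (fun x => F (x + c)) = cint (a + c) (b + c) F.
Proof. by move=> [F1 F2]; rewrite /cint -!(sint_shift _ _ _ F1) -!(sint_shift _ _ _ F2). Qed.

Lemma cint_supp (r A B : R) (F : R -> C) : 0 < r -> A <= - r -> r <= B -> ccont F ->
  (forall u, r <= `|u| -> F u = 0) -> cint A B F = cint (- r) r F.
Proof.
move=> r0 hA hB [F1 F2] F0; rewrite /cint.
rewrite (sint_supp r0 hA hB F1); last by move=> u /F0 ->.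
by rewrite (sint_supp r0 hA hB F2)// => u /F0 ->.
Qed.

(** On the circle, [sin * cis] is [(cis ^+ 2 - 1) / 2i] and [cos * cis] is [(cis ^+ 2 + 1) / 2]: one
    factor [cis] makes the label of a line a polynomial in [cis]. *)
Definition linepoly (x y : R) : {poly C} :=
  (0 -i* (x / 2))%:P * ('X ^+ 2 - 1) - ((y / 2)%:C)%:P * ('X ^+ 2 + 1).

Lemma linepolyE x y phi :
  (linepoly x y).[cis phi] = cis phi * (x * sin phi - y * cos phi)%:C.
Proof.
rewrite /linepoly !hornerE /cis; have := cos2Dsin2 phi.
move: (cos phi) (sin phi) => c s /eqP; rewrite eq_sym -subr_eq => /eqP cs.
have ss : s ^+ 2 = 1 - c ^+ 2 by rewrite -cs; ring.
by apply: complex_ext; rewrite expr2 !ReImE; cbn [complex.Re complex.Im];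
  rewrite -?[Algebra.hasZero.zero _]/(0 : R); field: ss.
Qed.

Lemma linepoly_sin phi : (linepoly 1 0).[cis phi] = cis phi * (sin phi)%:C.
Proof. by rewrite linepolyE mul1r mul0r subr0. Qed.


Variables (a f : R -> R -> R) (L r : R).
Hypotheses (L0 : 0 <= L) (r0 : 0 < r).
Hypothesis aL : forall x y x' y', `|a x y - a x' y'| <= L * (`|x - x'| + `|y - y'|).
Hypothesis a0 : forall x y, r <= `|x| \/ r <= `|y| -> a x y = 0.
Hypothesis cf : continuous (fun p : R * R => f p.1 p.2).
Hypothesis f0 : forall x y, r <= `|x| \/ r <= `|y| -> f x y = 0.
(** Lines that cross the axis outside the box, parametrized by height: the integral over their part
    above the axis vanishes. *)
Hypothesis data : forall x0 phi, r <= `|x0| -> sin phi != 0 ->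
  sint 0 r (fun y => f (x0 + y * (cos phi / sin phi)) y *
                     expR (- bf a r (x0 + y * (cos phi / sin phi)) y phi)) = 0.
Let T := 2 * (2 * r).
Let T0 : 0 < T. Proof. by rewrite !mulr_gt0. Qed.

(** [y = s * ta] turns arclength into height. The two ranges differ only where [G] is 0, since
    beyond arclength [T] or height [r] the box has been left. *)
Lemma ray_scale (G : R -> R -> R) x0 sg ta :
  continuous (fun p : R * R => G p.1 p.2) ->
  (forall x y, r <= `|x| \/ r <= `|y| -> G x y = 0) ->
  `|x0| <= r -> 0 < ta -> sg ^+ 2 + ta ^+ 2 = 1 ->
  ta * sint 0 T (fun s => G (x0 + s * sg) (s * ta)) =
  sint 0 r (fun y => G (x0 + y * (sg / ta)) y).
Proof.
move=> cG G0 x0r ta0 st.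
pose F y := G (x0 + y * (sg / ta)) y.
have cF : continuous F by rewrite /F; cnt.
have -> : sint 0 T (fun s => G (x0 + s * sg) (s * ta)) = sint 0 T (fun s => F (ta * s)).
  apply: sint_ext => s; rewrite /F [s * ta]mulrC.
  by congr (G (_ + _) _); field; rewrite gt_eqF.
rewrite sint_scale// mulr0 -/F -(sint_chasles r 0 (ta * T) (continuous_tame cF)).
rewrite [X in _ + X]sint_eq0 ?addr0// => y.
have [ry|yr] := leP r y => hy.
  by apply: G0; right; rewrite (le_trans ry)// ler_norm.
have [tr|tr] := leP (ta * T) r; last first.
  by move: hy; rewrite min_l ?(ltW tr)// => /andP[/le_lt_trans/(_ yr)]; rewrite ltxx.
move: hy; rewrite min_r// => /andP[ty _].
have y0 : 0 <= y by rewrite (le_trans _ ty)// mulr_ge0// ltW.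
apply: G0; left.
rewrite leNgt; apply/negP => h.
set k := y * (sg / ta) in h.
have kE : k ^+ 2 * ta ^+ 2 = y ^+ 2 * sg ^+ 2.
  by rewrite /k; field; rewrite gt_eqF.
have k2 : `|k| <= 2 * r.
  rewrite -[k](addKr x0) (le_trans (ler_normD _ _))// normrN mulr_natl mulr2n.
  by rewrite lerD// ltW.
have k4 : k ^+ 2 <= (2 * r) ^+ 2.
  by rewrite -real_normK ?num_real//; apply: lerXn2r; rewrite ?nnegrE// mulr_ge0// ltW.
have yy : (ta * T) ^+ 2 <= y ^+ 2.
  by apply: lerXn2r; rewrite ?nnegrE// mulr_ge0// ltW.
have y2 : y ^+ 2 <= r ^+ 2 by apply: lerXn2r; rewrite ?nnegrE// ltW.
have sum : (k ^+ 2 + y ^+ 2) * ta ^+ 2 = y ^+ 2.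
  rewrite mulrDl kE -mulrDr addrC (_ : ta ^+ 2 + sg ^+ 2 = 1) ?mulr1//.
  by rewrite addrC.
have ta2 : 0 < ta ^+ 2 by rewrite exprn_gt0.
have r2 : 0 < r ^+ 2 by rewrite exprn_gt0.
have : T ^+ 2 <= k ^+ 2 + y ^+ 2.
  by rewrite -(ler_pM2r ta2) sum -exprMn mulrC.
by move: k4 y2 r2; rewrite /T; nra.
Qed.

Let bb x y phi := bf a r x y phi.
Let w x y phi := f x y * expR (- bb x y phi).
Let cc x y phi := Cf a r x y phi.
Let cnt_bb (X : topologicalType) (f1 f2 f3 : X -> R) :
  continuous f1 -> continuous f2 -> continuous f3 ->
  continuous (fun p => bb (f1 p) (f2 p) (f3 p)).
Proof. by move=> h1 h2 h3; exact: (@cnt_bf _ a L r L0 aL _ f1 f2 f3 h1 h2 h3). Qed.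
Let cw : continuous (fun p : R * R * R => w p.1.1 p.1.2 p.2).
Proof.
apply: cnt_mul; first by apply: (continuous_comp2 cf); cnt.
by apply: cnt_exp; apply: cnt_opp; apply: cnt_bb; cnt.
Qed.

Let cnt_w (X : topologicalType) (f1 f2 f3 : X -> R) :
  continuous f1 -> continuous f2 -> continuous f3 ->
  continuous (fun p => w (f1 p) (f2 p) (f3 p)).
Proof.
move=> h1 h2 h3.
exact: (continuous_comp2 (h := fun p z => w p.1 p.2 z) cw (continuous_pair h1 h2) h3).
Qed.

Let cnt_cc (X : topologicalType) (f1 f2 f3 : X -> R) :
  continuous f1 -> continuous f2 -> continuous f3 ->
  continuous (fun p => cc (f1 p) (f2 p) (f3 p)).
Proof.
move=> h1 h2 h3.
exact: (continuous_comp2 (h := fun p z => cc p.1 p.2 z) (Cf_continuous L0 r0 aL a0)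
  (continuous_pair h1 h2) h3).
Qed.

Let w0 x y phi : r <= `|x| \/ r <= `|y| -> w x y phi = 0.
Proof. by move=> h; rewrite /w f0// mul0r. Qed.

(** The upper half line through [(x0, 0)] on the line of direction [phi], integrated by height. The
    truncated sines select whichever of the two directions points up, and keep the function
    continuous, with value 0, at horizontal directions. *)
Definition fanray x0 phi :=
  Num.max (sin phi) 0 * sint 0 T (fun s => w (x0 + s * cos phi) (s * sin phi) phi) +
  Num.max (- sin phi) 0 * sint 0 T (fun s => w (x0 + s * - cos phi) (s * - sin phi) phi).

Lemma cnt_fanray (X : topologicalType) (f1 f2 : X -> R) :
  continuous f1 -> continuous f2 -> continuous (fun p => fanray (f1 p) (f2 p)).
Proof.
move=> h1 h2; rewrite /fanray.
have h1' : continuous (fun p : X * R => f1 p.1).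
  by move=> p; apply: (@continuous_comp _ _ _ fst f1); [exact: cvg_fst|exact: h1].
have h2' : continuous (fun p : X * R => f2 p.1).
  by move=> p; apply: (@continuous_comp _ _ _ fst f2); [exact: cvg_fst|exact: h2].
apply: cnt_add; apply: cnt_mul.
- by apply: cnt_max; cnt.
- apply: (@continuous_sint_param R X 0 T (fun p s =>
    w (f1 p + s * cos (f2 p)) (s * sin (f2 p)) (f2 p))).
  by apply: cnt_w; cnt.
- by apply: cnt_max; cnt.
- apply: (@continuous_sint_param R X 0 T (fun p s =>
    w (f1 p + s * - cos (f2 p)) (s * - sin (f2 p)) (f2 p))).
  by apply: cnt_w; cnt.
Qed.

Lemma fanrayE x0 phi : `|x0| <= r -> sin phi != 0 ->
  fanray x0 phi = sint 0 r (fun y => w (x0 + y * (cos phi / sin phi)) y phi).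
Proof.
move=> x0r s0; rewrite /fanray.
have cG : continuous (fun p : R * R => w p.1 p.2 phi) by apply: cnt_w; cnt.
have G0 x y : r <= `|x| \/ r <= `|y| -> w x y phi = 0 by exact: w0.
have [sp|sn] := ltP 0 (sin phi).
  rewrite max_r ?oppr_le0 ?(ltW sp)// mul0r addr0.
  exact: (ray_scale (G := fun x y => w x y phi) cG G0 x0r sp (cos2Dsin2 phi)).
have sn' : 0 < - sin phi by rewrite oppr_gt0 lt_neqAle s0.
rewrite (max_l (ltW sn')) mul0r add0r.
have sq : (- cos phi) ^+ 2 + (- sin phi) ^+ 2 = 1 by rewrite !sqrrN cos2Dsin2.
rewrite (ray_scale (G := fun x y => w x y phi) cG G0 x0r sn' sq).
by apply: sint_ext => y; rewrite invrN mulrNN.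
Qed.

(** What [H] leaves on the line through [(x0, 0)] besides [w] and its phase: the label is
    [x0 * sin phi], which brings [k] sines with [x0 ^+ k], and the last factor of [H] brings one
    more. *)
Let cq m k x0 phi : C := ((sin phi)%:C * cis phi) ^+ k.+1 * cis phi ^+ m * (x0 ^+ k)%:C.

(** Made to be integrated in two ways. At a fixed point, it is in [phi] a function without negative
    orders times [cis ^+ m]. Along a line of direction [phi], within the box, all factors but [w]
    are constant. The factor [cis phi * sin phi] removes the horizontal directions. *)
Let H k m x y phi : C := (w x y phi)%:C * cis (- cc x y phi) *
  (cis phi * (x * sin phi - y * cos phi)%:C) ^+ k * (cis phi * (sin phi)%:C) * cis phi ^+ m.

Let ccont_H (X : topologicalType) (f1 f2 f3 : X -> R) k m :
  continuous f1 -> continuous f2 -> continuous f3 ->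
  ccont (fun p => H k m (f1 p) (f2 p) (f3 p)).
Proof.
move=> h1 h2 h3.
have h4 : ccont (fun p => cis (f3 p)) by exact: ccont_cis.
apply: ccontM; last exact: ccontX.
apply: ccontM; last by apply: ccontM => //; apply: ccont_real; cnt.
apply: ccontM; last by apply: ccontX; apply: ccontM => //; apply: ccont_real; cnt.
apply: ccontM; first by apply: ccont_real; exact: cnt_w.
by apply: ccont_cis; apply: cnt_opp; exact: cnt_cc.
Qed.

Let H_moment k m x y : (0 < m)%N -> cint 0 (2 * pi) (fun phi => H k m x y phi) = 0.
Proof.
move=> m0.
have c1 : continuous (bb x y) by apply: (cnt_bb (f1 := fun=> x) (f2 := fun=> y) (f3 := id)); cnt.
have c2 : continuous (conjf (bb x y)).
  by apply: (cnt_cc (f1 := fun=> x) (f2 := fun=> y) (f3 := id)); cnt.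
have E := hardy_cexp_conj (@attK_ge0 R L r L0 r0) c1 (@bf_pi R a L r L0 aL x y) (@bf_rot R a L r L0 r0 aL a0 x y)
  c2 (@bf_bound R a L r L0 r0 aL a0 x y).
have cE : ccont (fun s => cexp (- bb x y s -i* conjf (bb x y) s)).
  by apply: ccont_cexp; split => /=; cnt.
have := hardy_poly ((linepoly x y) ^+ k * linepoly 1 0) cE E m0.
rewrite -[X in X = _ -> _]mul1r => E1.
transitivity ((f x y)%:C * cint 0 (2 * pi) (fun s => cexp (- bb x y s -i* conjf (bb x y) s) *
   (linepoly x y ^+ k * linepoly 1 0).[cis s] * cis s ^+ m)); last by rewrite -[cint _ _ _]mul1r E1 mulr0.
rewrite -cintZ; last first.
  apply: ccontM; last by apply: ccontX; exact: ccont_cisid.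
  by apply: ccontM => //; apply: ccont_horner; exact: ccont_cisid.
apply: cint_ext => s; rewrite hornerM horner_exp linepoly_sin linepolyE /H /w /cexp rmorphM/=.
by rewrite !mulrA.
Qed.


(** Each row is sheared by [x = x0 + y * cos phi / sin phi], of Jacobian 1, and the integration
    along lines is done first. Lines with [r <= |x0|] contribute 0 by [data]. *)
Let line_H k m phi : sin phi != 0 ->
  cint 0 r (fun y => cint (- r) r (fun x => H k m x y phi)) =
  cint (- r) r (fun x0 => (fanray x0 phi)%:C * cis (- cc x0 0 phi) * cq m k x0 phi).
Proof.
move=> s0.
(* Wide enough for the sheared interval to cover the support in every row [0 <= y <= r]. *)
set ka := cos phi / sin phi; set A := r + r * `|ka|.
have rA : r <= A by rewrite lerDl mulr_ge0// ltW.
have cH : ccont (fun p : R * R => H k m (p.2 + p.1 * ka) p.1 phi) by apply: ccont_H; cnt.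
transitivity (cint 0 r (fun y => cint (- A) A (fun x0 => H k m (x0 + y * ka) y phi))).
  apply: eq_cint; first exact: ltW.
  move=> y /andP[y0 yr].
  have cHy : ccont (fun x => H k m x y phi) by apply: ccont_H; cnt.
  rewrite (cint_shift (- A) A (y * ka) cHy).
  have yk : `|y * ka| <= r * `|ka| by rewrite normrM ger0_norm// ler_wpM2r.
  move: yk; rewrite ler_norml => /andP[yk1 yk2].
  rewrite (cint_supp r0 _ _ cHy)//.
  - by rewrite /A; lra.
  - by rewrite /A; lra.
  - by move=> u ru; rewrite /H w0 ?mul0r//; left.
rewrite (cint_fubini 0 r (- A) A cH).
(* [Cf_line] compares points of the box. If [(x0, 0)] is in it, it is the reference; otherwise any
   point of the line with nonzero [w] is, and 0 stands in when there is none. *)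
have onbox x0 : exists c, (`|x0| <= r -> c = cc x0 0 phi) /\
    forall y, w (x0 + y * ka) y phi != 0 -> cc (x0 + y * ka) y phi = c.
  have eqc x y y' : `|x0 + y * ka| <= r -> `|y| <= r -> `|x0 + y' * ka| <= r -> `|y'| <= r ->
      x = x0 -> cc (x0 + y * ka) y phi = cc (x0 + y' * ka) y' phi.
    move=> h1 h2 h3 h4 _; apply: (@Cf_line R a L r L0 r0 aL a0) => //.
    by rewrite /ka; field.
  have inb y : w (x0 + y * ka) y phi != 0 -> `|x0 + y * ka| <= r /\ `|y| <= r.
    move=> wn; split; rewrite leNgt; apply/negP => /ltW h; move/eqP: wn; apply; apply: w0.
      by left.
    by right.
  have [xr|xr] := leP `|x0| r.
    exists (cc x0 0 phi); split; [by []|move=> y /inb[h1 h2]].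
    have := eqc x0 y 0 h1 h2; rewrite mul0r addr0 normr0 => -> //.
    exact: ltW.
  have [[y1 w1]|no] := pselect (exists y, w (x0 + y * ka) y phi != 0).
    exists (cc (x0 + y1 * ka) y1 phi); split.
      discriminate.
    move=> y /inb[h1 h2]; have [h3 h4] := inb _ w1; exact: (eqc x0).
  exists 0; split; first discriminate.
  by move=> y wy; exfalso; apply: no; exists y.
have inner x0 : exists c, (`|x0| <= r -> c = cc x0 0 phi) /\
    cint 0 r (fun y => H k m (x0 + y * ka) y phi) =
    (sint 0 r (fun y => w (x0 + y * ka) y phi))%:C * cis (- c) * cq m k x0 phi.
  have [c [h1 h2]] := onbox x0; exists c; split; first exact: h1.
  rewrite -[_ * cq _ _ _ _]mulrA [RHS]mulrC -cint_real -cintZ; last first.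
    by apply: ccont_real; apply: cnt_w; cnt.
  apply: cint_ext => y.
  have -> : H k m (x0 + y * ka) y phi = (w (x0 + y * ka) y phi)%:C *
      (cis (- cc (x0 + y * ka) y phi) * cq m k x0 phi).
    rewrite /H (_ : (x0 + y * ka) * sin phi - y * cos phi = x0 * sin phi); last first.
      by rewrite /ka; field.
    have CM : (x0 * sin phi)%:C = x0%:C * (sin phi)%:C by rewrite rmorphM.
    rewrite /cq rmorphXn/= CM; move: (w _ _ _)%:C => wC.
    by rewrite [in RHS]exprS !exprMn; ring.
  have [-> |wn] := eqVneq (w (x0 + y * ka) y phi) 0; first by rewrite mul0r mulr0.
  by rewrite h2// mulrC.
have innerE x0 : `|x0| <= r -> cint 0 r (fun y => H k m (x0 + y * ka) y phi) =
    (fanray x0 phi)%:C * cis (- cc x0 0 phi) * cq m k x0 phi.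
  by move=> xr; have [c [h1 ->]] := inner x0; rewrite h1// fanrayE.
rewrite (cint_supp r0 _ rA); last 3 first.
- by rewrite lerN2.
- apply: (@cint_param R R 0 r (fun x0 y => H k m (x0 + y * ka) y phi)).
  by apply: ccont_H; cnt.
- by move=> x0 xr; have [c [_ ->]] := inner x0; rewrite /w data// !mul0r.
apply: eq_cint => [|x0]; first by rewrite ge0_cp// ltW.
by rewrite -ler_norml => xr; exact: innerE.
Qed.

Let fan_moment k m : (0 < m)%N ->
  cint 0 (2 * pi) (fun phi => cint (- r) r (fun x0 =>
    (fanray x0 phi)%:C * cis (- cc x0 0 phi) * cq m k x0 phi)) = 0.
Proof.
move=> m0; have p0 := pi_gt0 R.
transitivity (cint 0 (2 * pi) (fun phi => cint 0 r (fun y => cint (- r) r (fun x => H k m x y phi)))).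
  (* At horizontal directions both sides are 0, by the factor [sin phi] in [H] and in [cq]. *)
  apply: cint_ext => phi; have [s0|s0] := eqVneq (sin phi) 0; last by rewrite line_H.
  transitivity (0 : C); [|symmetry].
    rewrite -[RHS](cint0 (- r) r); apply: cint_ext => x0.
    by rewrite /cq s0 exprS !mul0r mulr0.
  rewrite -[RHS](cint0 0 r); apply: cint_ext => y.
  rewrite -[RHS](cint0 (- r) r); apply: cint_ext => x.
  by rewrite /H s0 !mulr0 mul0r.
rewrite (@cint_fubini _ 0 (2 * pi) 0 r (fun phi y => cint (- r) r (fun x => H k m x y phi))); last first.
  apply: (@cint_param R _ (- r) r (fun (p : R * R) x => H k m x p.2 p.1)).
  by apply: ccont_H; cnt.
rewrite -[RHS](cint0 0 r); apply: cint_ext => y /=.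
rewrite (@cint_fubini _ 0 (2 * pi) (- r) r (fun phi x => H k m x y phi)); last first.
  by apply: ccont_H; cnt.
by rewrite -[RHS](cint0 (- r) r); apply: cint_ext => x /=; exact: H_moment.
Qed.

Lemma fan_const_integral x0 : `|x0| < r ->
  sint 0 r (fun y => f x0 y * expR (- bf a r x0 y (pi / 2))) = 0.
Proof.
move=> xr; have p0 := pi_gt0 R.
pose V x0 phi : C := (fanray x0 phi)%:C * cis (- cc x0 0 phi).
have cV (X : topologicalType) (f1 f2 : X -> R) : continuous f1 -> continuous f2 ->
    ccont (fun p => V (f1 p) (f2 p)).
  move=> h1 h2; apply: ccontM; first by apply: ccont_real; exact: cnt_fanray.
  by apply: ccont_cis; apply: cnt_opp; apply: cnt_cc => //; cnt.
(* Negative orders vanish first for every moment [g] of [V] in [x], once the powers of the sine are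
   divided out. Hence all moments of the coefficient [N] are 0, and so is [N x0]. *)
have hV m : (0 < m)%N -> cint 0 (2 * pi) (fun phi => V x0 phi * cis phi ^+ m) = 0.
  move=> m0.
  pose N x := cint 0 (2 * pi) (fun phi => V x phi * cis phi ^+ m).
  have cVm : ccont (fun p : R * R => V p.1 p.2 * cis p.2 ^+ m).
    by apply: ccontM; [apply: cV; cnt|apply: ccontX; apply: ccont_cis; cnt].
  have cN : ccont N by exact: (@cint_param R _ 0 (2 * pi) (fun x phi => V x phi * cis phi ^+ m)).
  have mom k : cint (- r) r (fun x => N x * (x ^+ k)%:C) = 0.
    pose g phi := cint (- r) r (fun x => V x phi * (x ^+ k)%:C).
    have cVk : ccont (fun p : R * R => V p.2 p.1 * (p.2 ^+ k)%:C).
      by apply: ccontM; [apply: cV; cnt|apply: ccont_real; cnt].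
    have cg : ccont g by exact: (@cint_param R _ (- r) r (fun phi x => V x phi * (x ^+ k)%:C)).
    have cVk' phi : ccont (fun x => V x phi * (x ^+ k)%:C).
      by apply: ccontM; [apply: cV; cnt|apply: ccont_real; cnt].
    have hg : hardy (2 * pi) g 1.
      apply: (@hardy_div_sin _ _ k.+1) => // j j0.
      rewrite -[RHS](fan_moment k j0); apply: cint_ext => phi.
      rewrite -mulrA mulrC -cintZ//; apply: cint_ext => x.
      by rewrite /cq /V; ring.
    rewrite -[RHS](hg m m0).
    transitivity (cint (- r) r (fun x => cint 0 (2 * pi)
        (fun phi => V x phi * (x ^+ k)%:C * cis phi ^+ m))).
      apply: cint_ext => x; rewrite mulrC -cintZ; last first.
        by apply: ccontM; [apply: cV; cnt|apply: ccontX; exact: ccont_cisid].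
      by apply: cint_ext => phi; ring.
    rewrite (@cint_fubini _ (- r) r 0 (2 * pi) (fun x phi => V x phi * (x ^+ k)%:C * cis phi ^+ m)).
      apply: cint_ext => phi; rewrite [RHS]mulrC -cintZ//.
      by apply: cint_ext => x; rewrite mulrC.
    apply: ccontM; last by apply: ccontX; apply: ccont_cis; cnt.
    by apply: ccontM; [apply: cV; cnt|apply: ccont_real; cnt].
  have [N1 N2] := cN.
  rewrite -/(N x0); apply: complex_ext.
    apply: (@moments_eq0 R r x0 _ N1); first by rewrite -ltr_norml.
    move=> k; have /(congr1 (@complex.Re R)) := mom k.
    rewrite /cint; cbn [complex.Re] => E; rewrite -[RHS]E; apply: sint_ext => x.
    by rewrite !ReImE; cbn [complex.Re complex.Im]; rewrite mulr0 subr0.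
  apply: (@moments_eq0 R r x0 _ N2); first by rewrite -ltr_norml.
  move=> k; have /(congr1 (@complex.Im R)) := mom k.
  rewrite /cint; cbn [complex.Im] => E; rewrite -[RHS]E; apply: sint_ext => x.
  by rewrite !ReImE; cbn [complex.Re complex.Im]; rewrite mulr0 add0r.
have c1 : continuous (bb x0 0).
  by apply: (cnt_bb (f1 := fun=> x0) (f2 := fun=> 0) (f3 := id)); cnt.
have c2 : continuous (conjf (bb x0 0)).
  by apply: (cnt_cc (f1 := fun=> x0) (f2 := fun=> 0) (f3 := id)); cnt.
have cVx : ccont (V x0) by apply: (cV _ (fun=> x0) id); cnt.
have E := hardy_cexp_conjN (@attK_ge0 R L r L0 r0) c1 (@bf_pi R a L r L0 aL x0 0) (@bf_rot R a L r L0 r0 aL a0 x0 0)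
  c2 (@bf_bound R a L r L0 r0 aL a0 x0 0) cVx hV.
pose F phi := fanray x0 phi * expR (bb x0 0 phi).
have cF : continuous F.
  by apply: cnt_mul; [apply: (cnt_fanray (f1 := fun=> x0) (f2 := id)); cnt|cnt].
have hF : hardy (2 * pi) (fun s => (F s)%:C) 1.
  rewrite [X in hardy _ X](_ : _ = fun s => V x0 s * cexp (bb x0 0 s +i* conjf (bb x0 0) s))//.
  apply/funext => s; rewrite /V /cexp; cbn [complex.Re complex.Im].
  rewrite /F rmorphM/= -/(cc x0 0 s) mulrACA -[in RHS](mulrC (cis (cc x0 0 s))) cisK mulr1//.
have [k Fk] := fourier_const cF hF.
have F00 : F 0 = 0.
  have fan (u v : R) : Num.max (sin 0) 0 * u + Num.max (- sin 0) 0 * v = 0.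
    by rewrite sin0 oppr0 maxxx !mul0r addr0.
  by rewrite /F [fanray x0 0]fan mul0r.
(* [fourier_const] gives the constant on the open interval only; continuity at 0, where [fanray]
   vanishes with the sine, identifies it. *)
have k0 : k = 0.
  have c0 : F (pi * n.+1%:R^-1) @[n --> \oo] --> F (pi * 0).
    apply: (@cvg_comp _ _ _ (fun n => pi * n.+1%:R^-1) F); last exact: cF.
    by apply: cvgM; [exact: cvg_cst|exact: cvg_harmonic].
  move: c0; rewrite mulr0 F00 => c0; symmetry; apply: (cvg_unique _ c0) => //.
  rewrite [X in X @ _](_ : _ = fun=> k); first exact: cvg_cst.
  apply/funext => n; apply: Fk; rewrite mulr_gt0 ?invr_gt0//= mulrC ltr_pM2r//.
  by rewrite (@le_lt_trans _ _ 1) ?ltr1n// invf_le1// ler1n.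
have sp : sin (pi / 2) = 1 :> R by rewrite sin_pihalf.
have : F (pi / 2) = 0.
  rewrite -k0; apply: Fk; rewrite divr_gt0//= ltr_pdivrMr//.
  by move: (pi : R) p0 => P p0; lra.
move=> /eqP; rewrite mulf_eq0 (gt_eqF (expR_gt0 _)) orbF fanrayE ?sp ?oner_neq0// ?(ltW xr)//.
move=> /eqP E1; rewrite -[RHS]E1; apply: sint_ext => y.
by rewrite cos_pihalf mul0r mulr0 addr0.
Qed.

End Core.

(** * Strictly convex plane domains *)

Section Geometry.
Context {R : realType}.
Local Notation plane := 'rV[R]_2.
Implicit Types (w v z p q theta : plane) (Omega : set plane).

Lemma cnt_ray w v : continuous (fun u : R => w + u *: v).
Proof. by move=> u; apply: cvgD; [exact: cvg_cst|apply: cvgZr_tmp; exact: cvg_id]. Qed.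

Lemma near_ray (A : set plane) w v : nbhs w A ->
  exists2 d : R, 0 < d & forall u, `|u| < d -> A (w + u *: v).
Proof.
move=> Aw; have := (@cnt_ray w v) 0 A; rewrite scale0r addr0 => /(_ Aw)/nbhs_ballP[d /= d0 H].
by exists d => // u ud; apply: H; rewrite /ball/= sub0r normrN.
Qed.

Lemma dotvE w v : dotv w v = w 0 0 * v 0 0 + w 0 1 * v 0 1.
Proof. rewrite /dotv !big_ord_recl big_ord0 addr0.
by rewrite (_ : lift ord0 ord0 = 1 :> 'I_2)//; exact/val_inj. Qed.

Lemma plane_ext w v : w 0 0 = v 0 0 -> w 0 1 = v 0 1 -> w = v.
Proof.
move=> h0 h1; apply/rowP => i.
by case: i => [[|[|//]] hi]; [rewrite (_ : Ordinal hi = 0)|rewrite (_ : Ordinal hi = 1)];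
  rewrite ?h0 ?h1//; exact/val_inj.
Qed.

Definition lipplane (M : R) (g : plane -> R) (A : set plane) :=
  forall x y, A x -> A y -> `|g x - g y| <= M * (`|x 0 0 - y 0 0| + `|x 0 1 - y 0 1|).

Section Convex.
Variable Omega : set plane.
Hypotheses (oO : open Omega) (bO : bounded_set Omega) (sc : strictly_convex Omega).

Lemma boundary_not_in z : boundary Omega z -> ~ Omega z.
Proof. by move=> [_ nz] Oz; apply: nz; rewrite ((interior_id _).1 oO). Qed.

Lemma closure_not_in_boundary z : closure Omega z -> ~ Omega z -> boundary Omega z.
Proof. by move=> cz nz; split=> //; rewrite ((interior_id _).1 oO). Qed.

Lemma seg_closure w v t : closure Omega w -> closure Omega v -> 0 <= t <= 1 ->
  closure Omega ((1 - t) *: w + t *: v).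
Proof.
move=> cw cv /andP[]; rewrite le_eqVlt => /predU1P[<- _|t0].
  by rewrite subr0 scale1r scale0r addr0.
rewrite le_eqVlt => /predU1P[->|t1]; first by rewrite subrr scale1r scale0r add0r.
have [->|wv] := eqVneq w v; first by rewrite -scalerDl subrK scale1r.
by apply: subset_closure; apply: sc => //; rewrite t0.
Qed.

Lemma seg_open w v t : closure Omega w -> Omega v -> 0 < t <= 1 ->
  Omega ((1 - t) *: w + t *: v).
Proof.
move=> cw Ov /andP[t0]; rewrite le_eqVlt => /predU1P[->|t1].
  by rewrite subrr scale1r scale0r add0r.
have [->|wv] := eqVneq w v; first by rewrite -scalerDl subrK scale1r.
by apply: sc => //; [exact: subset_closure|rewrite t0].
Qed.

Lemma line_comb w v (s u t : R) :
  (1 - t) *: (w + s *: v) + t *: (w + u *: v) = w + ((1 - t) * s + t * u) *: v.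
Proof. by apply: plane_ext; rewrite !mxE; ring. Qed.

Lemma line_convex w v (s u x : R) : closure Omega (w + s *: v) ->
  closure Omega (w + u *: v) -> s <= x <= u -> closure Omega (w + x *: v).
Proof.
move=> cs cu /andP[sx xu].
have [us|su] := leP u s.
  by rewrite (_ : x = s)//; apply/eqP; rewrite eq_le sx (le_trans xu).
have us0 : u - s != 0 by rewrite subr_eq0 gt_eqF.
have := seg_closure cs cu (t := (x - s) / (u - s)).
rewrite line_comb (_ : (1 - (x - s) / (u - s)) * s + (x - s) / (u - s) * u = x); last by field.
by apply; rewrite divr_ge0 ?subr_ge0 ?(ltW su)//= ler_pdivrMr ?subr_gt0// mul1r lerB.
Qed.

Lemma closure_coord : exists2 B : R, 0 < B &
  forall x, closure Omega x -> forall i, `|x 0 i| <= B.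
Proof.
have [M [_ HM]] := bO.
exists (`|M| + 1) => [|x cx i]; first by rewrite ltr_wpDl.
have coordN (y : plane) : `|y 0 i| <= `|y|.
  by change (`|y 0 i| <= mx_norm y); rewrite mx_normrE (le_trans _ (le_bigmax _ _ (0, i))).
have cB : closed [set y : plane | `|y 0 i| <= `|M| + 1].
  apply: (@preimage_closed _ _ (fun y : plane => `|y 0 i|) [set u | u <= `|M| + 1]).
    have cc : continuous (fun y : plane => y 0 i) by exact: coord_continuous.
    by move=> y _; exact: (cvg_norm (cc y)).
  exact: closed_le.
have sub : Omega `<=` [set y : plane | `|y 0 i| <= `|M| + 1].
  move=> y /= Oy.
  by rewrite (le_trans (coordN y))// (HM (`|M| + 1))// ltr_pwDr// ler_norm.
by have := closure_subset sub cx; rewrite -((closure_id _).1 cB).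
Qed.

(** By convexity the parameters of a line in [closure Omega] form a closed bounded interval, and the
    exit is its supremum. The start may lie on the boundary, where the data are given. *)
Lemma line_exit w v s : v != 0 -> closure Omega (w + s *: v) ->
  exists be, [/\ s <= be, closure Omega (w + be *: v) &
    forall u, s <= u -> closure Omega (w + u *: v) <-> u <= be].
Proof.
move=> v0 cs.
pose J := [set u | closure Omega (w + u *: v)].
have cJ : closed J.
  apply: (@preimage_closed _ _ (fun u : R => w + u *: v) (closure Omega)).
    by move=> x _; exact: cnt_ray.
  exact: closed_closure.
have [B B0 HB] := closure_coord.
have [i vi] : exists i, v 0 i != 0.
  apply: contrapT => /forallNP h; move/eqP: v0; apply; apply/rowP => i; rewrite mxE.
  by apply/eqP; apply/negPn/negP; exact: h.
have sJ : has_sup J.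
  split; first by exists s.
  exists ((B + `|w 0 i|) / `|v 0 i|) => u /HB/(_ i) h.
  rewrite (le_trans (ler_norm _))// ler_pdivlMr ?normr_gt0// -normrM.
  rewrite !mxE in h.
  by rewrite -[u * _](addKr (w 0 i)) (le_trans (ler_normD _ _))// normrN addrC lerD2r.
have supJ : J (sup J).
  by case: sJ => s1 s2; have := @closure_sup R J s1 s2; rewrite -((closure_id J).1 cJ).
have ub u : J u -> u <= sup J by exact: sup_upper_bound.
exists (sup J); split; [exact (ub s cs)|exact supJ|move=> u su; split; first exact (ub u)].
by move=> us; apply: (line_convex cs supJ); rewrite su.
Qed.

Lemma exit_boundary w v : Omega w -> v != 0 ->
  exists be, [/\ 0 < be, boundary Omega (w + be *: v) &
    forall u, 0 <= u -> closure Omega (w + u *: v) <-> u <= be].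
Proof.
move=> Ow v0.
have c0 : closure Omega (w + 0 *: v) by rewrite scale0r addr0; exact: subset_closure.
have [be [b0 cb H]] := line_exit v0 c0.
have nb : ~ Omega (w + be *: v).
  move=> Ob; have [d d0 Hd] := near_ray v (open_nbhs_nbhs (conj oO Ob)).
  have : closure Omega (w + (be + d / 2) *: v).
    apply: subset_closure; rewrite scalerDl addrA; apply: Hd.
    by rewrite gtr0_norm ?divr_gt0// ltr_pdivrMr// ltr_pMr// ltr1n.
  by move=> /H; rewrite addr_ge0 ?divr_ge0 ?(ltW d0)// => /(_ isT); rewrite gerDl leNgt divr_gt0.
exists be; split=> //; last exact: closure_not_in_boundary.
rewrite lt_neqAle b0 andbT; apply/eqP => be0; apply: nb.
by rewrite -be0 scale0r addr0.
Qed.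

Lemma enorm1_neq0 v : enorm v = 1 -> v != 0.
Proof.
move=> v1; apply/eqP => v0; move: v1; rewrite /enorm dotvE v0 !mxE !mul0r addr0 sqrtr0.
by move/eqP; rewrite eq_sym oner_eq0.
Qed.

Lemma enorm1_sqr v : enorm v = 1 -> v 0 0 ^+ 2 + v 0 1 ^+ 2 = 1.
Proof.
move=> /(congr1 (fun x => x ^+ 2)); rewrite /enorm sqr_sqrtr ?dotvE ?expr1n; first by rewrite !expr2.
by rewrite addr_ge0// -expr2 sqr_ge0.
Qed.

(** To get a strict sign, the interior end of the segment is pushed by [ep] times the normal [v],
    which openness permits. Along the pushed segment the subgraph inequality, divided by the
    parameter, tends to a weak inequality on [D]; removing the push makes it strict for [theta]. *)
Lemma outer_normal_gt0 zeta theta s : C2_boundary Omega -> boundary Omega zeta ->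
  0 < s -> Omega (zeta - s *: theta) -> 0 < dotv (outer_normal Omega zeta) theta.
Proof.
move=> C2 bz s0 Oz.
have [e1 [n1 [g1 [cg1 lg1]]]] := C2 _ bz.
have : is_outer_normal Omega zeta (outer_normal Omega zeta).
  rewrite /outer_normal; apply: (@xgetPex _ 0 (is_outer_normal Omega zeta)).
  by eexists; exists e1, n1, g1; split; [exact: cg1|exact: lg1|reflexivity].
move: (outer_normal Omega zeta) => N [e [n [g [[dg _ _] [e_1 n_1 en lg] ->]]]].
set g' := g^`()%classic 0.
have D0 : is_derive (0 : R) 1 g g' by rewrite /g' derive1E; exact: derivableP (dg 0).
pose v := n - g' *: e.
have vv : dotv v v = 1 + g' ^+ 2.
  have := enorm1_sqr e_1; have := enorm1_sqr n_1; move: en; rewrite !dotvE /v !mxE => h1 h2 h3.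
  have -> : (n 0 0 - g' * e 0 0) * (n 0 0 - g' * e 0 0) + (n 0 1 - g' * e 0 1) * (n 0 1 - g' * e 0 1)
    = (n 0 0 ^+ 2 + n 0 1 ^+ 2) - 2 * g' * (e 0 0 * n 0 0 + e 0 1 * n 0 1)
      + g' ^+ 2 * (e 0 0 ^+ 2 + e 0 1 ^+ 2) by ring.
  by rewrite h1 h2 h3; ring.
have nz : ~ Omega zeta := boundary_not_in bz.
have cz : closure Omega zeta by case: bz.
have g0 : g 0 <= 0.
  rewrite leNgt; apply/negP => g0; apply: nz.
  have := nbhs_singleton lg; rewrite subrr => ->.
  by rewrite !dotvE !mxE !mul0r !addr0.
have [d d0 Hd] := near_ray v (open_nbhs_nbhs (conj oO Oz)).
pose ep := d / 2.
have ep0 : 0 < ep by rewrite divr_gt0.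
have epd : `|ep| < d by rewrite gtr0_norm// ltr_pdivrMr// ltr_pMr// ltr1n.
pose D := - (s *: theta) + ep *: v.
have OD t : 0 < t <= 1 -> Omega (zeta + t *: D).
  move=> t01; have := seg_open cz (Hd _ epd) t01.
  by congr Omega; rewrite /D; apply: plane_ext; rewrite !mxE; ring.
have [d' d'0 Hd'] := near_ray D lg.
pose Dn := dotv D n; pose De := dotv D e.
have ineq t : 0 < t -> t <= 1 -> t < d' -> t * Dn < g (t * De).
  move=> t0 t1 td; have /Hd' [+ _] : `|t| < d' by rewrite gtr0_norm.
  have -> : dotv (zeta + t *: D - zeta) n = t * Dn by rewrite /Dn !dotvE !mxE; ring.
  have -> : dotv (zeta + t *: D - zeta) e = t * De by rewrite /De !dotvE !mxE; ring.
  by apply; apply: OD; rewrite t0.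
have DnDe : Dn <= g' * De.
  have DG : is_derive (0 : R) 1 (fun t => g (t * De)) (De * g').
    have h : is_derive (0 : R) 1 (fun t : R => t * De) De.
      by apply: is_derive_eq; rewrite scaler0 add0r -[X in X = _]mulr1 mulr1 [_ *: _]mulr1.
    have D0' : is_derive ((fun t : R => t * De) 0) 1 g g' by rewrite mul0r.
    by rewrite mulrC; exact: (@is_derive1_comp _ g (fun t : R => t * De) 0 _ _ D0' h).
  have cv := is_derive_quot_cvg DG.
  rewrite mulrC; apply: (cvgr_to_ge cv).
  have /cvgrPdist_lt/(_ _ d'0) := @cvg_harmonic R; apply: filterS => k.
  rewrite sub0r normrN /harmonic /= gtr0_norm ?invr_gt0// => kd.
  rewrite add0r mul0r.
  have k1 : k.+1%:R^-1 <= 1 :> R by rewrite invf_le1// ler1n.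
  have := ineq k.+1%:R^-1 _ k1 kd; rewrite invr_gt0 ltr0n => /(_ isT) h.
  have -> : Dn = k.+1%:R * (k.+1%:R^-1 * Dn) by rewrite mulrA divff ?mul1r// pnatr_eq0.
  rewrite ler_wpM2l// (le_trans (ltW h))// lerDl oppr_ge0//.
have : 0 < dotv v theta.
  have Dv : dotv D v = Dn - g' * De by rewrite /Dn /De !dotvE /v !mxE; ring.
  have Dv2 : dotv D v = - s * dotv v theta + ep * (1 + g' ^+ 2).
    by rewrite -vv /D !dotvE !mxE; ring.
  have : 0 < ep * (1 + g' ^+ 2) by rewrite mulr_gt0// ltr_pwDl// sqr_ge0.
  by move=> ?; rewrite -(pmulr_rgt0 _ s0); move: DnDe; lra.
rewrite -/v; have -> : dotv ((Num.sqrt (1 + g' ^+ 2))^-1 *: v) theta = (Num.sqrt (1 + g' ^+ 2))^-1 * dotv v theta.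
  by rewrite !dotvE !mxE; ring.
by move=> h; rewrite mulr_gt0// invr_gt0 sqrtr_gt0 ltr_pwDl// sqr_ge0.
Qed.


(** The segment from [zeta] to [z], without [zeta], stays in [Omega] and strictly above the chord,
    hence in the component of [z]. So [zeta] is on the boundary of that component, and too high to
    be on the chord. *)
Lemma cap_boundary Lambda p q z zeta n : cap_domain Omega Lambda p q z ->
  dotv (q - p) n = 0 -> 0 < dotv (z - p) n ->
  boundary Omega zeta -> 0 < dotv (zeta - p) n -> Lambda zeta.
Proof.
move=> [[Oz _] bd] qpn zn bz zetan.
pose K := connected_component (Omega `\` chord p q) z.
have dchord w : chord p q w -> dotv (w - p) n = 0.
  move=> [t _ <-].
  rewrite (_ : _ - p = t *: (q - p)); last by apply: plane_ext; rewrite !mxE; ring.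
  by move: qpn; rewrite !dotvE !mxE => h; rewrite -!mulrA -mulrDr h mulr0.
have cz : closure Omega zeta by case: bz.
have segK (t : R) : 0 < t <= 1 -> K ((1 - t) *: zeta + t *: z).
  move=> /andP[t0 t1].
  pose B := (fun t : R => zeta + t *: (z - zeta)) @` `[t, 1].
  have Bz : B z by exists 1; rewrite /= ?in_itv/= ?t1 ?lexx// scale1r addrCA subrr addr0.
  have Bc : connected B.
    apply: connected_continuous_connected; first exact: segment_connected.
    by apply: continuous_subspaceT; exact: cnt_ray.
  have BO : B `<=` Omega `\` chord p q.
    move=> w [s sI <-]; move: sI; rewrite /= in_itv/= => /andP[ts s1].
    have s0 : 0 < s by exact: lt_le_trans ts.
    rewrite (_ : zeta + s *: (z - zeta) = (1 - s) *: zeta + s *: z); last first.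
      by apply: plane_ext; rewrite !mxE; ring.
    split; first by apply: seg_open => //; rewrite s0.
    move=> /dchord; rewrite (_ : dotv _ n = (1 - s) * dotv (zeta - p) n + s * dotv (z - p) n).
      by move=> /eqP; rewrite gt_eqF// ltr_wpDl ?mulr_ge0 ?subr_ge0 ?(ltW zetan)// mulr_gt0.
    by rewrite !dotvE !mxE; ring.
  apply: (connected_component_max Bz BO Bc).
  exists t; rewrite /= ?in_itv/= ?lexx//.
  by apply: plane_ext; rewrite !mxE; ring.
have : boundary K zeta.
  split.
    move=> U nU; have [d d0 Hd] := near_ray (z - zeta) nU.
    pose t := Num.min (d / 2) 1.
    have t0 : 0 < t by rewrite lt_min ltr01 andbT divr_gt0.
    exists (zeta + t *: (z - zeta)); split.
      rewrite (_ : zeta + _ = (1 - t) *: zeta + t *: z).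
        by apply: segK; rewrite t0/= ge_min lexx orbT.
      by apply: plane_ext; rewrite !mxE; ring.
    apply: Hd; rewrite gtr0_norm// gt_min ltr_pdivrMr// ltr_pMr// ltr1n//.
  move=> /interior_subset/connected_component_sub[Ozeta _].
  exact: (boundary_not_in bz).
rewrite bd => -[//|/dchord h]; by rewrite h ltxx in zetan.
Qed.

(** On the line but off the chord, [z] would leave [p] or [q] strictly between itself and the other
    endpoint, and strict convexity would put a boundary point into [Omega]. *)
Lemma cap_off_line p q z : boundary Omega p -> boundary Omega q -> p != q ->
  (Omega `\` chord p q) z -> forall t, z != p + t *: (q - p).
Proof.
move=> bp bq pq [Oz nz] t; apply/eqP => zE.
have cp : closure Omega p by case: bp.
have cq : closure Omega q by case: bq.
have [t0|t0] := ltP t 0.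
  apply: (boundary_not_in bp).
  have t1 : 1 - t != 0 by rewrite subr_eq0 gt_eqF// (lt_trans t0).
  rewrite (_ : p = (1 - (1 - t)^-1) *: q + (1 - t)^-1 *: z).
    apply: seg_open => //; rewrite invr_gt0 subr_gt0 (lt_trans t0)//=.
    by rewrite invf_le1 ?subr_gt0 ?(lt_trans t0)// lerBrDl gerDr ltW.
  by apply: plane_ext; rewrite zE !mxE; field.
have [t1|t1] := ltP 1 t.
  apply: (boundary_not_in bq).
  have tn0 : t != 0 by rewrite gt_eqF// (lt_trans _ t1).
  rewrite (_ : q = (1 - t^-1) *: p + t^-1 *: z).
    by apply: seg_open => //; rewrite invr_gt0 (lt_trans _ t1)//= invf_le1 ?(ltW t1)// (lt_trans _ t1).
  by apply: plane_ext; rewrite zE !mxE; field.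
apply: nz; exists t; first by rewrite /= in_itv/= t0.
by apply: plane_ext; rewrite zE !mxE; ring.
Qed.

Lemma arc_endpoints_boundary Lambda p q : arc_with_endpoints Omega Lambda p q ->
  boundary Omega p /\ boundary Omega q.
Proof.
move=> [_ [LO _] _ pq].
have cb : closed (boundary Omega).
  rewrite /boundary setDE; apply: closedI; first exact: closed_closure.
  by rewrite closedC; exact: open_interior.
have H w : [set p; q] w -> boundary Omega w.
  by rewrite -pq => -[/(closure_subset LO) + _]; rewrite -((closure_id _).1 cb).
by split; apply: H; [left|right].
Qed.

(** The Holder condition bounds the partial derivatives because [Omega] is bounded; the mean value
    theorem on segments, which stay in [Omega], concludes. *)
Lemma C1holder_lip mu f : 0 <= mu -> C1holder mu Omega f ->
  exists2 M, 0 <= M & lipplane M f Omega.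
Proof.
move=> mu0 [_ df [Cst HC]].
have [[w Ow]|no] := pselect (Omega !=set0); last first.
  by exists 0 => // x y Ox; exfalso; apply: no; exists x.
have [B B0 HB] := closure_coord.
(* Coordinates are at most [B], so two points of [Omega] are within sqrt 8 times [B], less than
   [4 * B]. *)
pose D : R := `|Cst| * (4 * B) `^ mu.
have D0 : 0 <= D by rewrite mulr_ge0// powR_ge0.
have pd (i : 'I_2) x : Omega x -> `|'D_(delta_mx 0 i) f x| <= `|'D_(delta_mx 0 i) f w| + D.
  move=> Ox; have := HC i x w Ox Ow => h.
  rewrite -[X in `|X|](subrK ('D_(delta_mx 0 i) f w)) (le_trans (ler_normD _ _))// addrC lerD2l.
  rewrite (le_trans h)// (le_trans (ler_norm _))// normrM (ger0_norm (powR_ge0 _ _)).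
  rewrite ler_wpM2l// ge0_ler_powR// ?nnegrE ?sqrtr_ge0 ?mulr_ge0 ?(ltW B0)//.
  have b4 : 0 <= 4 * B by rewrite mulr_ge0// ltW.
  rewrite -(ger0_norm b4) -sqrtr_sqr /enorm ler_sqrt ?sqr_ge0//.
  have cx := subset_closure Ox; have cw := subset_closure Ow.
  have k (j : 'I_2) : ((x - w) 0 j) ^+ 2 <= (2 * B) ^+ 2.
    rewrite -real_normK ?num_real//; apply: lerXn2r; rewrite ?nnegrE ?mulr_ge0 ?(ltW B0)//.
    by rewrite !mxE (le_trans (ler_normB _ _))// mulr_natl mulr2n lerD// HB.
  have B2 : 0 < B ^+ 2 by rewrite exprn_gt0.
  by rewrite dotvE -!expr2; have := k 0; have := k 1; move: B2; nra.
pose M := \sum_(i < 2) (`|'D_(delta_mx 0 i) f w| + D).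
have M0 : 0 <= M by rewrite sumr_ge0// => i _; rewrite addr_ge0.
have pdM (i : 'I_2) x : Omega x -> `|'D_(delta_mx 0 i) f x| <= M.
  move=> Ox; rewrite (le_trans (pd i x Ox))// /M (bigD1 i)//= lerDl sumr_ge0// => j _.
  by rewrite addr_ge0.
exists M => // x y Ox Oy.
have [->|xy] := eqVneq x y; first by rewrite !subrr !normr0 addr0 mulr0.
pose h (t : R) := f (y + t *: (x - y)).
have Oh (t : R) : 0 <= t <= 1 -> Omega (y + t *: (x - y)).
  move=> /andP[]; rewrite le_eqVlt => /predU1P[<- _|t0 t1]; first by rewrite scale0r addr0.
  rewrite (_ : y + _ = (1 - t) *: y + t *: x); last by apply: plane_ext; rewrite !mxE; ring.
  by apply: seg_open => //; [exact: subset_closure|rewrite t0].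
have dh (t : R) : 0 <= t <= 1 -> is_derive t 1 h ('D_(x - y) f (y + t *: (x - y))).
  move=> t01; set b := y + t *: (x - y).
  have Dt : differentiable f b := df _ (Oh t t01).
  have E : (fun k : R => k^-1 *: ((h \o shift t) (k *: (1 : R)) - h t)) =
           (fun k : R => k^-1 *: ((f \o shift b) (k *: (x - y)) - f b)).
    apply/funext => k /=; congr (_ *: (_ - _)).
    by rewrite /h; congr f; apply: plane_ext; rewrite /b !mxE [k *: 1]mulr1; ring.
  have dv : derivable f b (x - y) by exact: diff_derivable.
  by split; [rewrite /derivable E|rewrite /derive E].
have [c cI] : exists2 c : R, c \in `]0, 1[ & h 1 - h 0 = 'D_(x - y) f (y + c *: (x - y)) * (1 - 0).
  apply: (@MVT R h (fun c => 'D_(x - y) f (y + c *: (x - y)))) => //.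
    by move=> t; rewrite in_itv/= => /andP[/ltW t0 /ltW t1]; apply: dh; rewrite t0.
  apply: derivable_within_continuous => t; rewrite in_itv/= => t01.
  by case: (dh t t01).
rewrite subr0 mulr1 /h scale1r scale0r addr0 addrCA subrr addr0 => ->.
have Oc : Omega (y + c *: (x - y)).
  by move: cI; rewrite in_itv/= => /andP[/ltW c0 /ltW c1]; apply: Oh; rewrite c0.
have -> : 'D_(x - y) f (y + c *: (x - y)) =
    (x - y) 0 0 * 'D_(delta_mx 0 0) f (y + c *: (x - y)) +
    (x - y) 0 1 * 'D_(delta_mx 0 1) f (y + c *: (x - y)).
  have Dc := df _ Oc; rewrite !deriveE//.
  rewrite [X in 'd _ _ X](_ : x - y = (x - y) 0 0 *: delta_mx 0 0 + (x - y) 0 1 *: delta_mx 0 1).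
    by rewrite linearD !linearZ.
  by apply: plane_ext; rewrite !mxE !eqxx /= ?mulr1 ?mulr0 ?addr0 ?add0r.
rewrite (le_trans (ler_normD _ _))// !normrM mulrDr !mxE.
by rewrite lerD// mulrC ler_wpM2r// pdM.
Qed.

End Convex.
End Geometry.

(** * Lipschitz extension and the transform in a moving frame *)

Section Extension.
Context {R : realType}.
Local Notation plane := 'rV[R]_2.
Implicit Types (w v p e : plane).

Let dist1 w v : R := `|w 0 0 - v 0 0| + `|w 0 1 - v 0 1|.

Let dist1_tri u w v : dist1 w v <= dist1 w u + dist1 u v.
Proof.
rewrite /dist1 addrACA lerD//.
  by rewrite (le_trans _ (ler_normD _ _))// addrA subrK.
by rewrite (le_trans _ (ler_normD _ _))// addrA subrK.
Qed.

Let dist1C w v : dist1 w v = dist1 v w.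
Proof. by rewrite /dist1 distrC [X in _ + X]distrC. Qed.

(** The lower envelope of the cones of slope [M] standing on the graph of [g]. *)
Lemma mcshane (M : R) (g : plane -> R) (S : set plane) : 0 <= M -> S !=set0 ->
  lipplane M g S -> exists2 A, lipplane M A setT & forall u, S u -> A u = g u.
Proof.
move=> M0 [u0 Su0] gS.
pose E w := [set g u + M * dist1 w u | u in S].
have Elb w : has_lbound (E w).
  exists (g u0 - M * dist1 u0 w) => _ [u Su <-].
  have h1 : g u0 - g u <= M * dist1 u0 u by rewrite (le_trans (ler_norm _))//; exact: gS.
  have h2 : M * dist1 u0 u <= M * (dist1 u0 w + dist1 w u) by rewrite ler_wpM2l.
  by move: h1 h2; rewrite mulrDr; lra.
have E0 w : E w !=set0 by exists (g u0 + M * dist1 w u0), u0.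
have half w w' : inf (E w) <= inf (E w') + M * dist1 w w'.
  rewrite -lerBlDr; apply: lb_le_inf => // _ [u Su <-]; rewrite lerBlDr.
  have h1 : inf (E w) <= g u + M * dist1 w u by apply: ge_inf => //; exists u.
  have h2 : M * dist1 w u <= M * (dist1 w w' + dist1 w' u) by rewrite ler_wpM2l.
  by move: h1 h2; rewrite mulrDr; lra.
exists (fun w => inf (E w)).
  move=> w w' _ _; rewrite -/(dist1 w w') ler_norml; apply/andP; split.
    by have := half w' w; rewrite dist1C; lra.
  by have := half w w'; lra.
move=> u Su; apply/eqP; rewrite eq_le; apply/andP; split.
  apply: ge_inf => //; exists u => //.
  by rewrite /dist1 !subrr normr0 addr0 mulr0 addr0.
apply: lb_le_inf => // _ [v Sv <-].
have h1 : g u - g v <= M * dist1 u v by rewrite (le_trans (ler_norm _))//; exact: gS.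
by move: h1; lra.
Qed.

Lemma lipplane_closure (M : R) (g A : plane -> R) (S : set plane) : 0 <= M ->
  lipplane M A setT -> (forall u, S u -> A u = g u) ->
  {within closure S, continuous g} -> forall w, closure S w -> A w = g w.
Proof.
move=> M0 lA Ag cg w cw; apply/eqP; rewrite -subr_eq0 -normr_le0; apply/ler_addgt0Pr => eps eps0.
rewrite add0r.
have e2 : 0 < eps / 2 by rewrite divr_gt0.
have h1 : nbhs w [set u | closure S u -> `|g w - g u| < eps / 2].
  by have /subspace_continuousP/(_ w cw)/cvgrPdist_lt/(_ _ e2) := cg.
have d0 : 0 < eps / 2 / (2 * (M + 1)) by rewrite divr_gt0// mulr_gt0// ltr_wpDl.
have cc (i : 'I_2) : continuous (fun y : plane => y 0 i) by exact: coord_continuous.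
have /cvgrPdist_lt/(_ _ d0) h2 := cc 0 w.
have /cvgrPdist_lt/(_ _ d0) h3 := cc 1 w.
have [u [Su [[H1 H2] H3]]] := cw _ (filterI (filterI h1 h2) h3).
have := H1 (subset_closure Su); rewrite -(Ag u Su) => k1.
have : `|A w - A u| <= eps / 2.
  rewrite (le_trans (lA w u I I))//.
  have h : `|w 0 0 - u 0 0| + `|w 0 1 - u 0 1| <= eps / 2 / (M + 1).
    have -> : eps / 2 / (M + 1) = eps / 2 / (2 * (M + 1)) + eps / 2 / (2 * (M + 1)).
      by field; rewrite gt_eqF// ltr_wpDl.
    by rewrite lerD// ltW.
  rewrite (le_trans (ler_wpM2l M0 h))// mulrCA ger_pMr// ler_pdivrMr ?ltr_wpDl//.
  by rewrite mul1r lerDl.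
have -> : A w - g w = (A w - A u) - (g w - A u) by ring.
move=> k2; rewrite (le_trans (ler_normB _ _))// [leRHS]splitr lerD// ltW//.
Qed.

(** Truncation by a variable bound plays the role of a cutoff factor: it is Lipschitz with constant
    1 in value and bound, and 0 where the bound is 0. *)
Definition clamp (x b : R) := Num.max (Num.min x b) (- b).

Lemma clamp_lip x b x' b' : `|clamp x b - clamp x' b'| <= `|x - x'| + `|b - b'|.
Proof.
have H (y c y' c' : R) : clamp y c <= clamp y' c' + (`|y - y'| + `|c - c'|).
  have h1 := ler_norm (y - y'); have h2 := ler_norm (c - c').
  have h3 := ler_norm (c' - c); rewrite distrC in h3.
  have h4 := normr_ge0 (y - y'); have h5 := normr_ge0 (c - c').
  rewrite /clamp; move: h1 h2 h3 h4 h5.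
  move: (`|y - y'|) (`|c - c'|) => d1 d2 *.
  rewrite ge_max; apply/andP; split.
    rewrite -lerBlDr le_max; apply/orP; left; rewrite lerBlDr.
    have [_|_] := leP y' c'; rewrite ge_min; apply/orP; [left|right]; lra.
  rewrite -lerBlDr le_max; apply/orP; right; lra.
rewrite ler_norml; apply/andP; split.
  by have := H x' b' x b; rewrite (distrC x') (distrC b'); lra.
by have := H x b x' b'; lra.
Qed.

Lemma clamp_id x b : `|x| <= b -> clamp x b = x.
Proof.
by rewrite ler_norml => /andP[h1 h2]; rewrite /clamp (min_l h2) (max_l h1).
Qed.

Lemma clamp0 x : clamp x 0 = 0.
Proof. by rewrite /clamp oppr0; have [h|h] := leP x 0; rewrite ?(max_r h)// maxxx. Qed.

Definition rot90 e : plane := \row_j (if j == 0 then - e 0 1 else e 0 0).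
Definition frame p e x y : plane := p + x *: e + y *: rot90 e.
Definition frameX p e w : R := dotv (w - p) e.
Definition frameY p e w : R := dotv (w - p) (rot90 e).

Section Frame.
Variables (p e : plane).
Hypothesis e1 : e 0 0 ^+ 2 + e 0 1 ^+ 2 = 1.

Lemma frame0 x y : frame p e x y 0 0 = p 0 0 + x * e 0 0 - y * e 0 1.
Proof. by rewrite !mxE/=; ring. Qed.
Lemma frame1 x y : frame p e x y 0 1 = p 0 1 + x * e 0 1 + y * e 0 0.
Proof. by rewrite !mxE/=; ring. Qed.
Lemma frameXE w : frameX p e w = (w 0 0 - p 0 0) * e 0 0 + (w 0 1 - p 0 1) * e 0 1.
Proof. by rewrite /frameX dotvE !mxE. Qed.
Lemma frameYE w : frameY p e w = (w 0 1 - p 0 1) * e 0 0 - (w 0 0 - p 0 0) * e 0 1.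
Proof. by rewrite /frameY dotvE !mxE/=; ring. Qed.

Let e1' : e 0 1 ^+ 2 = 1 - e 0 0 ^+ 2. Proof. by rewrite -e1; ring. Qed.

Lemma frameK w : frame p e (frameX p e w) (frameY p e w) = w.
Proof. by apply: plane_ext; rewrite ?frame0 ?frame1 frameXE frameYE; ring: e1'. Qed.
Lemma frameX_frame x y : frameX p e (frame p e x y) = x.
Proof. by rewrite frameXE frame0 frame1; ring: e1'. Qed.
Lemma frameY_frame x y : frameY p e (frame p e x y) = y.
Proof. by rewrite frameYE frame0 frame1; ring: e1'. Qed.

Definition fdir phi : plane := frame p e (cos phi) (sin phi) - p.

Lemma fdir_unit phi : enorm (fdir phi) = 1.
Proof.
rewrite /enorm dotvE /fdir !mxE/=.
rewrite (_ : _ + _ = (cos phi ^+ 2 + sin phi ^+ 2) * (e 0 0 ^+ 2 + e 0 1 ^+ 2)); last by ring.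
by rewrite e1 cos2Dsin2 mulr1 sqrtr1.
Qed.

Lemma frame_dir x y phi s :
  frame p e x y + s *: fdir phi = frame p e (x + s * cos phi) (y + s * sin phi).
Proof. by apply: plane_ext; rewrite /fdir !mxE/=; ring. Qed.

Lemma cnt_frame (T : topologicalType) (f1 f2 : T -> R) :
  continuous f1 -> continuous f2 -> continuous (fun t => frame p e (f1 t) (f2 t)).
Proof.
move=> h1 h2 t; apply: cvgD; last by apply: cvgZr_tmp; exact: h2.
by apply: cvgD; [exact: cvg_cst|apply: cvgZr_tmp; exact: h1].
Qed.

Let ee : `|e 0 0| <= 1 /\ `|e 0 1| <= 1.
Proof.
have k (x : R) : x ^+ 2 <= 1 -> `|x| <= 1 by rewrite -real_normK ?num_real// expr_le1.
by split; apply: k; rewrite -e1 ?lerDl ?lerDr sqr_ge0.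
Qed.

(** The McShane extension of [a] is truncated by the tent [Bf], which is at least [N >= |a|] on
    [closure Omega] and 0 outside the box. *)
Lemma frame_extension Omega (a : plane -> R) M : bounded_set Omega -> Omega !=set0 ->
  0 <= M -> lipplane M a Omega -> {within closure Omega, continuous a} ->
  exists r L (al : R -> R -> R),
  [/\ 0 < r, 0 <= L,
    forall x y x' y', `|al x y - al x' y'| <= L * (`|x - x'| + `|y - y'|),
    forall x y, r <= `|x| \/ r <= `|y| -> al x y = 0 &
    forall w, closure Omega w ->
      [/\ `|frameX p e w| < r, `|frameY p e w| < r & al (frameX p e w) (frameY p e w) = a w]].
Proof.
move=> bO O0 M0 aM ca; have [E1 E2] := ee.
have [A lA Aa] := mcshane M0 O0 aM.
have Acl := lipplane_closure M0 lA Aa ca.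
have [B B0 HB] := closure_coord bO.
(* The final 1 leaves a margin around [closure Omega] in which the tent comes down to 0. *)
pose r := (B + `|p 0 0|) + (B + `|p 0 1|) + 1.
pose N := `|A 0| + M * (B + B).
have N0 : 0 <= N by rewrite addr_ge0// mulr_ge0// addr_ge0// ltW.
have r0 : 0 < r by rewrite ltr_wpDl// addr_ge0// addr_ge0// ltW.
pose Bf (x y : R) := Num.max 0 (N * (r - Num.max `|x| `|y|)).
pose al (x y : R) := clamp (A (frame p e x y)) (Bf x y).
have Bf1 (x y x' y' : R) : Bf x y <= Bf x' y' + N * (`|x - x'| + `|y - y'|).
  have D0 : 0 <= N * (`|x - x'| + `|y - y'|) by rewrite mulr_ge0// addr_ge0.
  rewrite /Bf ge_max; apply/andP; split.
    by rewrite addr_ge0// le_max lexx.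
  rewrite -lerBlDr le_max; apply/orP; right; rewrite lerBlDr -mulrDr ler_wpM2l//.
  have hx : `|x'| <= `|x| + `|x - x'|.
    by rewrite -[x' in leLHS](subKr x) (le_trans (ler_normB _ _)).
  have hy : `|y'| <= `|y| + `|y - y'|.
    by rewrite -[y' in leLHS](subKr y) (le_trans (ler_normB _ _)).
  have : Num.max `|x'| `|y'| <= Num.max `|x| `|y| + (`|x - x'| + `|y - y'|).
    have h0 := normr_ge0 (x - x'); have h0' := normr_ge0 (y - y').
    rewrite ge_max; apply/andP; split; rewrite -lerBlDr le_max; apply/orP; [left|right];
      by move: hx hy h0 h0'; lra.
  by lra.
exists r, (2 * M + N), al; split=> //.
- by rewrite addr_ge0// mulr_ge0.
- move=> x y x' y'; rewrite /al (le_trans (clamp_lip _ _ _ _))// mulrDl lerD//.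
    rewrite (le_trans (lA _ _ I I))// [2 * M]mulrC -mulrA ler_wpM2l//.
    rewrite !frame0 !frame1.
    have -> : p 0 0 + x * e 0 0 - y * e 0 1 - (p 0 0 + x' * e 0 0 - y' * e 0 1) =
      (x - x') * e 0 0 - (y - y') * e 0 1 by ring.
    have -> : p 0 1 + x * e 0 1 + y * e 0 0 - (p 0 1 + x' * e 0 1 + y' * e 0 0) =
      (x - x') * e 0 1 + (y - y') * e 0 0 by ring.
    have k (u v : R) : `|v| <= 1 -> `|u * v| <= `|u| by move=> v1; rewrite normrM ler_piMr.
    have := ler_normB ((x - x') * e 0 0) ((y - y') * e 0 1).
    have := ler_normD ((x - x') * e 0 1) ((y - y') * e 0 0).
    have := k (x - x') _ E1; have := k (x - x') _ E2.
    have := k (y - y') _ E1; have := k (y - y') _ E2.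
    by lra.
  rewrite ler_norml; apply/andP; split.
    by have := Bf1 x' y' x y; rewrite (distrC x') (distrC y'); lra.
  by have := Bf1 x y x' y'; lra.
- move=> x y h; rewrite /al (_ : Bf x y = 0) ?clamp0//.
  rewrite /Bf max_l// mulr_ge0_le0// subr_le0 le_max.
  by case: h => ->; rewrite ?orbT.
move=> w cw; have w0 := HB w cw 0; have w1 := HB w cw 1.
have nX : `|frameX p e w| <= r - 1.
  rewrite /r addrK frameXE (le_trans (ler_normD _ _))// lerD// normrM.
    by rewrite (le_trans (ler_piMr _ E1))// (le_trans (ler_normB _ _))// lerD2r.
  by rewrite (le_trans (ler_piMr _ E2))// (le_trans (ler_normB _ _))// lerD2r.
have nY : `|frameY p e w| <= r - 1.
  rewrite /r addrK frameYE (le_trans (ler_normB _ _))// addrC lerD// normrM.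
    by rewrite (le_trans (ler_piMr _ E2))// (le_trans (ler_normB _ _))// lerD2r.
  by rewrite (le_trans (ler_piMr _ E1))// (le_trans (ler_normB _ _))// lerD2r.
have r1 : r - 1 < r by rewrite gtrDl oppr_lt0.
split; [exact: le_lt_trans r1|exact: le_lt_trans r1|].
rewrite /al frameK clamp_id ?Acl//.
rewrite -(Acl w cw) (@le_trans _ _ N)//.
  rewrite -[A w](subrK (A 0)) (le_trans (ler_normD _ _))// addrC lerD2l.
  rewrite (le_trans (lA w 0 I I))// ler_wpM2l// !mxE !subr0 lerD//.
rewrite /Bf le_max; apply/orP; right; rewrite -[leLHS]mulr1 ler_wpM2l//.
have : Num.max `|frameX p e w| `|frameY p e w| <= r - 1 by rewrite ge_max nX nY.
by lra.
Qed.


(** * The attenuation along a line, up to a constant *)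

Section Beam.
Variables (Omega : set plane) (a : plane -> R) (r L : R) (al : R -> R -> R).
Hypotheses (oO : open Omega) (bO : bounded_set Omega) (sc : strictly_convex Omega).
Hypotheses (L0 : 0 <= L) (r0 : 0 < r).
Hypothesis alL : forall x y x' y', `|al x y - al x' y'| <= L * (`|x - x'| + `|y - y'|).
Hypothesis al0 : forall x y, r <= `|x| \/ r <= `|y| -> al x y = 0.
Hypothesis alE : forall w, closure Omega w ->
  [/\ `|frameX p e w| < r, `|frameY p e w| < r & al (frameX p e w) (frameY p e w) = a w].
Hypothesis a_zero : forall z, ~ closure Omega z -> a z = 0.
Let T := 2 * (2 * r).
Let T0 : 0 < T. Proof. by rewrite !mulr_gt0. Qed.

Lemma box_exit (x y s phi : R) : `|x| <= r -> `|y| <= r -> T <= `|s| ->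
  r <= `|x + s * cos phi| \/ r <= `|y + s * sin phi|.
Proof.
move=> xr yr sT.
have [h|h] := leP r `|x + s * cos phi|; first by left.
right; rewrite leNgt; apply/negP => h'.
have k (u v : R) : `|u| <= r -> `|u + v| < r -> v ^+ 2 <= (2 * r) ^+ 2.
  move=> ur uv; rewrite -real_normK ?num_real//; apply: lerXn2r.
  - by rewrite nnegrE.
  - by rewrite nnegrE mulr_ge0// ltW.
  rewrite -[v](addKr u) (le_trans (ler_normD _ _))// normrN mulr_natl mulr2n.
  by rewrite lerD// ltW.
have := lerD (k _ _ xr h) (k _ _ yr h').
rewrite !exprMn -mulrDr cos2Dsin2 mulr1.
have : T ^+ 2 <= s ^+ 2.
  by rewrite -(@real_normK _ s) ?num_real//; apply: lerXn2r; rewrite ?nnegrE// ltW.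
have : 0 < r ^+ 2 by rewrite exprn_gt0.
by rewrite /T; lra.
Qed.

Let cal : continuous (fun q : R * R => al q.1 q.2).
Proof. exact: continuous_lip L0 alL. Qed.

(** For a primitive [F] of the extension along the line, the beam is [F be - F s] with [be] the exit
    parameter, and [bf] is the mean of [F (s + T)] and [F (s - T)] minus [F s]. The far values do
    not depend on [s], because the support has been left. *)
Lemma beam_bf w phi s1 s2 : closure Omega (w + s1 *: fdir phi) ->
  closure Omega (w + s2 *: fdir phi) ->
  divergence_beam a (w + s1 *: fdir phi) (fdir phi)
    - bf al r (frameX p e (w + s1 *: fdir phi)) (frameY p e (w + s1 *: fdir phi)) phi =
  divergence_beam a (w + s2 *: fdir phi) (fdir phi)
    - bf al r (frameX p e (w + s2 *: fdir phi)) (frameY p e (w + s2 *: fdir phi)) phi.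
Proof.
wlog s12 : s1 s2 / s1 <= s2 => [H|c1 c2].
  by have [/H|/ltW/H h c1 c2] := leP s1 s2; [exact|rewrite -h].
have [be [b1 cb HJ]] := line_exit bO sc (enorm1_neq0 (fdir_unit phi)) c1.
pose x := frameX p e w; pose y := frameY p e w.
pose h u := al (x + u * cos phi) (y + u * sin phi).
have ch : continuous h by rewrite /h; cnt.
have th := continuous_tame ch.
have wE u : w + u *: fdir phi = frame p e (x + u * cos phi) (y + u * sin phi).
  by rewrite -frame_dir frameK.
have aE u : closure Omega (w + u *: fdir phi) -> a (w + u *: fdir phi) = h u.
  by move=> cu; have [_ _ <-] := alE cu; rewrite wE frameX_frame frameY_frame.
have beam s : s1 <= s -> closure Omega (w + s *: fdir phi) ->
    divergence_beam a (w + s *: fdir phi) (fdir phi) = sint s be h.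
  move=> ss /(HJ s ss) sbe.
  have s0 : 0 <= be - s by rewrite subr_ge0.
  transitivity (\int[@lebesgue_measure R]_(t in `[0, be - s]) h (t + s)).
    rewrite /divergence_beam Rintegral_mkcond [RHS]Rintegral_mkcond; congr Rintegral.
    apply/funext => t; rewrite /= !patchE !mem_setE !in_itv/= andbT.
    have [t0|t0] := leP 0 t => //=.
    have st : s1 <= s + t by rewrite (le_trans ss)// lerDl.
    rewrite -addrA -scalerDl.
    have [tb|tb] := leP t (be - s).
      by rewrite [t + s]addrC; apply: aE; apply/(HJ _ st); rewrite -lerBrDl.
    by apply: a_zero => /(HJ _ st); rewrite -lerBrDl leNgt tb.
  rewrite -sint_le// (sint_shift 0 (be - s) s ch) add0r subrK//.
have bfE s : bf al r (frameX p e (w + s *: fdir phi)) (frameY p e (w + s *: fdir phi)) phi =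
    2^-1 * (sint s (s + T) h - sint (s - T) s h).
  rewrite wE frameX_frame frameY_frame /bf.
  have E1 : sint 0 T (fun t => h (t + s)) = sint s (s + T) h.
    by rewrite (sint_shift 0 T s ch) add0r [T + s]addrC.
  have cr : continuous (fun t => h (s - t)) by cnt.
  have E2 : sint 0 T (fun t => h (s - t)) = sint (s - T) s h.
    have := sint_affine 0 T (-1) s ch.
    rewrite mulr0 add0r !mulN1r sintC [- T + s]addrC => /eqP.
    rewrite eqr_opp => /eqP ->.
    by apply: sint_ext => t; rewrite mulN1r addrC.
  have cs : continuous (fun t => h (t + s)) by cnt.
  rewrite -E1 -E2 -(sintB 0 T (continuous_tame cs) (continuous_tame cr)).
  rewrite -sintZ; last by apply: tameB; exact: continuous_tame.
  apply: sint_ext => t; rewrite /bet /h mulrC.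
  by congr (_ * (al _ _ - al _ _)); ring.
have far s u : closure Omega (w + s *: fdir phi) -> T <= `|u - s| -> h u = 0.
  move=> cs; have [hx hy _] := alE cs; move: hx hy.
  rewrite wE frameX_frame frameY_frame => hx hy uT; apply: al0.
  have := box_exit phi (ltW hx) (ltW hy) uT.
  have -> : x + s * cos phi + (u - s) * cos phi = x + u * cos phi by ring.
  by have -> : y + s * sin phi + (u - s) * sin phi = y + u * sin phi by ring.
rewrite (beam s1 (lexx _) c1) (beam s2 s12 c2) (bfE s1) (bfE s2).
pose F u := sint 0 u h.
have FE (u v : R) : sint u v h = F v - F u.
  by rewrite -(sint_chasles 0 u v th) sintC addrC.
have z1 : F (s1 + T) = F (s2 + T).
  apply/eqP; rewrite eq_sym -subr_eq0 -FE; apply/eqP.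
  apply: sint_eq0 => u; rewrite min_l ?lerD2r// => /andP[hu _].
  by apply: (far s1) => //; rewrite (le_trans _ (ler_norm _))// lerBrDl.
have z2 : F (s1 - T) = F (s2 - T).
  apply/eqP; rewrite eq_sym -subr_eq0 -FE; apply/eqP.
  apply: sint_eq0 => u; rewrite max_r ?lerD2r// => /andP[_ hu].
  apply: (far s2) => //; rewrite -normrN (le_trans _ (ler_norm _))//.
  by rewrite opprB lerBrDl -lerBrDr.
rewrite !FE z1 z2; move: (F _) (F _) (F _) (F _) (F _) => *; lra.
Qed.

(** [k] comes before [f] in the statement: it depends on the line only and cancels between two
    functions with equal data. *)
Lemma xray_sint w phi : closure Omega w ->
  exists2 k : R, 0 < k & forall f : plane -> R, continuous f ->
    (forall z, f z != 0 -> Omega z) ->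
    attenuated_xray a f (w, fdir phi) = k * sint (- T) T (fun s =>
      f (w + s *: fdir phi) *
      expR (- bf al r (frameX p e (w + s *: fdir phi)) (frameY p e (w + s *: fdir phi)) phi)).
Proof.
move=> cw.
pose b s := bf al r (frameX p e (w + s *: fdir phi)) (frameY p e (w + s *: fdir phi)) phi.
pose k := expR (- (divergence_beam a (w + 0 *: fdir phi) (fdir phi) - b 0)).
exists k; first exact: expR_gt0.
move=> f cf fO.
have T2 : - T <= T by rewrite ge0_cp// ltW.
have c0 : closure Omega (w + 0 *: fdir phi) by rewrite scale0r addr0.
have fk s : f (w + s *: fdir phi) * expR (- divergence_beam a (w + s *: fdir phi) (fdir phi)) =
    k * (f (w + s *: fdir phi) * expR (- b s)).
  have [->|fn] := eqVneq (f (w + s *: fdir phi)) 0; first by rewrite !mul0r mulr0.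
  have cs := subset_closure (fO _ fn).
  have E := beam_bf c0 cs; rewrite -!/(b _) in E.
  rewrite mulrCA; congr (_ * _); rewrite /k -expRD; congr expR.
  by rewrite E; ring.
have fz s : T <= `|s| -> f (w + s *: fdir phi) = 0.
  move=> sT; apply/eqP/negP => /negP fn.
  have [h1 h2 _] := alE (subset_closure (fO _ fn)).
  have [g1 g2 _] := alE cw.
  have [] := box_exit phi (ltW g1) (ltW g2) sT; rewrite leNgt.
    by move: h1; rewrite -[w in X in X -> _]frameK frame_dir frameX_frame => ->.
  by move: h2; rewrite -[w in X in X -> _]frameK frame_dir frameY_frame => ->.
rewrite /attenuated_xray /=.
transitivity (\int[@lebesgue_measure R]_(s in `[- T, T]) (k * (f (w + s *: fdir phi) * expR (- b s)))).
  rewrite [RHS]Rintegral_mkcond; congr Rintegral; apply/funext => s.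
  rewrite /= patchE mem_setE in_itv/= -ler_norml fk.
  by have [//|/ltW/fz ->] := leP `|s| T; rewrite mul0r mulr0.
rewrite -sint_le// sintZ//; apply: continuous_tame; apply: cnt_mul.
  by move=> s; apply: (@continuous_comp _ _ _ (fun s : R => w + s *: fdir phi) f);
    [exact: cnt_ray|exact: cf].
apply: cnt_exp; apply: cnt_opp.
rewrite (_ : b = fun s => bf al r (frameX p e w + s * cos phi) (frameY p e w + s * sin phi) phi).
  by apply: (@cnt_bf _ al L r L0 alL); cnt.
by apply/funext => s; rewrite /b -[w in LHS]frameK frame_dir frameX_frame frameY_frame.
Qed.

End Beam.

End Frame.
End Extension.

(** * Reconstruction *)

Section Reconstruction.
Context {R : realType}.
Local Notation plane := 'rV[R]_2.
Implicit Types (w v p q e z : plane).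

Lemma frame_exists p q z : p != q -> (forall t, z != p + t *: (q - p)) ->
  exists e, [/\ e 0 0 ^+ 2 + e 0 1 ^+ 2 = 1, frameY p e q = 0 & 0 < frameY p e z].
Proof.
move=> pq zl.
pose v := q - p.
pose rho2 := v 0 0 ^+ 2 + v 0 1 ^+ 2.
have rho0 : 0 < rho2.
  rewrite lt_def addr_ge0 ?sqr_ge0// andbT paddr_eq0 ?sqr_ge0// !sqrf_eq0.
  apply/negP => /andP[/eqP h0 /eqP h1]; move/eqP: pq; apply; apply/eqP.
  rewrite eq_sym -subr_eq0; apply/eqP.
  by apply: plane_ext; rewrite ?h0 ?h1 !mxE.
pose c := (z 0 1 - p 0 1) * v 0 0 - (z 0 0 - p 0 0) * v 0 1.
have c0 : c != 0.
  apply/eqP => c0.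
  pose t := ((z 0 0 - p 0 0) * v 0 0 + (z 0 1 - p 0 1) * v 0 1) / rho2.
  have t2 : t * rho2 = (z 0 0 - p 0 0) * v 0 0 + (z 0 1 - p 0 1) * v 0 1.
    by rewrite /t divfK// gt_eqF.
  have k0 : (z 0 0 - p 0 0) * rho2 = t * rho2 * v 0 0.
    rewrite t2 /rho2.
    have -> : (z 0 0 - p 0 0) * (v 0 0 ^+ 2 + v 0 1 ^+ 2) =
      ((z 0 0 - p 0 0) * v 0 0 + (z 0 1 - p 0 1) * v 0 1) * v 0 0 - c * v 0 1 by rewrite /c; ring.
    by rewrite c0 mul0r subr0.
  have k1 : (z 0 1 - p 0 1) * rho2 = t * rho2 * v 0 1.
    rewrite t2 /rho2.
    have -> : (z 0 1 - p 0 1) * (v 0 0 ^+ 2 + v 0 1 ^+ 2) =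
      ((z 0 0 - p 0 0) * v 0 0 + (z 0 1 - p 0 1) * v 0 1) * v 0 1 + c * v 0 0 by rewrite /c; ring.
    by rewrite c0 mul0r addr0.
  have rn : rho2 != 0 by rewrite gt_eqF.
  have e0 : z 0 0 - p 0 0 = t * v 0 0 by apply: (mulIf rn); rewrite k0; ring.
  have e1 : z 0 1 - p 0 1 = t * v 0 1 by apply: (mulIf rn); rewrite k1; ring.
  have := zl t; rewrite -/v => /eqP; apply.
  by apply: plane_ext; rewrite [RHS]mxE [X in _ + X]mxE -?e0 -?e1 addrC subrK.
(* The inverse length of [q - p], with the sign that puts [z] above the axis. *)
have [s [s2 sc]] : exists s, s ^+ 2 * rho2 = 1 /\ 0 < s * c.
  have sr : Num.sqrt rho2 ^+ 2 = rho2 by rewrite sqr_sqrtr// ltW.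
  have sp : 0 < Num.sqrt rho2 by rewrite sqrtr_gt0.
  have [cp|cn] := ltP 0 c.
    exists (Num.sqrt rho2)^-1; split; first by rewrite exprVn sr mulVf// gt_eqF.
    by rewrite mulr_gt0// invr_gt0.
  exists (- (Num.sqrt rho2)^-1); split; first by rewrite sqrrN exprVn sr mulVf// gt_eqF.
  by rewrite mulNr -mulrN mulr_gt0 ?invr_gt0// oppr_gt0 lt_neqAle c0.
exists (s *: v); split.
- rewrite [(s *: v) 0 0]mxE [(s *: v) 0 1]mxE -s2 /rho2.
  by ring.
- by rewrite frameYE [(s *: v) 0 0]mxE [(s *: v) 0 1]mxE /v !mxE; ring.
rewrite frameYE [(s *: v) 0 0]mxE [(s *: v) 0 1]mxE.
by move: sc; rewrite /c; congr (_ < _); ring.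
Qed.

Lemma C1holder0_supp mu Omega (f : plane -> R) : C1holder0 mu Omega f ->
  continuous f /\ forall z, f z != 0 -> Omega z.
Proof.
move=> [[_ df _] _ sO]; split; last by move=> z fz; apply: sO; exact: subset_closure.
suff H (x : plane) : f u @[u --> x] --> f x by exact: H.
have [Ox|nOx] := pselect (Omega x).
  exact: differentiable_continuous (df x Ox).
have nx : ~ closure [set x | f x != 0] x by move=> /sO.
have f0 u : ~ closure [set x | f x != 0] u -> f u = 0.
  by move=> h; apply/eqP/negP => /negP fu; apply: h; exact: subset_closure.
apply/(@cvgrPdist_lt _ _ _ (nbhs x) (nbhs_filter x)) => eps eps0.
have : nbhs x (~` closure [set x | f x != 0]).
  by apply: open_nbhs_nbhs; split=> //; rewrite openC; exact: closed_closure.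
by apply: filterS => u /f0 fu; rewrite f0// fu subrr normr0.
Qed.

Section Injectivity.
Variables (Omega Lambda : set plane) (p q z : plane) (mu : R) (a f1 f2 : plane -> R).
Hypotheses (Omega_domain : domain Omega) (bO : bounded_set Omega).
Hypotheses (sc : strictly_convex Omega) (C2 : C2_boundary Omega).
Hypothesis arc : arc_with_endpoints Omega Lambda p q.
Hypothesis mu0 : 0 <= mu.
Hypothesis aC : C1holder mu Omega a.
Hypothesis a_zero : forall z, ~ closure Omega z -> a z = 0.
Hypotheses (hf1 : C1holder0 mu Omega f1) (hf2 : C1holder0 mu Omega f2).
Hypothesis capz : cap_domain Omega Lambda p q z.
Hypothesis data : forall l, Lambda_plus Omega Lambda l ->
  attenuated_xray a f1 l = attenuated_xray a f2 l.

Lemma xray_injective : f1 z = f2 z.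
Proof.
have [oO _ O0] := Omega_domain.
have [bp bq] := arc_endpoints_boundary arc.
have [_ _ pq _] := arc.
have [e [e1 qY zY]] := frame_exists pq (cap_off_line oO sc bp bq pq capz.1).
have [M M0 aM] := C1holder_lip bO sc mu0 aC.
have [ca _ _] := aC.
have [r [L [al [r0 L0 alL al0' alE']]]] := frame_extension p e1 bO O0 M0 aM ca.
have [cf1 O1] := C1holder0_supp hf1; have [cf2 O2] := C1holder0_supp hf2.
(* Doubled, so that [al] and [g] still vanish outside the box after a vertical shift by [c <= r]. *)
pose r' := 2 * r.
have rr' : r <= r' by rewrite /r' mulr_natl mulr2n lerDl ltW.
have r'0 : 0 < r' by rewrite mulr_gt0.
have al0 x y : r' <= `|x| \/ r' <= `|y| -> al x y = 0.
  by move=> h; apply: al0'; case: h => h; [left|right]; exact: le_trans h.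
have alE w : closure Omega w ->
    [/\ `|frameX p e w| < r', `|frameY p e w| < r' & al (frameX p e w) (frameY p e w) = a w].
  by move=> /alE'[h1 h2 h3]; split=> //; [exact: lt_le_trans h1 rr'|exact: lt_le_trans h2 rr'].
pose fd w := f1 w - f2 w.
have cfd : continuous fd.
  by move=> w; exact: (cvgB (cf1 w) (cf2 w)).
have Od w : fd w != 0 -> Omega w.
  have [h1|/O1//] := eqVneq (f1 w) 0; have [h2|/O2//] := eqVneq (f2 w) 0.
  by rewrite /fd h1 h2 subrr eqxx.
pose g x y := fd (frame p e x y).
have cg : continuous (fun u : R * R => g u.1 u.2).
  by move=> u; apply: (@continuous_comp _ _ _ (fun u : R * R => frame p e u.1 u.2) fd);
    [apply: cnt_frame; cnt|exact: cfd].
have gO x y : g x y != 0 -> Omega (frame p e x y) by exact: Od.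
have g_box x y : r <= `|x| \/ r <= `|y| -> g x y = 0.
  move=> h; apply/eqP/negP => /negP /gO/subset_closure/alE'[].
  rewrite frameX_frame// frameY_frame// => h1 h2 _.
  by case: h; rewrite leNgt ?h1 ?h2.
pose T := 2 * (2 * r').
have T0 : 0 < T by rewrite !mulr_gt0.
pose b x y phi := bf al r' x y phi.
(* A line that leaves [Omega] in direction [phi] at a boundary point above the chord belongs to the
   data, whence the vanishing of its full integral, with [b] in place of the beam. *)
have ray0 x y phi : boundary Omega (frame p e x y) -> 0 < y ->
    (exists2 s, 0 < s & Omega (frame p e x y - s *: fdir p e phi)) ->
    sint (- T) T (fun s => g (x + s * cos phi) (y + s * sin phi) *
      expR (- b (x + s * cos phi) (y + s * sin phi) phi)) = 0.
  move=> bz y0 [s s0 Os].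
  have cz : closure Omega (frame p e x y) by case: bz.
  have [k k0 kE] := xray_sint e1 bO sc L0 r'0 alL al0 alE a_zero phi cz.
  have lz : Lambda_plus Omega Lambda (frame p e x y, fdir p e phi).
    split=> /=.
    - apply: (cap_boundary oO sc capz qY zY bz).
      by rewrite -/(frameY p e _) frameY_frame.
    - exact: fdir_unit.
    - exact: (outer_normal_gt0 oO sc C2 bz s0 Os).
  have := data lz; rewrite (kE f1 cf1 O1) (kE f2 cf2 O2) => /(mulfI (lt0r_neq0 k0)) E.
  pose J (f : plane -> R) s := f (frame p e (x + s * cos phi) (y + s * sin phi)) *
    expR (- b (x + s * cos phi) (y + s * sin phi) phi).
  have JE f : sint (- T) T (fun s => f (frame p e x y + s *: fdir p e phi) * expR
      (- bf al r' (frameX p e (frame p e x y + s *: fdir p e phi))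
                  (frameY p e (frame p e x y + s *: fdir p e phi)) phi)) = sint (- T) T (J f).
    by apply: sint_ext => t; rewrite frame_dir (frameX_frame p e1) (frameY_frame p e1).
  have E' := etrans (esym (JE f1)) (etrans E (JE f2)).
  have cJ (f : plane -> R) : continuous f -> continuous (J f).
    move=> cf; apply: cnt_mul.
      by move=> t; apply: (@continuous_comp _ _ _
        (fun s : R => frame p e (x + s * cos phi) (y + s * sin phi)) f);
        [apply: cnt_frame; cnt|exact: cf].
    by apply: cnt_exp; apply: cnt_opp; apply: (@cnt_bf _ al L r' L0 alL); cnt.
  have tJ1 := continuous_tame (cJ f1 cf1); have tJ2 := continuous_tame (cJ f2 cf2).
  have := sintB (- T) T tJ1 tJ2; rewrite E' subrr => E2; rewrite -[RHS]E2.
  by apply: sint_ext => t; rewrite /J /g /fd mulrBl.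
have core c x0 : 0 < c -> c <= r -> `|x0| < r' ->
    sint 0 r' (fun y => g x0 (y + c) * expR (- b x0 (y + c) (pi / 2))) = 0.
  move=> c0 cr x0r.
  pose ac x y := al x (y + c).
  pose fc x y := g x (y + c).
  have bE x y phi : bf ac r' x y phi = b x (y + c) phi.
    by apply: sint_ext => t; rewrite /bet /ac [y + c + _]addrAC [y + c - _]addrAC.
  have big y : r' <= `|y| -> r <= `|y + c|.
    move=> ry; have := ler_normB (y + c) c; rewrite addrK (gtr0_norm c0).
    by move: ry; rewrite /r'; lra.
  have acL x y x' y' : `|ac x y - ac x' y'| <= L * (`|x - x'| + `|y - y'|).
    by rewrite /ac (le_trans (alL _ _ _ _))// (_ : y + c - (y' + c) = y - y')//; ring.
  have ac0 x y : r' <= `|x| \/ r' <= `|y| -> ac x y = 0.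
    by move=> h; apply: al0'; case: h => [/(le_trans rr')|/big]; [left|right].
  have cfc : continuous (fun u : R * R => fc u.1 u.2) by rewrite /fc; cnt.
  have fc0 x y : r' <= `|x| \/ r' <= `|y| -> fc x y = 0.
    by move=> h; apply: g_box; case: h => [/(le_trans rr')|/big]; [left|right].
  have dt x1 phi : r' <= `|x1| -> sin phi != 0 ->
      sint 0 r' (fun y => fc (x1 + y * (cos phi / sin phi)) y *
                     expR (- bf ac r' (x1 + y * (cos phi / sin phi)) y phi)) = 0.
    move=> x1r s0.
    pose k := sin phi; pose ka := cos phi / k.
    pose F y := fc (x1 + y * ka) y * expR (- bf ac r' (x1 + y * ka) y phi).
    change (sint 0 r' F = 0).
    have [[y1 [/andP[y10 y1r] Fy1]]|no] := pselect (exists y1, 0 <= y1 <= r' /\ F y1 != 0);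
        last first.
      apply: sint_eq0 => y; rewrite min_l ?max_r ?(ltW r'0)// => yI.
      by apply/eqP/negP => /negP Fy; apply: no; exists y.
    have cF : continuous F.
      apply: cnt_mul; first by cnt.
      by apply: cnt_exp; apply: cnt_opp; apply: (@cnt_bf _ ac L r' L0 acL); cnt.
    have FO y : F y != 0 -> Omega (frame p e (x1 + y * ka) (y + c)).
      by move=> Fn; apply: gO; apply: contraNN Fn => /eqP h; rewrite /F /fc h mul0r.
    have Ow1 := FO _ Fy1.
    (* The line crosses height [c] outside the box. By convexity its trace in [Omega] lies on one
       side of that crossing, so a nonzero value above height [c] excludes any below. *)
    have nx1 : ~ closure Omega (frame p e x1 c).
      by move=> /alE[]; rewrite frameX_frame// ltNge x1r.
    have lineE y : frame p e (x1 + y * ka) (y + c) =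
        frame p e x1 c + y *: (frame p e ka 1 - p).
      by apply: plane_ext; rewrite !mxE/=; ring.
    have Fneg y : y <= 0 -> F y = 0.
      move=> y0; apply/eqP/negP => /negP/FO/subset_closure; rewrite lineE => cy.
      have := subset_closure Ow1; rewrite lineE => cy1.
      apply: nx1; have := line_convex sc cy cy1 (x := 0).
      by rewrite scale0r addr0; apply; rewrite y0.
    have Fbig y : r' <= y -> F y = 0.
      by move=> ry; rewrite /F fc0 ?mul0r//; right; rewrite (le_trans ry)// ler_norm.
    have [be [be0 bz HJ]] := exit_boundary oO bO sc Ow1 (enorm1_neq0 (fdir_unit p e1 phi)).
    rewrite frame_dir in bz.
    set xz := x1 + y1 * ka + be * cos phi in bz; set yz := y1 + c + be * sin phi in bz.
    (* Puts the exit point on [Lambda]. If [phi] points down, the line would have to reach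
       [(x1, c)], which is outside [closure Omega], before getting down to height [c]. *)
    have yzc : c < yz.
      have [sp|sn] := ltP 0 (sin phi).
        by rewrite /yz addrAC ltrDr ltr_wpDl// mulr_gt0.
      have sn' : 0 < - sin phi by rewrite oppr_gt0 lt_neqAle s0.
      have tb : ~ (y1 / - sin phi <= be).
        move=> /(HJ (y1 / - sin phi) (divr_ge0 y10 (ltW sn'))); rewrite frame_dir.
        rewrite (_ : x1 + y1 * ka + _ = x1); last by rewrite /ka /k; field.
        by rewrite (_ : y1 + c + _ = c)//; field.
      move/negP: tb; rewrite -ltNge ltr_pdivlMr// mulrN => h.
      by move: h; rewrite /yz; lra.
    have z0 : sint (- T) T (fun s => g (xz + s * cos phi) (yz + s * sin phi) *
        expR (- b (xz + s * cos phi) (yz + s * sin phi) phi)) = 0.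
      apply: (ray0 _ _ _ bz (lt_trans c0 yzc)); exists be => //.
      by rewrite /xz /yz -frame_dir addrK.
    pose c2 := yz - c.
    have argX s : x1 + (k * s + c2) * ka = xz + s * cos phi.
      by rewrite /c2 /xz /yz /ka /k; field.
    have argY s : k * s + c2 + c = yz + s * sin phi by rewrite /c2 /k; ring.
    have Fs s : F (k * s + c2) = g (xz + s * cos phi) (yz + s * sin phi) *
        expR (- b (xz + s * cos phi) (yz + s * sin phi) phi).
      by rewrite /F bE /fc argX argY.
    have E : sint (k * (- T) + c2) (k * T + c2) F = 0.
      by rewrite (sint_affine (- T) T k c2 cF) (sint_ext _ _ Fs) z0 mulr0.
    have k0 : k != 0 by exact: s0.
    have [zx zy _] := alE _ bz.1; rewrite (frameX_frame p e1) in zx; rewrite (frameY_frame p e1) in zy.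
    clearbody F xz yz c2 k ka.
    have Fout y : `|k| * T <= `|y - c2| -> F y = 0.
      pose s := (y - c2) / k => h.
      have -> : y = k * s + c2 by rewrite /s mulrC divfK// subrK.
      have sT : T <= `|s| by rewrite /s normrM normfV ler_pdivlMr ?normr_gt0// mulrC.
      rewrite Fs g_box ?mul0r//.
      by have := box_exit r'0 phi (ltW zx) (ltW zy) sT => -[/(le_trans rr')|/(le_trans rr')]; [left|right].
    pose A := c2 - `|k| * T; pose B := c2 + `|k| * T.
    (* [F] is 0 outside [[A, B]] by [Fout], and outside [[0, r']] by [Fneg] and [Fbig], so both
       ranges give the same integral. *)
    have EAB : sint A B F = 0.
      rewrite /A /B; have [kp|kn] := ltP 0 k.
        by rewrite gtr0_norm// -[RHS]E; congr sint; ring.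
      by rewrite ler0_norm// sintC -[RHS]oppr0; congr (- _); rewrite -[RHS]E; congr sint; ring.
    have tF := continuous_tame cF.
    move: EAB; rewrite -(sint_chasles 0 A B tF) -(sint_chasles r' 0 B tF).
    rewrite [sint A 0 F]sint_eq0; last first.
      move=> y /andP[_]; rewrite le_max => /orP[yA|/Fneg//].
      apply: Fout; rewrite [leRHS]distrC (le_trans _ (ler_norm _))//.
      by move: yA; rewrite /A; lra.
    rewrite [sint r' B F]sint_eq0; first by rewrite add0r addr0.
    move=> y /andP[+ _]; rewrite ge_min => /orP[/Fbig//|yB].
    apply: Fout; rewrite (le_trans _ (ler_norm _))//.
    by move: yB; rewrite /B; lra.
  have := fan_const_integral L0 r'0 acL ac0 cfc fc0 dt x0r.
  by move=> E; rewrite -[RHS]E; apply: sint_ext => y; rewrite bE.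
pose x0 := frameX p e z.
have [zx zy _] := alE' _ (subset_closure capz.1.1).
pose c := frameY p e z.
have c0 : 0 < c by exact: zY.
have cr : c < r by rewrite (le_lt_trans (ler_norm _)).
pose G y := g x0 y * expR (- b x0 y (pi / 2)).
have cG : continuous G.
  apply: cnt_mul; first exact: (continuous_slice cg).
  by apply: cnt_exp; apply: cnt_opp; apply: (@cnt_bf _ al L r' L0 alL); cnt.
have G0 c1 : 0 < c1 -> c1 <= r -> sint r' c1 G = 0.
  move=> c10 c1r; have tG := continuous_tame cG.
  have := core c1 x0 c10 c1r (lt_le_trans zx rr').
  rewrite -/(fun y => G (y + c1)) (sint_shift 0 r' c1 cG) add0r.
  rewrite -(sint_chasles r' c1 (r' + c1) tG) [X in _ + X]sint_eq0 ?addr0.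
    by rewrite sintC => /eqP; rewrite oppr_eq0 => /eqP.
  move=> y; rewrite min_l ?lerDl ?(ltW c10)// => /andP[ry _].
  by rewrite /G g_box ?mul0r//; right; rewrite (le_trans rr')// (le_trans ry)// ler_norm.
have Gc : G c = 0.
  have D := is_derive_sint r' c cG.
  have := is_derive_quot_cvg D => cv.
  apply: (cvg_unique _ cv) => //.
  apply: (@cvg_trans _ ((fun=> 0 : R) @ \oo)); last exact: cvg_cst.
  apply: near_eq_cvg.
  have rc : 0 < r - c by rewrite subr_gt0.
  have /cvgrPdist_lt/(_ _ rc) := @cvg_harmonic R; apply: filterS => n.
  rewrite sub0r normrN /harmonic /= gtr0_norm ?invr_gt0// => h.
  rewrite (G0 c c0 (ltW cr)) G0 ?subrr ?mulr0//.
    by rewrite addr_gt0// invr_gt0.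
  by rewrite -lerBrDl ltW.
move/eqP: Gc; rewrite /G mulf_eq0 (gt_eqF (expR_gt0 _)) orbF /g frameK// /fd subr_eq0.
by move/eqP.
Qed.

End Injectivity.

Lemma reconstruction Omega Lambda p q (mu : R) (a : plane -> R) : domain Omega ->
  bounded_set Omega -> strictly_convex Omega -> C2_boundary Omega ->
  arc_with_endpoints Omega Lambda p q -> 0 <= mu -> C1holder mu Omega a ->
  (forall z, ~ closure Omega z -> a z = 0) ->
  exists Rec : (Lambda_plus Omega Lambda -> R) -> (cap_domain Omega Lambda p q -> R),
    forall f : plane -> R, C1holder0 mu Omega f ->
      Rec (sigL (Lambda_plus Omega Lambda) (attenuated_xray a f))
      = sigL (cap_domain Omega Lambda p q) f.
Proof.
move=> dO bO sc C2 arc mu0 aC a0.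
pose good d f := C1holder0 mu Omega f /\
  sigL (Lambda_plus Omega Lambda) (attenuated_xray a f) = d.
(* Any admissible preimage of [d] will do, by [xray_injective]; the default 0 is returned only when
   [d] has none. *)
exists (fun d => sigL (cap_domain Omega Lambda p q) (xget (fun=> 0) (good d))).
move=> f hf; set d := sigL (Lambda_plus _ _) _.
have [h1 h2] : good d (xget (fun=> 0) (good d)) by apply: (@xgetPex _ _ (good d)); exists f.
apply/funext => -[z zc]; have cz := set_mem zc.
apply: (xray_injective dO bO sc C2 arc mu0 aC a0 h1 hf cz) => l Ll.
have := congr1 (fun F => F (SigSub (mem_set Ll))) h2.
exact.
Qed.

End Reconstruction.

Theorem theorem1p1 (R : realType) (Omega Lambda : set 'rV[R]_2)
  (p q : 'rV[R]_2) (mu : R) (a : 'rV[R]_2 -> R)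
  (Omega_domain : domain Omega)
  (Omega_bounded : bounded_set Omega)
  (Omega_strictly_convex : strictly_convex Omega)
  (Omega_C2 : C2_boundary Omega)
  (Lambda_arc : arc_with_endpoints Omega Lambda p q)
  (mu_bounds : 2^-1 < mu < 1)
  (a_C1holder : C1holder mu Omega a)
  (a_zero : forall z, ~ closure Omega z -> a z = 0) :
  exists Rec : (Lambda_plus Omega Lambda -> R) ->
               (cap_domain Omega Lambda p q -> R),
    forall f : 'rV[R]_2 -> R, C1holder0 mu Omega f ->
      Rec (sigL (Lambda_plus Omega Lambda) (attenuated_xray a f))
      = sigL (cap_domain Omega Lambda p q) f.
Proof.
apply: (reconstruction Omega_domain Omega_bounded Omega_strictly_convex Omega_C2
  Lambda_arc _ a_C1holder a_zero).
by case/andP: mu_bounds => mu_gt _; rewrite ltW// (lt_trans _ mu_gt)// invr_gt0.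
Qed.
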